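(* Let $M$ be a positive equilibrium, and let $\chi$ and $G_M$ be the vector of conserved modes and the associated Gram matrix $G_M=\int_{\mathbb R^6}\chi\chi^\tau M\,dx\,dv\in\mathbb R^{5\times5}$. The matrix $G_M$ is symmetric positive definite. If $f$ is a possibly signed function on $\mathbb R^6$ satisfying $$\int_{\mathbb R^6}(1+E+|\ell|)|f|\,dx\,dv<\infty,$$ then $$\Pi_Mf:=(c(f)\cdot\chi)M,\qquad c(f):=G_M^{-1}\int_{\mathbb R^6}\chi f\,dx\,dv,$$ is the unique element of $\operatorname{span}\{M,EM,\ell_1M,\ell_2M,\ell_3M\}$ having the same conserved moments as $f$, that is, $$\int_{\mathbb R^6}\chi\,\Pi_Mf\,dx\,dv=\int_{\mathbb R^6}\chi f\,dx\,dv.$$ Moreover, $\Pi_Mf$ lies in the kernel of the full linearized generator, including both the transport and collision parts, i.e. $h=\Pi_Mf$ satisfies $$-v\cdot\nabla_xh+\nabla_x\Phi\cdot\nabla_vh+Q(M,h)+Q(h,M)=0.$$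
   Context: Let $p\in(1,2)$ and $\Phi(x)=\frac1p\langle x\rangle^p$ with $\langle x\rangle=(1+|x|^2)^{1/2}$, or $p\in(2,\infty)$ and $\Phi(x)=\frac1p|x|^p$, $x\in\mathbb R^3$. A positive equilibrium is $M(x,v)=m\exp\{-\alpha(\Phi(x)+\frac12|v|^2)+Rx\cdot v\}$ with $m,\alpha>0$ and $R$ a real $3\times3$ skew-symmetric matrix, where $R=0$ when $p\in(1,2)$. Notation: $E(x,v)=\Phi(x)+\frac12|v|^2$; $\ell(x,v)=(x_1v_2-x_2v_1,\ x_1v_3-x_3v_1,\ x_2v_3-x_3v_2)^\tau$; $\chi=(1,E,\ell^\tau)^\tau\in\mathbb R^5$. Collision operator: $Q(F,G)(v)=\int_{\mathbb R^3\times\mathbb S^2}B(v-v_*,\sigma)[F(v_*')G(v')-F(v_* )G(v)]\,d\sigma dv_*$, with $v'=\frac{v+v_*}2+\frac{|v-v_*|}2\sigma$, $v'_*=\frac{v+v_*}2-\frac{|v-v_*|}2\sigma$, acting only on $v$; $B=|v-v_*|^\gamma b(\cos\theta)$, $\gamma\in(-3,1]$, $\cos\theta=\frac{v-v_*}{|v-v_*|}\cdot\sigma$; $b\ge0$ is supported in $0\le\theta\le\pi/2$ and satisfies either $\int_{\mathbb S^2}b(\hat z\cdot\sigma)d\sigma<\infty$ (cutoff) or $c_b\theta^{-2-2s}\le b(\cos\theta)\le C_b\theta^{-2-2s}$ for $0<\theta\le\pi/2$ with some $s\in(0,1)$, $0<c_b\le C_b<\infty$ (non-cutoff). The equation linearized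 about $M$ is $\partial_tf+v\cdot\nabla_xf-\nabla_x\Phi\cdot\nabla_vf=Q(M,f)+Q(f,M)$. *)

(* Defs.v *)
From HB Require Import structures.
From mathcomp Require Import all_boot all_order all_algebra.
From mathcomp Require Import all_classical all_reals all_analysis.
Set Implicit Arguments.
Unset Strict Implicit.
Unset Printing Implicit Defensive.
Import Order.TTheory GRing.Theory Num.Theory.
Import numFieldNormedType.Exports.
Local Open Scope classical_set_scope.
Local Open Scope ring_scope.

(* The norm that the library puts on matrices is the sup norm; [enorm] is the
   Euclidean one. *)
Definition dotp (R : realType) (n : nat) (u w : 'cV[R]_n) : R :=
  \sum_(i < n) u i 0 * w i 0.

Definition enorm (R : realType) (n : nat) (u : 'cV[R]_n) : R :=
  Num.sqrt (dotp u u).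

Definition dir (R : realType) (z : 'cV[R]_3) : 'cV[R]_3 := (enorm z)^-1 *: z.

Definition grad (R : realType) (g : 'cV[R]_3 -> R) (x : 'cV[R]_3) : 'cV[R]_3 :=
  \col_i 'D_(delta_mx i 0) g x.

Definition has_grad (R : realType) (g : 'cV[R]_3 -> R) (x : 'cV[R]_3) : Prop :=
  forall i : 'I_3, derivable g x (delta_mx i 0).

(* The library has no measure on ['cV[R]_3]: integrals over R^3 are taken over
   triples of reals with the product Lebesgue measure, and [pt] identifies a
   triple with a vector.  The library does not infer that a product of two
   sigma-finite measures is sigma-finite, hence [prod_sigma_finite] and the
   instances below. *)
Notation R3 R :=
  (measurableTypeR R * measurableTypeR R * measurableTypeR R)%type.

Definition pt (R : realType) (y : R3 R) : 'cV[R]_3 :=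
  \col_i [:: y.1.1 : R; y.1.2 : R; y.2 : R]`_i.

Lemma prod_sigma_finite (d1 d2 : measure_display) (T1 : measurableType d1)
    (T2 : measurableType d2) (R : realType)
    (m1 : {sigma_finite_measure set T1 -> \bar R})
    (m2 : {sigma_finite_measure set T2 -> \bar R}) :
  sigma_finite setT (m1 \x m2)%E.
Proof.
have /sigma_finiteP[F [TF ndF Foo]] := sigma_finiteT m1.
have /sigma_finiteP[G [TG ndG Goo]] := sigma_finiteT m2.
exists (fun n => F n `*` G n).
  rewrite -setXTT TF TG predeqE => -[x y]; split.
    move=> [/= [n _ Fnx] [k _ Gky]]; exists (maxn n k) => //; split.
    - by move: x Fnx; exact/subsetPset/ndF/leq_maxl.
    - by move: y Gky; exact/subsetPset/ndG/leq_maxr.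
  by move=> [n _ []/= ? ?]; split; exists n.
move=> k; have [? ?] := Foo k; have [? ?] := Goo k.
split; first exact: measurableX.
by rewrite product_measure1E// lte_mul_pinfty// ge0_fin_numE.
Qed.

Definition leb2 (R : realType) :=
  (@lebesgue_measure R \x @lebesgue_measure R)%E.
HB.instance Definition _ (R : realType) := Measure.on (@leb2 R).
HB.instance Definition _ (R : realType) :=
  Measure_isSigmaFinite.Build _ _ _ (@leb2 R) (prod_sigma_finite _ _).

Definition leb3 (R : realType) := (@leb2 R \x @lebesgue_measure R)%E.
HB.instance Definition _ (R : realType) := Measure.on (@leb3 R).
HB.instance Definition _ (R : realType) :=
  Measure_isSigmaFinite.Build _ _ _ (@leb3 R) (prod_sigma_finite _ _).

Definition leb6 (R : realType) := (@leb3 R \x @leb3 R)%E.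
HB.instance Definition _ (R : realType) := Measure.on (@leb6 R).
HB.instance Definition _ (R : realType) :=
  Measure_isSigmaFinite.Build _ _ _ (@leb6 R) (prod_sigma_finite _ _).

Definition int6 (R : realType) (g : 'cV[R]_3 -> 'cV[R]_3 -> R) : R :=
  \int[@leb6 R]_z g (pt z.1) (pt z.2).

(* Surface measure on S^2 is the cone measure
   sigma(A) = 3 * Leb {r w | 0 < r <= 1, w \in A}, that is,
   int_{S^2} g dsigma = 3 * int_{|y| <= 1} g (y / |y|) dy. *)
Definition unit_ball (R : realType) : set (R3 R) :=
  [set y | enorm (pt y) <= 1].

Definition sphere_int (R : realType) (g : 'cV[R]_3 -> \bar R) : \bar R :=
  (3%:E * \int[@leb3 R]_(y in @unit_ball R) g (dir (pt y)))%E.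

Definition bracket (R : realType) (x : 'cV[R]_3) : R :=
  Num.sqrt (1 + enorm x ^+ 2).

Definition Phi (R : realType) (p : R) (x : 'cV[R]_3) : R :=
  if p < 2 then p^-1 * bracket x `^ p else p^-1 * enorm x `^ p.

Definition energy (R : realType) (p : R) (x v : 'cV[R]_3) : R :=
  Phi p x + 2^-1 * enorm v ^+ 2.

Definition ell (R : realType) (x v : 'cV[R]_3) : 'cV[R]_3 :=
  \col_i [:: x 0 0 * v 1 0 - x 1 0 * v 0 0;
             x 0 0 * v 2 0 - x 2 0 * v 0 0;
             x 1 0 * v 2 0 - x 2 0 * v 1 0]`_i.

Definition chi (R : realType) (p : R) (x v : 'cV[R]_3) : 'cV[R]_5 :=
  col_mx 1%:M (col_mx (energy p x v)%:M (ell x v)).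

Definition positive_equilibrium (R : realType) (p : R)
    (M : 'cV[R]_3 -> 'cV[R]_3 -> R) : Prop :=
  exists (m alpha : R) (A : 'M[R]_3),
    [/\ 0 < m, 0 < alpha, A^T = - A, (p < 2 -> A = 0) &
        forall x v,
          M x v = m * expR (- alpha * energy p x v + dotp (A *m x) v)].

Definition moments (R : realType) (p : R) (f : 'cV[R]_3 -> 'cV[R]_3 -> R) :
    'cV[R]_5 :=
  \col_i int6 (fun x v => chi p x v i 0 * f x v).

Definition Gram (R : realType) (p : R) (M : 'cV[R]_3 -> 'cV[R]_3 -> R) :
    'M[R]_5 :=
  \matrix_(i, j) int6 (fun x v => (chi p x v *m (chi p x v)^T) i j * M x v).

Definition symmetric_posdef (R : realType) (n : nat) (G : 'M[R]_n) : Prop :=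
  G^T = G /\ forall u : 'cV[R]_n, u != 0 -> 0 < (u^T *m G *m u) 0 0.

Definition coefs (R : realType) (p : R) (M f : 'cV[R]_3 -> 'cV[R]_3 -> R) :
    'cV[R]_5 :=
  invmx (Gram p M) *m moments p f.

Definition Pi (R : realType) (p : R) (M f : 'cV[R]_3 -> 'cV[R]_3 -> R) :
    'cV[R]_3 -> 'cV[R]_3 -> R :=
  fun x v => dotp (coefs p M f) (chi p x v) * M x v.

Definition modes_span (R : realType) (p : R)
    (M : 'cV[R]_3 -> 'cV[R]_3 -> R) : set ('cV[R]_3 -> 'cV[R]_3 -> R) :=
  [set g | exists a : 'I_5 -> R,
     g = fun x v => \sum_(i < 5) a i * (chi p x v i 0 * M x v)].

Definition finite_moments (R : realType) (p : R)
    (f : 'cV[R]_3 -> 'cV[R]_3 -> R) : Prop :=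
  measurable_fun setT
    (fun z : (R3 R * R3 R)%type => f (pt z.1) (pt z.2)) /\
  (\int[@leb6 R]_z
     ((1 + energy p (pt z.1) (pt z.2) + enorm (ell (pt z.1) (pt z.2)))
      * `|f (pt z.1) (pt z.2)|)%:E < +oo)%E.

(* Here and below [b] is a function of cos theta. *)

Definition cutoff (R : realType) (b : R -> R) : Prop :=
  forall z : 'cV[R]_3, enorm z = 1 ->
    (sphere_int (fun s => (b (dotp z s))%:E) < +oo)%E.

Definition noncutoff (R : realType) (b : R -> R) : Prop :=
  exists s cb Cb : R, [/\ 0 < s < 1, 0 < cb <= Cb &
    forall theta : R, 0 < theta <= pi / 2 ->
      cb * theta `^ (- 2 - 2 * s) <= b (cos theta)
        <= Cb * theta `^ (- 2 - 2 * s)].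

Definition angular_kernel (R : realType) (b : R -> R) : Prop :=
  [/\ measurable_fun (`[-1, 1]%classic : set R) b,
      (forall u, -1 <= u <= 1 -> 0 <= b u),
      (forall theta : R, pi / 2 < theta <= pi -> b (cos theta) = 0) &
      cutoff b \/ noncutoff b].

Definition kernelB (R : realType) (gamma : R) (b : R -> R)
    (z s : 'cV[R]_3) : R :=
  enorm z `^ gamma * b (dotp (dir z) s).

Definition vpost (R : realType) (v vs s : 'cV[R]_3) : 'cV[R]_3 :=
  2^-1 *: (v + vs) + (2^-1 * enorm (v - vs)) *: s.

Definition vspost (R : realType) (v vs s : 'cV[R]_3) : 'cV[R]_3 :=
  2^-1 *: (v + vs) - (2^-1 * enorm (v - vs)) *: s.

Definition Qintegrand (R : realType) (gamma : R) (b : R -> R)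
    (F G : 'cV[R]_3 -> R) (v vs s : 'cV[R]_3) : R :=
  kernelB gamma b (v - vs) s *
  (F (vspost v vs s) * G (vpost v vs s) - F vs * G v).

(* For the non-cutoff kernel with s >= 1/2 the collision integral does not
   converge absolutely near theta = 0, and is understood as the limit
   eps -> 0+ of the integrals over {theta > eps}.  Where the integral over
   R^3 x S^2 converges absolutely (in particular under cutoff) this limit is
   that integral, by dominated convergence, as {theta = 0} is a null set.
   [angle_gt v eps] is {(v_*, y) | |y| <= 1, theta > eps} with
   sigma = y / |y|, cf. [sphere_int]; theta > eps is cos theta < cos eps. *)
Definition angle_gt (R : realType) (v : 'cV[R]_3) (eps : R) :
    set (R3 R * R3 R)%type :=
  [set z | @unit_ball R z.2 /\
           dotp (dir (v - pt z.1)) (dir (pt z.2)) < cos eps].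

Definition Qtrunc (R : realType) (gamma : R) (b : R -> R)
    (F G : 'cV[R]_3 -> R) (v : 'cV[R]_3) (eps : R) : R :=
  3 * \int[@leb6 R]_(z in angle_gt v eps)
        Qintegrand gamma b F G v (pt z.1) (dir (pt z.2)).

Definition Q (R : realType) (gamma : R) (b : R -> R)
    (F G : 'cV[R]_3 -> R) (v : 'cV[R]_3) : R :=
  lim (Qtrunc gamma b F G v eps @[eps --> 0^'+]).

Definition Q_converges (R : realType) (gamma : R) (b : R -> R)
    (F G : 'cV[R]_3 -> R) (v : 'cV[R]_3) : Prop :=
  (\forall eps \near 0^'+,
     (@leb6 R).-integrable (angle_gt v eps)
       (fun z => (Qintegrand gamma b F G v (pt z.1) (dir (pt z.2)))%:E)) /\
  cvg (Qtrunc gamma b F G v eps @[eps --> 0^'+]).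

(* [lim] and ['D_] are total, so the existence of the derivatives and of the
   collision integrals is stated along with the equation. *)
Definition in_kernel (R : realType) (p gamma : R) (b : R -> R)
    (M h : 'cV[R]_3 -> 'cV[R]_3 -> R) : Prop :=
  forall x v : 'cV[R]_3,
    [/\ has_grad (Phi p) x, has_grad (h ^~ v) x & has_grad (h x) v] /\
    [/\ Q_converges gamma b (M x) (h x) v,
        Q_converges gamma b (h x) (M x) v &
        - dotp v (grad (h ^~ v) x) + dotp (grad (Phi p) x) (grad (h x) v)
        + Q gamma b (M x) (h x) v + Q gamma b (h x) (M x) v = 0].

(* Main.v *)
(** The Gram matrix is positive definite because a vanishing combination
    [c0 + c1 E + (K x) . v] of the conserved modes is annihilated by all finite
    differences in [x] and [v]; uniqueness and equality of moments are then
    linear algebra.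

    For [h = (c0 + c1 E + (K x) . v) M] the transport part vanishes since
    [grad Phi] is parallel to [x] and both [K] and the matrix of [M] are
    skew-symmetric.  In the collision part [M M_*] is invariant under
    collisions, so that with [psi = h / M] the integrand of [Q(M, h)] is
    [B M M_* (psi(v') - psi(v))] and that of [Q(h, M)] is its opposite: the sum
    vanishes as soon as both integrals converge.

    Convergence for the non-cutoff kernel comes from averaging over the
      half-turn
    [sigma -> 2 (n . sigma) n - sigma] around the relative velocity [n], which
    preserves the surface measure and replaces [psi(v') - psi(v)], of order
    [theta], by a multiple of [1 - cos theta].  That [b (1 - cos theta)] is
    integrable uniformly in [n] is reduced to one direction by rotation
    invariance.  All singular integrals are bounded by products of
    one-dimensional ones, through [|z|^2 >= |z_1| |z_2|] and
    [|z|^3 >= |z_1 z_2 z_3|]. *)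

Require Import Defs.
From HB Require Import structures.
From mathcomp Require Import all_boot all_order all_algebra.
From mathcomp Require Import all_classical all_reals all_analysis.
From mathcomp Require Import measurable_realfun ring lra.
Set Implicit Arguments.
Unset Strict Implicit.
Unset Printing Implicit Defensive.
Import Order.TTheory GRing.Theory Num.Theory.
Import numFieldNormedType.Exports.
Local Open Scope classical_set_scope.
Local Open Scope ring_scope.

(** * Measure-preserving maps of the space of triples *)

(** The half-turn average is legitimate only after truncation to [theta > eps]: there the density is
    absolutely integrable, and the truncated set is invariant because the half-turn keeps
    [cos theta]. The averaged density is integrable with no truncation, so the limit at [eps = 0]
    exists by monotonicity of the integrals of its positive and negative parts. Both collision terms
    are written as [s] times one density, with [s = 1] and [s = -1]; their limits are thus opposite
    numbers and cancel without being computed.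

    The ranges of the exponents are used sharply. For [gamma < 0] the factor [|z|^gamma] is shared
    evenly by the three axes, each with exponent [gamma / 3], integrable at [0] exactly when
    [gamma > -3]. Without cutoff, [b (1 - cos theta)] is at most a multiple of [(sin theta)^(-2 s)];
    as [sin^2 theta >= |y_1| |y_2|] on the ball, this leaves the power [-s] on two axes, integrable
    since [s < 1]. Growth at infinity is never integrated directly: powers of [1 + E] are traded
    against the exponential for the product over coordinates of [1 / (1 + t^2)]. *)

Definition measure_preserving d (T : measurableType d) (R : realType)
    (m : {measure set T -> \bar R}) (f : T -> T) : Prop :=
  measurable_fun setT f /\
  forall g : T -> \bar R, measurable_fun setT g -> (forall x, (0 <= g x)%E) ->
    (\int[m]_x g (f x) = \int[m]_x g x)%E.

Lemma measure_preserving_comp d (T : measurableType d) (R : realType)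
    (m : {measure set T -> \bar R}) (f g : T -> T) :
  measure_preserving m f -> measure_preserving m g ->
  measure_preserving m (f \o g).
Proof.
move=> [mf If] [mg Ig]; split; first exact: measurableT_comp.
move=> k mk k0 /=; rewrite (Ig (k \o f))//= ?If//.
exact: measurableT_comp.
Qed.

Lemma measure_preserving_integral d (T : measurableType d) (R : realType)
    (m : {measure set T -> \bar R}) (f : T -> T) (g : T -> \bar R) :
  measure_preserving m f -> measurable_fun setT g ->
  (\int[m]_x g (f x) = \int[m]_x g x)%E.
Proof.
move=> [mf If] mg; rewrite integralE [RHS]integralE.
have -> : ((fun x => g (f x))^\+ = g^\+ \o f)%E by apply/funext=> x /=; rewrite
  !funeposE.
have -> : ((fun x => g (f x))^\- = g^\- \o f)%E by apply/funext=> x /=; rewrite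
  !funenegE.
by rewrite /= !If//; [exact: measurable_funeneg|exact: measurable_funepos].
Qed.

(** By Tonelli only the fibres matter, and the fibre map may depend on the base point in any jointly
    measurable way. This covers shears as well as the half-turn whose axis depends on [vs]; it is
    the reason to state preservation through integrals of nonnegative functions. *)
Lemma measure_preserving_skewr d1 d2 (T1 : measurableType d1)
    (T2 : measurableType d2) (R : realType)
    (m1 : {sigma_finite_measure set T1 -> \bar R})
    (m2 : {sigma_finite_measure set T2 -> \bar R}) (f : T1 -> T2 -> T2) :
  measurable_fun setT (fun z : T1 * T2 => f z.1 z.2) ->
  (forall u, measure_preserving m2 (f u)) ->
  measure_preserving (m1 \x m2)%E (fun z => (z.1, f z.1 z.2)).
Proof.
move=> mf If; have mF : measurable_fun [set: T1 * T2] (fun z => (z.1, f z.1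
  z.2)).
  by apply/measurable_fun_pair.
split=> // g mg g0.
rewrite (fubini_tonelli1 (fun z => g (z.1, f z.1 z.2)))//; last first.
  exact: (measurableT_comp mg).
rewrite (fubini_tonelli1 g mg g0); apply: eq_integral => u _.
rewrite /fubini_F/=; apply: (If u).2 => //.
exact: (measurableT_comp mg).
Qed.

Lemma measure_preserving_skewl d1 d2 (T1 : measurableType d1)
    (T2 : measurableType d2) (R : realType)
    (m1 : {sigma_finite_measure set T1 -> \bar R})
    (m2 : {sigma_finite_measure set T2 -> \bar R}) (f : T2 -> T1 -> T1) :
  measurable_fun setT (fun z : T1 * T2 => f z.2 z.1) ->
  (forall u, measure_preserving m1 (f u)) ->
  measure_preserving (m1 \x m2)%E (fun z => (f z.2 z.1, z.2)).
Proof.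
move=> mf If; have mF : measurable_fun [set: T1 * T2] (fun z => (f z.2 z.1,
  z.2)).
  by apply/measurable_fun_pair.
split=> // g mg g0.
rewrite (fubini_tonelli2 (fun z => g (f z.2 z.1, z.2)))//; last first.
  exact: (measurableT_comp mg).
rewrite (fubini_tonelli2 g mg g0); apply: eq_integral => u _.
rewrite /fubini_G/=.
apply: ((If u).2 (fun t => g (t, u))) => //.
exact: (measurableT_comp mg).
Qed.

Lemma measure_preserving_of_measure d (T : measurableType d) (R : realType)
    (m : {measure set T -> \bar R}) (f : T -> T) :
  measurable_fun setT f ->
  (forall A, measurable A -> m A = m (f @^-1` A)) -> measure_preserving m f.
Proof.
move=> mf mE; split=> // g mg g0.
have := @ge0_integral_pushforward _ _ _ _ R f mf m setT g measurableT mg.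
rewrite preimage_setT => <-; last by move=> x _; exact: g0.
by apply: eq_measure_integral => A mA _; rewrite mE.
Qed.

(** Uniqueness of Lebesgue measure: the pushforward under a translation agrees with it on half-open
    intervals. *)
Lemma measure_preserving_shift (R : realType) (a : R) :
  measure_preserving (@lebesgue_measure R) (fun t : measurableTypeR R => t + a :
    measurableTypeR R).
Proof.
have mf : measurable_fun setT (fun t : measurableTypeR R => t + a :
  measurableTypeR R).
  exact: measurable_funD.
apply: measure_preserving_of_measure => //.
pose h : {mfun measurableTypeR R >-> measurableTypeR R} :=
  HB.pack (fun t : measurableTypeR R => t + a : measurableTypeR R)
    (isMeasurableFun.Build _ _ _ _ _ mf).
move=> A mA.
apply: (@lebesgue_measure_unique R (pushforward lebesgue_measure h)) => //.
move=> _ [[b c]] _ <-; rewrite /pushforward/=.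
transitivity (@lebesgue_measure R `]b - a, c - a]%classic).
  rewrite !lebesgue_measure_itv/= !lte_fin ltrD2r.
  by case: ifP => //; rewrite -!EFinD => _; congr _%:E; ring.
congr (@lebesgue_measure R _).
by apply/seteqP; split=> t /=; rewrite !in_itv/= ltrBlDr lerBrDr.
Qed.

Lemma measure_preserving_opp (R : realType) :
  measure_preserving (@lebesgue_measure R) (fun t : measurableTypeR R => - t :
    measurableTypeR R).
Proof.
apply: measure_preserving_of_measure; first exact: oppr_measurable.
by move=> A mA; rewrite -[LHS]lebesgue_measureN.
Qed.

Lemma measure_preserving_id d (T : measurableType d) (R : realType)
    (m : {measure set T -> \bar R}) : measure_preserving m id.
Proof. by split. Qed.

Lemma measure_preserving_prod d1 d2 (T1 : measurableType d1)
    (T2 : measurableType d2) (R : realType)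
    (m1 : {sigma_finite_measure set T1 -> \bar R})
    (m2 : {sigma_finite_measure set T2 -> \bar R})
    (f : T1 -> T1) (g : T2 -> T2) :
  measure_preserving m1 f -> measure_preserving m2 g ->
  measure_preserving (m1 \x m2)%E (fun z => (f z.1, g z.2)).
Proof.
move=> mf mg.
have m2g : measure_preserving (m1 \x m2)%E (fun z => (z.1, g z.2)).
  apply: (measure_preserving_skewr m1 (f := fun=> g)) => //=.
  exact: measurableT_comp mg.1 measurable_snd.
have m1f : measure_preserving (m1 \x m2)%E (fun z => (f z.1, z.2)).
  apply: (measure_preserving_skewl m2 (f := fun=> f)) => //=.
  exact: measurableT_comp mf.1 measurable_fst.
exact: (measure_preserving_comp m1f m2g).
Qed.

Lemma measure_preserving_shift2 (R : realType) (a b : R) :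
  measure_preserving (@leb2 R)
    (fun q : measurableTypeR R * measurableTypeR R => (q.1 + a : measurableTypeR
      R, q.2 + b : measurableTypeR R)).
Proof.
exact: (measure_preserving_prod (measure_preserving_shift a)
                                (measure_preserving_shift b)).
Qed.

Lemma measure_preserving_shift3 (R : realType) (u : R3 R) :
  measure_preserving (@leb3 R)
    (fun y : R3 R => ((y.1.1 + u.1.1, y.1.2 + u.1.2), y.2 + u.2) : R3 R).
Proof.
exact: (measure_preserving_prod (measure_preserving_shift2 u.1.1 u.1.2)
                                (measure_preserving_shift u.2)).
Qed.

(** Over fixed first two coordinates a shear is a translation of the third, so no determinant is
    involved. Shears, flips and translations are the building blocks of all the maps used later. *)
Lemma measure_preserving_shear1 (R : realType) (a b : R) :
  measure_preserving (@leb3 R)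
    (fun y : R3 R => (y.1, y.2 + (a * y.1.1 + b * y.1.2)) : R3 R).
Proof.
apply: (@measure_preserving_skewr _ _ _ _ R (@leb2 R) lebesgue_measure
  (fun q t => t + (a * q.1 + b * q.2) : measurableTypeR R)).
  apply: measurable_funD => //; apply: measurable_funD; apply:
    measurable_funM => //;
  do ?[exact: measurableT_comp].
by move=> u; exact: measure_preserving_shift.
Qed.

Lemma measure_preserving_shear2 (R : realType) (a b : R) :
  measure_preserving (@leb3 R)
    (fun y : R3 R => ((y.1.1 + a * y.2, y.1.2 + b * y.2), y.2) : R3 R).
Proof.
apply: (@measure_preserving_skewl _ _ _ _ R (@leb2 R) lebesgue_measure
  (fun t q => (q.1 + a * t, q.2 + b * t))).
  by apply/measurable_fun_pair; apply: measurable_funD;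
   do ?[exact: measurableT_comp | apply: measurable_funM].
by move=> u; exact: measure_preserving_shift2.
Qed.

Lemma measure_preserving_flip3 (R : realType) :
  measure_preserving (@leb3 R) (fun y : R3 R => (y.1, - y.2) : R3 R).
Proof.
exact: (measure_preserving_prod (measure_preserving_id (@leb2 R))
                                (measure_preserving_opp R)).
Qed.

Lemma measure_preserving_flip12 (R : realType) :
  measure_preserving (@leb3 R)
    (fun y : R3 R => ((- y.1.1, - y.1.2), y.2) : R3 R).
Proof.
have F : measure_preserving (@leb2 R)
    (fun q : measurableTypeR R * measurableTypeR R =>
      (- q.1 : measurableTypeR R, - q.2 : measurableTypeR R)).
  exact: (measure_preserving_prod (measure_preserving_opp R)
                                  (measure_preserving_opp R)).
exact: (@measure_preserving_prod _ _ _ _ R (@leb2 R) lebesgue_measure _ id F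
  (measure_preserving_id _)).
Qed.

(** * Euclidean geometry of vectors: reflections and half-turns *)

Definition tup (R : realType) (u : 'cV[R]_3) : R3 R :=
  ((u 0 0, u 1 0), u 2 0).

Lemma ord3P (i : 'I_3) : [\/ i = 0, i = 1 | i = 2].
Proof.
by case: i => -[|[|[|//]]] h; [apply: Or31|apply: Or32|apply: Or33];
  apply/val_inj.
Qed.

Lemma tupK (R : realType) : cancel (@tup R) (@pt R).
Proof.
by move=> u; apply/colP => i; rewrite mxE; case: (ord3P i) => ->.
Qed.

Lemma dotp3 (R : realType) (u w : 'cV[R]_3) :
  dotp u w = u 0 0 * w 0 0 + u 1 0 * w 1 0 + u 2 0 * w 2 0.
Proof.
rewrite /dotp !big_ord_recl big_ord0 addr0 addrA.
by congr (u _ 0 * w _ 0 + u _ 0 * w _ 0 + u _ 0 * w _ 0); apply/val_inj.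
Qed.

(* Each reflection is conjugate under shears to the flip of the third axis:
   one shear maps the plane of the first two axes onto the orthogonal of [n],
   the other one takes the third axis to the direction of [n]. *)
Lemma measure_preserving_reflection (R : realType) (n : 'cV[R]_3) :
  n 2 0 != 0 -> dotp n n = 1 ->
  measure_preserving (@leb3 R)
    (fun y => tup (pt y - (2 * dotp n (pt y)) *: n)).
Proof.
move=> n3 n1.
have L := measure_preserving_shear1 (- (n 0 0 / n 2 0)) (- (n 1 0 / n 2 0)).
have L' := measure_preserving_shear1 (n 0 0 / n 2 0) (n 1 0 / n 2 0).
have U := measure_preserving_shear2 (n 0 0 * n 2 0) (n 1 0 * n 2 0).
have U' := measure_preserving_shear2 (- (n 0 0 * n 2 0)) (- (n 1 0 * n 2 0)).
have := measure_preserving_comp L (measure_preserving_comp U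
 (measure_preserving_comp (measure_preserving_flip3 R) (measure_preserving_comp
   U' L'))).
congr measure_preserving; apply/funext => -[[y0 y1] y2].
rewrite /comp /tup/= dotp3 !mxE /=.
move: n1 n3; rewrite dotp3; move: (n 0 0) (n 1 0) (n 2 0) => a b c n1 c0.
have n0 : a * a + b * b + c * c - 1 = 0 by rewrite n1 subrr.
congr (_, _, _); [by field|by field|].
(* Only the third coordinate uses [|n| = 1]: the two sides differ by a multiple of [|n|^2 - 1]. *)
apply/eqP; rewrite -subr_eq0; apply/eqP.
rewrite [LHS](_ : _ = 2 * (a * y0 + b * y1 + c * y2) *
  (a * a + b * b + c * c - 1) / c); last by field.
by rewrite n0 mulr0 mul0r.
Qed.

Definition basis3 (R : realType) (k : 'I_3) : 'cV[R]_3 := delta_mx k 0.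

Lemma dotpC (R : realType) n (u w : 'cV[R]_n) : dotp u w = dotp w u.
Proof. by apply: eq_bigr => i _; rewrite mulrC. Qed.

Lemma dotpDl (R : realType) n (u w t : 'cV[R]_n) :
  dotp (u + w) t = dotp u t + dotp w t.
Proof. by rewrite -big_split; apply: eq_bigr => i _; rewrite /= !mxE mulrDl.
  Qed.

Lemma dotpZl (R : realType) n (a : R) (u t : 'cV[R]_n) :
  dotp (a *: u) t = a * dotp u t.
Proof. by rewrite mulr_sumr; apply: eq_bigr => i _; rewrite !mxE mulrA. Qed.

Lemma dotpNl (R : realType) n (u t : 'cV[R]_n) : dotp (- u) t = - dotp u t.
Proof. by rewrite -scaleN1r dotpZl mulN1r. Qed.

Lemma dotpBl (R : realType) n (u w t : 'cV[R]_n) :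
  dotp (u - w) t = dotp u t - dotp w t.
Proof. by rewrite dotpDl dotpNl. Qed.

Lemma dotpDr (R : realType) n (t u w : 'cV[R]_n) :
  dotp t (u + w) = dotp t u + dotp t w.
Proof. by rewrite dotpC dotpDl !(dotpC _ t). Qed.

Lemma dotpZr (R : realType) n (a : R) (t u : 'cV[R]_n) :
  dotp t (a *: u) = a * dotp t u.
Proof. by rewrite dotpC dotpZl dotpC. Qed.

Lemma dotpNr (R : realType) n (t u : 'cV[R]_n) : dotp t (- u) = - dotp t u.
Proof. by rewrite dotpC dotpNl dotpC. Qed.

Lemma dotpBr (R : realType) n (t u w : 'cV[R]_n) :
  dotp t (u - w) = dotp t u - dotp t w.
Proof. by rewrite dotpDr dotpNr. Qed.

Lemma dotp_ge0 (R : realType) n (u : 'cV[R]_n) : 0 <= dotp u u.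
Proof. by apply: sumr_ge0 => i _; rewrite -expr2 sqr_ge0. Qed.

Lemma enorm_ge0 (R : realType) n (u : 'cV[R]_n) : 0 <= enorm u.
Proof. exact: sqrtr_ge0. Qed.

Lemma enorm_sqr (R : realType) n (u : 'cV[R]_n) : enorm u ^+ 2 = dotp u u.
Proof. by rewrite sqr_sqrtr// dotp_ge0. Qed.

Lemma enorm0 (R : realType) n : enorm (0 : 'cV[R]_n) = 0.
Proof.
by rewrite /enorm /dotp big1 ?sqrtr0// => i _; rewrite mxE mul0r.
Qed.

Lemma enorm_eq0 (R : realType) n (u : 'cV[R]_n) : (enorm u == 0) = (u == 0).
Proof.
apply/idP/idP => [|/eqP->]; last by rewrite enorm0.
rewrite -sqrf_eq0 enorm_sqr psumr_eq0; last first.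
  by move=> i _; rewrite -expr2 sqr_ge0.
move/allP => u0; apply/eqP/colP => i; rewrite mxE; apply/eqP.
by have /implyP := u0 i (mem_index_enum i); rewrite mulf_eq0 orbb; exact.
Qed.

Lemma dir_dir (R : realType) (z : 'cV[R]_3) : z != 0 -> dotp (dir z) (dir z) =
  1.
Proof.
move=> z0; rewrite /dir dotpZl dotpZr -enorm_sqr.
by have := z0; rewrite -enorm_eq0 => e0; field.
Qed.

Lemma dir0 (R : realType) : dir (0 : 'cV[R]_3) = 0.
Proof. by rewrite /dir scaler0. Qed.

Lemma dir_scale (R : realType) (z : 'cV[R]_3) : enorm z *: dir z = z.
Proof.
have [->|z0] := eqVneq z 0; first by rewrite dir0 scaler0.
by rewrite /dir scalerA divff ?scale1r// enorm_eq0.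
Qed.

Lemma dotp_dir_le1 (R : realType) (z : 'cV[R]_3) : dotp (dir z) (dir z) <= 1.
Proof.
have [->|z0] := eqVneq z 0; last by rewrite dir_dir.
by rewrite dir0 -enorm_sqr enorm0 expr0n.
Qed.

Lemma dotp_itv (R : realType) (u w : 'cV[R]_3) :
  dotp u u <= 1 -> dotp w w <= 1 -> -1 <= dotp u w <= 1.
Proof.
move=> u1 w1.
have : 0 <= dotp (u + w) (u + w) by exact: dotp_ge0.
have : 0 <= dotp (u - w) (u - w) by exact: dotp_ge0.
rewrite !(dotpDl, dotpDr, dotpNl, dotpNr) (dotpC w u) => h1 h2.
by apply/andP; split; lra.
Qed.

Definition reflection (R : realType) (n u : 'cV[R]_3) : 'cV[R]_3 :=
  u - (2 * dotp n u) *: n.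

Lemma reflectionD (R : realType) (n u w : 'cV[R]_3) :
  reflection n (u + w) = reflection n u + reflection n w.
Proof. by rewrite /reflection dotpDr mulrDr scalerDl opprD addrACA. Qed.

Lemma reflectionZ (R : realType) (n u : 'cV[R]_3) (a : R) :
  reflection n (a *: u) = a *: reflection n u.
Proof. by rewrite /reflection dotpZr scalerBr scalerA mulrCA. Qed.

Lemma reflectionN (R : realType) (n u : 'cV[R]_3) :
  reflection n (- u) = - reflection n u.
Proof. by rewrite -scaleN1r reflectionZ scaleN1r. Qed.

Lemma reflectionK (R : realType) (n u : 'cV[R]_3) :
  dotp n n = 1 -> reflection n (reflection n u) = u.
Proof.
move=> n1; rewrite /reflection dotpBr dotpZr n1 mulr1.
rewrite -addrA -opprD -scalerDl (_ : 2 * dotp n u + _ = 0) ?scale0r ?subr0//;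
  ring.
Qed.

Lemma reflection_dotp (R : realType) (n u w : 'cV[R]_3) :
  dotp n n = 1 -> dotp (reflection n u) (reflection n w) = dotp u w.
Proof.
move=> n1; rewrite /reflection !(dotpBl, dotpBr, dotpZl, dotpZr) n1.
by rewrite (dotpC u n); ring.
Qed.

Lemma basis3_dotp (R : realType) (k : 'I_3) (u : 'cV[R]_3) :
  dotp (basis3 R k) u = u k 0.
Proof.
rewrite /dotp (bigD1 k)//= mxE !eqxx mul1r big1 ?addr0// => i ik.
by rewrite mxE (negbTE ik) mul0r.
Qed.

(** The reflection in the plane bisecting [z] and the third basis vector [e], with normal [z - e].
    Its third component is nonzero because [|z - e|^2 = 2 (1 - z_2)], and this is what
    [measure_preserving_reflection] asks for. *)
Lemma exists_reflection (R : realType) (z : 'cV[R]_3) :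
  dotp z z = 1 -> z != basis3 R 2 -> exists n : 'cV[R]_3,
  [/\ n 2 0 != 0, dotp n n = 1 & reflection n (basis3 R 2) = z].
Proof.
move=> z1 ze; set e := basis3 R 2.
have ee : dotp e e = 1 by rewrite basis3_dotp mxE !eqxx.
have zee : dotp (z - e) (z - e) = 2 * (1 - z 2 0).
  by rewrite !(dotpBl, dotpBr) z1 ee (dotpC z e) basis3_dotp; ring.
have nz : enorm (z - e) != 0 by rewrite enorm_eq0 subr_eq0.
have nz2 : 2 * (1 - z 2 0) != 0 by rewrite -zee -enorm_sqr sqrf_eq0.
have z20 : 1 - z 2 0 != 0 by apply: contra nz2 => /eqP ->; rewrite mulr0.
exists (dir (z - e)); split.
- rewrite !mxE mulf_neq0 ?invr_eq0//.
  by rewrite !eqxx -oppr_eq0 opprB.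
- by rewrite dir_dir// subr_eq0.
- have ez : dotp (z - e) e = - (1 - z 2 0).
    by rewrite dotpC basis3_dotp !mxE !eqxx opprB.
  rewrite /reflection /dir dotpZl scalerA ez.
  rewrite (_ : 2 * _ * _ = -1).
    by rewrite scaleN1r opprK addrC subrK.
  have : enorm (z - e) ^+ 2 = 2 * (1 - z 2 0) by rewrite enorm_sqr.
  move: (enorm _) nz => c c0 c2.
  have -> : 1 - z 2 0 = c ^+ 2 / 2 by rewrite c2; field.
  by field.
Qed.

(** For a unit [z] this is the rotation by pi about the axis [z]. For [z = 0], which is the value of
    [dir 0], it degenerates to the central symmetry, which still preserves the measure. *)
Definition half_turn (R : realType) (z u : 'cV[R]_3) : 'cV[R]_3 :=
  (2 * dotp z u) *: z - u.

Lemma half_turn_dotp (R : realType) (z u : 'cV[R]_3) :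
  dotp z z = 1 -> dotp z (half_turn z u) = dotp z u.
Proof. by move=> z1; rewrite dotpBr dotpZr z1; ring. Qed.

Lemma half_turn_norm (R : realType) (z u : 'cV[R]_3) :
  dotp z z = 1 -> enorm (half_turn z u) = enorm u.
Proof.
move=> z1; rewrite /enorm /half_turn; congr Num.sqrt.
by rewrite !(dotpBl, dotpBr, dotpZl, dotpZr) z1 (dotpC u z); ring.
Qed.

Lemma half_turn0 (R : realType) (u : 'cV[R]_3) : half_turn 0 u = - u.
Proof. by rewrite /half_turn scaler0 add0r. Qed.

(** Conjugation by a reflection that exchanges the axis and the third basis vector reduces the turn
    to the sign change of the first two coordinates. *)
Lemma measure_preserving_half_turn (R : realType) (z : 'cV[R]_3) :
  measure_preserving (@leb3 R) (fun y => tup (half_turn (dir z) (pt y))).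
Proof.
have F12 : (fun y => tup (half_turn (basis3 R 2) (pt y))) =
    (fun y : R3 R => ((- y.1.1, - y.1.2), y.2) : R3 R).
  apply/funext => -[[a b] c]; rewrite /half_turn basis3_dotp /tup !mxE /=.
  by congr (_, _, _); ring.
have [->|z0] := eqVneq z 0.
  have := measure_preserving_comp (measure_preserving_flip12 R)
                                  (measure_preserving_flip3 R).
  congr measure_preserving; apply/funext => -[[a b] c].
  by rewrite dir0 half_turn0 /tup !mxE.
have z1 := dir_dir z0; move: (dir z) z1 => {z0} {}z z1.
(* Here the bisecting plane of [exists_reflection] is undefined, but the turn is already the
   coordinate flip. *)
have [->|ze] := eqVneq z (basis3 R 2).
  by rewrite F12; exact: measure_preserving_flip12.
have [n [n2 n1 nz]] := exists_reflection z1 ze.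
have H := measure_preserving_reflection n2 n1.
have F := measure_preserving_flip12 R; rewrite -F12 in F.
have := measure_preserving_comp H (measure_preserving_comp F H).
congr measure_preserving; apply/funext => y; rewrite /comp /= !tupK.
rewrite -!/(reflection _ _); congr tup.
rewrite /half_turn reflectionD reflectionN reflectionZ reflectionK// nz.
by rewrite -{1}(reflectionK (basis3 R 2) n1) nz reflection_dotp.
Qed.


(** * Measurability of vector-valued maps *)

Definition vmeasurable d (T : measurableType d) (R : realType) n
    (F : T -> 'cV[R]_n) : Prop :=
  forall i, measurable_fun setT (fun t => F t i 0).

Lemma vmeasurable_cst d (T : measurableType d) (R : realType) n (u : 'cV[R]_n) :
  vmeasurable (fun _ : T => u).
Proof. by move=> i; exact: measurable_cst. Qed.

Lemma vmeasurableD d (T : measurableType d) (R : realType) n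
    (F G : T -> 'cV[R]_n) :
  vmeasurable F -> vmeasurable G -> vmeasurable (fun t => F t + G t).
Proof.
move=> mF mG i.
rewrite (_ : (fun t => _) = (fun t => F t i 0) \+ (fun t => G t i 0)).
  exact: measurable_funD (mF i) (mG i).
by apply/funext => t /=; rewrite mxE.
Qed.

Lemma vmeasurableZ d (T : measurableType d) (R : realType) n
    (a : T -> R) (F : T -> 'cV[R]_n) :
  measurable_fun setT a -> vmeasurable F -> vmeasurable (fun t => a t *: F t).
Proof.
move=> ma mF i; rewrite (_ : (fun t => _) = a \* (fun t => F t i 0)).
  exact: measurable_funM ma (mF i).
by apply/funext => t /=; rewrite mxE.
Qed.

Lemma vmeasurableN d (T : measurableType d) (R : realType) n
    (F : T -> 'cV[R]_n) : vmeasurable F -> vmeasurable (fun t => - F t).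
Proof.
move=> mF; rewrite (_ : (fun t => - F t) = (fun t => -1 *: F t)).
  exact: vmeasurableZ.
by apply/funext => t; rewrite scaleN1r.
Qed.

Lemma vmeasurableB d (T : measurableType d) (R : realType) n
    (F G : T -> 'cV[R]_n) :
  vmeasurable F -> vmeasurable G -> vmeasurable (fun t => F t - G t).
Proof. by move=> mF mG; apply: vmeasurableD => //; exact: vmeasurableN. Qed.

Lemma measurable_sumr d (T : measurableType d) (R : realType) (I : Type)
    (s : seq I) (F : I -> T -> R) :
  (forall i, measurable_fun setT (F i)) ->
  measurable_fun setT (fun t => \sum_(i <- s) F i t).
Proof.
move=> mF; elim: s => [|i s IH].
  by under eq_fun do rewrite big_nil; exact: measurable_cst.
under eq_fun do rewrite big_cons.
exact: measurable_funD.
Qed.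

Lemma measurable_dotp d (T : measurableType d) (R : realType) n
    (F G : T -> 'cV[R]_n) :
  vmeasurable F -> vmeasurable G -> measurable_fun setT (fun t => dotp (F t) (G
    t)).
Proof.
move=> mF mG; rewrite /dotp.
apply: (@measurable_sumr _ _ _ _ (index_enum 'I_n) (fun i t => F t i 0 * G t i
  0)) => i.
exact: measurable_funM (mF i) (mG i).
Qed.

Lemma vmeasurable_mulmx d (T : measurableType d) (R : realType) n
    (A : 'M[R]_n) (F : T -> 'cV[R]_n) :
  vmeasurable F -> vmeasurable (fun t => A *m F t).
Proof.
move=> mF i; under eq_fun do rewrite mxE.
apply: (@measurable_sumr _ _ _ _ (index_enum 'I_n) (fun j t => A i j * F t j
  0)) => j.
by apply: measurable_funM => //; exact: mF.
Qed.

Lemma measurable_sqrt (R : realType) : measurable_fun setT (@Num.sqrt R).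
Proof. by apply: continuous_measurable_fun => x; exact: sqrt_continuous. Qed.

Lemma measurable_enorm d (T : measurableType d) (R : realType) n
    (F : T -> 'cV[R]_n) :
  vmeasurable F -> measurable_fun setT (fun t => enorm (F t)).
Proof.
by move=> mF; exact: measurableT_comp (@measurable_sqrt R) (measurable_dotp mF
  mF).
Qed.

Lemma vmeasurable_dir d (T : measurableType d) (R : realType)
    (F : T -> 'cV[R]_3) :
  vmeasurable F -> vmeasurable (fun t => dir (F t)).
Proof.
move=> mF; apply: vmeasurableZ => //.
rewrite (_ : (fun t => _) = (@powR R ^~ (-1)) \o (fun t => enorm (F t))).
  exact: measurableT_comp (measurable_powR _) (measurable_enorm mF).
by apply/funext => t /=; rewrite powR_inv1// enorm_ge0.
Qed.

Lemma vmeasurable_pt d (T : measurableType d) (R : realType) (g : T -> R3 R) :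
  measurable_fun setT g -> vmeasurable (fun t => pt (g t)).
Proof.
move=> mg i.
have m1 : measurable_fun setT (fun t => (g t).1).
  exact: measurableT_comp measurable_fst mg.
case: (ord3P i) => ->; under eq_fun do rewrite mxE /=.
- exact: measurableT_comp measurable_fst m1.
- exact: measurableT_comp measurable_snd m1.
- exact: measurableT_comp measurable_snd mg.
Qed.

Lemma measurable_tup d (T : measurableType d) (R : realType)
    (F : T -> 'cV[R]_3) :
  vmeasurable F -> measurable_fun setT (fun t => tup (F t)).
Proof.
move=> mF; apply/measurable_fun_pair; last exact: mF.
by apply/measurable_fun_pair; exact: mF.
Qed.

Lemma vmeasurable_half_turn d (T : measurableType d) (R : realType)
    (F G : T -> 'cV[R]_3) :
  vmeasurable F -> vmeasurable G -> vmeasurable (fun t => half_turn (F t) (G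
    t)).
Proof.
move=> mF mG; apply: vmeasurableB => //; apply: vmeasurableZ => //.
by apply: measurable_funM => //; exact: measurable_dotp.
Qed.

Lemma measurable_unit_ball (R : realType) : measurable (@unit_ball R).
Proof.
rewrite (_ : unit_ball (R := R) = (fun y : R3 R => enorm (pt y)) @^-1` `]-oo,
  1]%classic).
  rewrite -[X in measurable X]setTI; apply: measurable_enorm => //.
  exact: (vmeasurable_pt (@measurable_id _ _ _)).
by apply/seteqP; split => y; rewrite /unit_ball /= in_itv.
Qed.

Lemma measure_preserving_collision_turn (R : realType) (v : 'cV[R]_3) :
  measure_preserving (@leb6 R)
    (fun z : (R3 R * R3 R)%type =>
       (z.1, tup (half_turn (dir (v - pt z.1)) (pt z.2)))).
Proof.
apply: (@measure_preserving_skewr _ _ _ _ R (@leb3 R) (@leb3 R)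
  (fun u y => tup (half_turn (dir (v - pt u)) (pt y)))).
  apply: measurable_tup; apply: vmeasurable_half_turn.
    apply: vmeasurable_dir; apply: vmeasurableB; first exact: vmeasurable_cst.
    exact: vmeasurable_pt measurable_fst.
  exact: vmeasurable_pt measurable_snd.
by move=> u; exact: measure_preserving_half_turn.
Qed.

(** * Nonnegative functions with finite integral *)

Definition finite_integral d (T : measurableType d) (R : realType)
    (m : {measure set T -> \bar R}) (f : T -> R) : Prop :=
  [/\ measurable_fun setT f, (forall x, 0 <= f x) &
      (\int[m]_x (f x)%:E < +oo)%E].

Lemma finite_integral_le d (T : measurableType d) (R : realType)
    (m : {measure set T -> \bar R}) (f g : T -> R) :
  measurable_fun setT g -> (forall x, 0 <= g x <= f x) ->
  finite_integral m f -> finite_integral m g.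
Proof.
move=> mg gf [mf f0 foo]; split=> //; first by move=> x; have /andP[] := gf x.
apply: le_lt_trans foo; apply: ge0_le_integral => //.
- by move=> x _; rewrite lee_fin; have /andP[] := gf x.
- exact/measurable_EFinP.
- exact/measurable_EFinP.
- by move=> x _; rewrite lee_fin; have /andP[] := gf x.
Qed.

Lemma finite_integral_ae_le d (T : measurableType d) (R : realType)
    (m : {measure set T -> \bar R}) (f g : T -> R) :
  measurable_fun setT g -> (forall x, 0 <= g x) ->
  {ae m, forall x, g x <= f x} ->
  finite_integral m f -> finite_integral m g.
Proof.
move=> mg g0 gf [mf f0 foo]; split=> //.
apply: le_lt_trans foo; apply: ae_ge0_le_integral => //.
- by move=> x _; rewrite lee_fin.
- exact/measurable_EFinP.
- by move=> x _; rewrite lee_fin.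
- exact/measurable_EFinP.
- by apply: filterS gf => x gf _; rewrite lee_fin.
Qed.

Lemma finite_integralD d (T : measurableType d) (R : realType)
    (m : {measure set T -> \bar R}) (f g : T -> R) :
  finite_integral m f -> finite_integral m g ->
  finite_integral m (fun x => f x + g x).
Proof.
move=> [mf f0 foo] [mg g0 goo]; split.
- exact: measurable_funD.
- by move=> x; rewrite addr_ge0.
- under eq_integral do rewrite EFinD.
  rewrite ge0_integralD//; first exact: lte_add_pinfty.
  + by move=> x _; rewrite lee_fin.
  + exact/measurable_EFinP.
  + by move=> x _; rewrite lee_fin.
  + exact/measurable_EFinP.
Qed.

Lemma finite_integralZ d (T : measurableType d) (R : realType)
    (m : {measure set T -> \bar R}) (c : R) (f : T -> R) :
  0 <= c -> finite_integral m f -> finite_integral m (fun x => c * f x).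
Proof.
move=> c0 [mf f0 foo]; split.
- exact: measurable_funM.
- by move=> x; rewrite mulr_ge0.
- under eq_integral do rewrite EFinM.
  rewrite ge0_integralZl_EFin//; first exact: lte_mul_pinfty.
  + by move=> x _; rewrite lee_fin.
  + exact/measurable_EFinP.
Qed.

Lemma finite_integral_comp d (T : measurableType d) (R : realType)
    (m : {measure set T -> \bar R}) (h : T -> T) (f : T -> R) :
  measure_preserving m h -> finite_integral m f ->
  finite_integral m (fun x => f (h x)).
Proof.
move=> [mh Ih] [mf f0 foo]; split=> //; first exact: measurableT_comp.
rewrite (Ih (fun x => (f x)%:E))//; exact/measurable_EFinP.
Qed.

Lemma finite_integral_prod d1 d2 (T1 : measurableType d1)
    (T2 : measurableType d2) (R : realType)
    (m1 : {sigma_finite_measure set T1 -> \bar R})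
    (m2 : {sigma_finite_measure set T2 -> \bar R}) (f : T1 -> R) (g : T2 -> R) :
  finite_integral m1 f -> finite_integral m2 g ->
  finite_integral (m1 \x m2)%E (fun z => f z.1 * g z.2).
Proof.
move=> [mf f0 foo] [mg g0 goo].
have mfg : measurable_fun setT (fun z : T1 * T2 => f z.1 * g z.2).
  by apply: measurable_funM; exact: measurableT_comp.
split=> //; first by move=> z; rewrite mulr_ge0.
rewrite (fubini_tonelli1 (fun z => (f z.1 * g z.2)%:E)); last 2 first.
- exact/measurable_EFinP.
- by move=> z; rewrite lee_fin mulr_ge0.
rewrite /fubini_F /=.
under eq_integral => x _.
  under eq_integral do rewrite EFinM.
  rewrite ge0_integralZl_EFin//; [|by move=> y _; rewrite
    lee_fin|exact/measurable_EFinP].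
  over.
rewrite ge0_integralZr//.
- rewrite lte_mul_pinfty//; first by apply: integral_ge0 => x _; rewrite
  lee_fin.
  by rewrite ge0_fin_numE//; apply: integral_ge0 => x _; rewrite lee_fin.
- exact/measurable_EFinP.
- by move=> x _; rewrite lee_fin.
- by apply: integral_ge0 => x _; rewrite lee_fin.
Qed.

(** Tonelli with an inner integral bounded uniformly in the outer variable. It separates the weight
    in [vs] from the angular factor, whose axis depends on [vs]. *)
Lemma finite_integral_kernel d1 d2 (T1 : measurableType d1)
    (T2 : measurableType d2) (R : realType)
    (m1 : {sigma_finite_measure set T1 -> \bar R})
    (m2 : {sigma_finite_measure set T2 -> \bar R})
    (f : T1 -> R) (g : T1 -> T2 -> R) (C : R) :
  measurable_fun setT (fun z : T1 * T2 => g z.1 z.2) ->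
  (forall x y, 0 <= g x y) ->
  0 <= C -> (forall x, (\int[m2]_y (g x y)%:E <= C%:E)%E) ->
  finite_integral m1 f ->
  finite_integral (m1 \x m2)%E (fun z => f z.1 * g z.1 z.2).
Proof.
move=> mg g0 C0 gC [mf f0 foo].
have mfg : measurable_fun setT (fun z : T1 * T2 => f z.1 * g z.1 z.2).
  by apply: measurable_funM => //; exact: measurableT_comp.
have mgx x : measurable_fun setT (g x).
  exact: (measurableT_comp mg (pair1_measurable x)).
split=> //; first by move=> z; rewrite mulr_ge0.
rewrite (fubini_tonelli1 (fun z => (f z.1 * g z.1 z.2)%:E)); last 2 first.
- exact/measurable_EFinP.
- by move=> z; rewrite lee_fin mulr_ge0.
rewrite /fubini_F /=.
have [_ _ Cfoo] := finite_integralZ C0 (And3 mf f0 foo).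
apply: le_lt_trans Cfoo; apply: ge0_le_integral => //.
- by move=> x _; apply: integral_ge0 => y _; rewrite lee_fin mulr_ge0.
- apply: (measurable_fun_fubini_tonelli_F (m2 := m2) (fun z => (f z.1 * g z.1
  z.2)%:E)).
  + exact/measurable_EFinP.
  + by move=> z; rewrite lee_fin mulr_ge0.
- exact/measurable_EFinP/measurable_funM.
- move=> x _; under eq_integral do rewrite EFinM.
  rewrite ge0_integralZl_EFin//; last 2 first.
    by move=> y _; rewrite lee_fin.
    exact/measurable_EFinP.
  by rewrite mulrC EFinM lee_wpmul2l// lee_fin.
Qed.

(** * Integrable functions of one variable and their products *)

Definition invsqr1 (R : realType) (t : R) : R := (1 + t ^+ 2)^-1.

Lemma invsqr1_gt0 (R : realType) (t : R) : 0 < invsqr1 t.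
Proof. by rewrite invr_gt0 ltr_wpDr// sqr_ge0. Qed.

Lemma invsqr1_le1 (R : realType) (t : R) : invsqr1 t <= 1.
Proof. by rewrite invf_le1 ?ltr_wpDr ?sqr_ge0// lerDl sqr_ge0. Qed.

Lemma continuous_invsqr1 (R : realType) : continuous (@invsqr1 R).
Proof. by move=> t; exact: continuous_oneDsqrV. Qed.

Lemma finite_integral_invsqr1 (R : realType) :
  finite_integral (@lebesgue_measure R) (@invsqr1 R).
Proof.
split.
- by apply: continuous_measurable_fun; exact: continuous_invsqr1.
- by move=> t; exact/ltW/invsqr1_gt0.
- rewrite ge0_symfun_integralT.
  + rewrite -set_itvcy integral0y_oneDsqr.
    by rewrite -EFinM ltry.
  + by move=> t; exact/ltW/invsqr1_gt0.
  + exact: continuous_invsqr1.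
  + by move=> t; rewrite /invsqr1/= sqrrN.
Qed.

(** The cut keeps the singularity at [0] and drops the tail. With [k = 0] it is the indicator of
    [[-1, 1]], used for a coordinate that carries no singularity. *)
Definition local_power (R : realType) (k t : R) : R :=
  `|t| `^ (- k) * \1_(`[-1, 1]%classic : set R) t.

Lemma measurable_local_power (R : realType) (k : R) :
  measurable_fun setT (@local_power R k).
Proof.
apply: measurable_funM => //.
exact: measurableT_comp (measurable_powR _) (@normr_measurable _ _).
Qed.

(** Away from the singularity the primitive [t^(1-k) / (1-k)] is differentiable. The bound does not
    depend on [n], which allows the passage to the limit. *)
Lemma integral_power_cut (R : realType) (k : R) (n : nat) : k < 1 ->
  (\int[@lebesgue_measure R]_(t in `[(n.+1%:R^-1)%R, 1%R]) (t `^ (- k))%:E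
    <= ((1 - k)^-1)%:E)%E.
Proof.
(* For [n = 0] the interval is the single point [1], which the fundamental theorem of calculus below
   does not cover. *)
move=> k1; case: n => [|n].
  rewrite invr1 set_itv1 integral_set1 lee_fin invr_ge0; lra.
have n0 : (0 : R) < n.+2%:R^-1 by rewrite invr_gt0 ltr0n.
have n1 : n.+2%:R^-1 < (1 : R) by rewrite invf_lt1 ?ltr0n// ltr1n.
pose F (t : R) := (1 - k)^-1 * t `^ (1 - k).
have k1' : 1 - k != 0 by lra.
have dF (t : R) : 0 < t -> is_derive t 1 F (t `^ (- k)).
  move=> t0; have := is_deriveZ (1 - k)^-1 (is_derive1_powR (1 - k) t0).
  rewrite {1}/GRing.scale/= mulrA mulVf// mul1r.
  by rewrite (_ : 1 - k - 1 = - k); last by ring.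
have cF (t : R) : 0 < t -> {for t, continuous F}.
  by move=> t0; apply/differentiable_continuous/derivable1_diffP; case: (dF t
    t0).
rewrite (@continuous_FTC2 _ _ F)//.
- rewrite -EFinB lee_fin /F powR1 mulr1 lerBlDr lerDl mulr_ge0 ?powR_ge0//.
  rewrite invr_ge0; lra.
- apply: derivable_within_continuous => t; rewrite in_itv/= => /andP[tn _].
  by apply: derivable_powR; rewrite in_itv/= andbT (lt_le_trans n0).
- split.
  + by move=> t; rewrite in_itv/= => /andP[tn _]; case: (dF t (lt_trans n0 tn)).
  + by apply: cvg_at_right_filter; exact: cF.
  + by apply: cvg_at_left_filter; exact: cF.
- move=> t; rewrite in_itv/= => /andP[tn _].
  by rewrite derive1E; case: (dF t (lt_trans n0 tn)).
Qed.

(** Monotone convergence along the exhaustion of []0, 1]] by the intervals [[1/(n+1), 1]]. *)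
Lemma integral_power01 (R : realType) (k : R) : k < 1 ->
  (\int[@lebesgue_measure R]_(t in `]0%R, 1%R]) (t `^ (- k))%:E
    <= ((1 - k)^-1)%:E)%E.
Proof.
move=> k1.
have -> : `]0, 1]%classic = \bigcup_n `[n.+1%:R^-1, (1:R)]%classic.
  apply/seteqP; split=> t /=; rewrite in_itv/=.
    move=> /andP[t0 t1]; have [n tn] := ltr_add_invr t0.
    by exists n => //=; rewrite in_itv/= t1 andbT -[_^-1]add0r ltW.
  move=> [n _ /=]; rewrite in_itv/= => /andP[tn ->]; rewrite andbT.
  by apply: lt_le_trans tn; rewrite invr_gt0 ltr0n.
have mpow (D : set R) : measurable_fun D (fun t => (t `^ (- k))%:E).
  by apply/measurable_EFinP/measurable_funTS; exact: measurable_powR.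
pose I n : set (measurableTypeR R) := `[n.+1%:R^-1, 1]%classic.
have ndI : nondecreasing_seq I.
  apply/nondecreasing_seqP => n; rewrite subsetEset => t /=.
  rewrite /I/= !in_itv/= => /andP[tn ->]; rewrite andbT (le_trans _ tn)//.
  by rewrite lef_pV2 ?posrE ?ltr0n// ler_nat.
have mI n : measurable (I n) by exact: measurable_itv.
have pow0 n (t : R) : I n t -> (0 <= (t `^ (- k))%:E)%E.
  by move=> _; rewrite lee_fin powR_ge0.
have cv := @ge0_nondecreasing_set_cvg_integral _ (measurableTypeR R) R
  I (fun t => (t `^ (- k))%:E) (@lebesgue_measure R) ndI mI
  (fun n => mpow (I n)) pow0.
rewrite -(cvg_lim _ cv)//; apply: lime_le.
  by apply/cvg_ex; eexists; exact: cv.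
by apply: nearW => n; exact: integral_power_cut.
Qed.

Lemma finite_integral_local_power (R : realType) (k : R) :
  k < 1 -> finite_integral (@lebesgue_measure R) (local_power k).
Proof.
move=> k1.
pose g (t : R) := `|t| `^ (- k) * \1_(`[0, 1]%classic : set R) t.
have g0 t : 0 <= g t by rewrite mulr_ge0// powR_ge0.
have mg : measurable_fun setT g.
  apply: measurable_funM => //.
  exact: measurableT_comp (measurable_powR _) (@normr_measurable _ _).
have fg : finite_integral (@lebesgue_measure R) g.
  split=> //.
  have -> : (\int[@lebesgue_measure R]_t (g t)%:E =
      \int[@lebesgue_measure R]_(t in `[0%R, 1%R]) (t `^ (- k))%:E)%E.
    rewrite [RHS]integral_mkcond; apply: eq_integral => t _.
    rewrite patchE /g indicE; case: ifPn => /=; last by rewrite mulr0.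
    by rewrite inE/= in_itv/= => /andP[t0 _]; rewrite mulr1 ger0_norm.
  rewrite -integral_itv_obnd_cbnd.
    by apply: le_lt_trans (integral_power01 k1) _; rewrite ltry.
  by apply/measurable_EFinP/measurable_funTS; exact: measurable_powR.
(* The two halves of [[-1, 1]] overlap at [0], so the sum of [g] and its mirror image is only an
   upper bound. *)
apply: finite_integral_le (finite_integralD fg
  (finite_integral_comp (measure_preserving_opp R) fg)).
  exact: measurable_local_power.
move=> t; apply/andP; split; first by rewrite mulr_ge0// powR_ge0.
rewrite /local_power /g normrN -mulrDr ler_wpM2l ?powR_ge0//.
rewrite !indicE !mem_setE !in_itv/=.
have [t0|t0] := leP 0 t.
  have -> : -1 <= t by lra.
  by rewrite /= lerDl ler0n.
have -> : 0 <= - t by lra.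
have -> : t <= 1 by lra.
by rewrite lerNl andbT add0r.
Qed.

(** Within distance [1] of [a] the weight is at most [1] and the singularity is a local power;
    farther away the power is at most [1]. Together they give the majorant
    [2 * invsqr1 t + local_power k (a - t)]. *)
Lemma finite_integral_shifted_power (R : realType) (k a : R) :
  0 <= k < 1 ->
  finite_integral (@lebesgue_measure R)
    (fun t => (1 + `|a - t| `^ (- k)) * invsqr1 t).
Proof.
move=> /andP[k0 k1].
have mdiff : measurable_fun setT (fun t : measurableTypeR R => a - t).
  exact: measurable_funB.
have fl : finite_integral (@lebesgue_measure R) (fun t => local_power k (a -
  t)).
  have := finite_integral_comp (measure_preserving_comp
    (measure_preserving_shift a)
    (measure_preserving_opp R)) (finite_integral_local_power k1).
  by under eq_fun do rewrite /= addrC.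
have [mw _ _] := finite_integral_invsqr1 R.
apply: finite_integral_le (finite_integralD
  (finite_integralZ (c := 2) _ (finite_integral_invsqr1 R)) fl) => //.
  apply: measurable_funM => //; apply: measurable_funD => //.
  apply: measurableT_comp (measurable_powR _) _.
  exact: measurableT_comp (@normr_measurable _ _) mdiff.
move=> t; have w0 := invsqr1_gt0 t; have w1 := invsqr1_le1 t.
have p0 := powR_ge0 `|a - t| (- k).
apply/andP; split; first by rewrite mulr_ge0 ?addr_ge0// ltW.
rewrite /local_power indicE mem_setE in_itv/= -ler_norml.
have [t1|t1] := leP `|a - t| 1; first by rewrite mulr1; nra.
have : `|a - t| `^ (- k) <= 1.
  by rewrite -[leRHS](powRr0 `|a - t|) ler_powR ?oppr_le0// ltW.
by rewrite mulr0 addr0; nra.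
Qed.

(** The coordinate planes through [a] are products with a singleton factor, hence null. They have to
    be discarded because a nonzero power of [0] is [0], which breaks the bounds by one-dimensional
    powers there. *)
Lemma ae_coordinates_neq (R : realType) (a : R3 R) :
  {ae @leb3 R, forall y, [/\ y.1.1 != a.1.1, y.1.2 != a.1.2 & y.2 != a.2]}.
Proof.
have T0 c : @lebesgue_measure R [set c] = 0%E by rewrite lebesgue_measure_set1.
have mc (c : R) : measurable ([set c] : set (measurableTypeR R)).
  exact: measurable_set1.
have mT : measurable [set: measurableTypeR R] by exact: measurableT.
have M1 : @leb2 R ([set a.1.1] `*` setT) = 0%E.
  by rewrite /leb2 product_measure1E// [X in (X * _)%E](T0 a.1.1) mul0e.
have M2 : @leb2 R (setT `*` [set a.1.2]) = 0%E.
  by rewrite /leb2 product_measure1E// [X in (_ * X)%E](T0 a.1.2) mule0.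
have P3 A B : measurable A -> measurable B ->
    @leb3 R (A `*` B) = (@leb2 R A * @lebesgue_measure R B)%E.
  exact: (@product_measure1E _ _ _ _ R (@leb2 R) (@lebesgue_measure R)).
have N1 : (@leb3 R).-negligible ((([set a.1.1] `*` setT) `*` setT) : set (R3
  R)).
  apply/negligibleP; first by apply: measurableX => //; exact: measurableX.
  apply: etrans (P3 _ _ _ _) _ => //; first exact: measurableX.
  by rewrite M1 mul0e.
have N2 : (@leb3 R).-negligible (((setT `*` [set a.1.2]) `*` setT) : set (R3
  R)).
  apply/negligibleP; first by apply: measurableX => //; exact: measurableX.
  apply: etrans (P3 _ _ _ _) _ => //; first exact: measurableX.
  by rewrite M2 mul0e.
have N3 : (@leb3 R).-negligible ((setT `*` [set a.2]) : set (R3 R)).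
  apply/negligibleP; first exact: measurableX.
  by apply: etrans (P3 _ _ _ _) _ => //; rewrite (T0 a.2) mule0.
apply: negligibleS (negligibleU N1 (negligibleU N2 N3)) => -[[x y] z] /=.
apply: contra_notP => /not_orP[h1 /not_orP[h2 h3]]; split.
- by apply/eqP => xa; apply: h1; split.
- by apply/eqP => ya; apply: h2; split.
- by apply/eqP => za; apply: h3; split.
Qed.

Lemma finite_integral_leb3 (R : realType) (f g h : R -> R) :
  finite_integral (@lebesgue_measure R) f ->
  finite_integral (@lebesgue_measure R) g ->
  finite_integral (@lebesgue_measure R) h ->
  finite_integral (@leb3 R) (fun y => f y.1.1 * g y.1.2 * h y.2).
Proof.
move=> ff fg fh.
have ffg : finite_integral (@leb2 R) (fun q => f q.1 * g q.2).
  exact: finite_integral_prod.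
exact: (@finite_integral_prod _ _ _ _ R (@leb2 R) (@lebesgue_measure R)
  (fun q => f q.1 * g q.2) h).
Qed.

Lemma vmeasurable_idpt (R : realType) : vmeasurable (@pt R).
Proof. exact: (vmeasurable_pt (@measurable_id _ _ _)). Qed.

Lemma measurable_ball_indic (R : realType) :
  measurable_fun setT (\1_(@unit_ball R) : R3 R -> R).
Proof. by apply: measurable_indic; exact: measurable_unit_ball. Qed.

Lemma coord_sqr_le (R : realType) (u : 'cV[R]_3) (i : 'I_3) :
  u i 0 ^+ 2 <= enorm u ^+ 2.
Proof.
rewrite enorm_sqr /dotp (bigD1 i)//= -expr2 lerDl.
by apply: sumr_ge0 => j _; rewrite -expr2 sqr_ge0.
Qed.

Lemma coord_le_enorm (R : realType) (u : 'cV[R]_3) (i : 'I_3) :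
  `|u i 0| <= enorm u.
Proof.
rewrite -(ler_pXn2r (n := 2)) ?nnegrE ?enorm_ge0//.
by rewrite real_normK ?num_real// coord_sqr_le.
Qed.

Lemma unit_ball_coord (R : realType) (y : R3 R) : unit_ball y ->
  [/\ `|y.1.1| <= 1, `|y.1.2| <= 1 & `|y.2| <= 1].
Proof.
rewrite /unit_ball/= => y1; have h i := le_trans (coord_le_enorm (pt y) i) y1.
by have := (h 0, h 1, h 2); rewrite !mxE/= => -[[]].
Qed.

Lemma finite_integral_ball_indic (R : realType) :
  finite_integral (@leb3 R) (\1_(@unit_ball R)).
Proof.
have l0 := finite_integral_local_power (ltr01 : (0 : R) < 1).
apply: finite_integral_le (finite_integral_leb3 l0 l0 l0).
  exact: measurable_ball_indic.
move=> y; rewrite indicE ler0n/=; have [|_] := boolP (y \in _).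
  rewrite inE => /unit_ball_coord[y1 y2 y3].
  rewrite /local_power !indicE !mem_setE !in_itv/= -!ler_norml y1 y2 y3.
  by rewrite oppr0 !powRr0 !mulr1.
by rewrite !mulr_ge0 ?powR_ge0//.
Qed.

(** The reflection taking the third axis to [z] preserves the measure, the norm and hence the ball,
    so the angular integral is the same for every unit axis. *)
Lemma ball_rotation (R : realType) (z : 'cV[R]_3) (g : R -> R) :
  dotp z z = 1 -> measurable_fun setT g -> (forall u, 0 <= g u) ->
  (\int[@leb3 R]_y (g (dotp z (dir (pt y))) * \1_(@unit_ball R) y)%:E =
   \int[@leb3 R]_y (g (dir (pt y) 2 0) * \1_(@unit_ball R) y)%:E)%E.
Proof.
move=> z1 mg g0.
have [->|ze] := eqVneq z (basis3 R 2).
  by apply: eq_integral => y _; rewrite basis3_dotp.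
have [n [n2 n1 nz]] := exists_reflection z1 ze.
have [_ <-] := measure_preserving_reflection n2 n1.
- apply: eq_integral => y _; rewrite tupK -/(reflection n (pt y)).
  have en : enorm (reflection n (pt y)) = enorm (pt y).
    by rewrite /enorm reflection_dotp.
  congr (g _ * _)%:E.
    by rewrite /dir en dotpZr -nz reflection_dotp// basis3_dotp !mxE.
  rewrite !indicE; congr (nat_of_bool _)%:R; apply/idP/idP; rewrite !inE
    /unit_ball/=.
    by rewrite tupK -/(reflection n (pt y)) en.
  by rewrite tupK -/(reflection n (pt y)) en.
- apply/measurable_EFinP/measurable_funM; last exact: measurable_ball_indic.
  apply: measurableT_comp mg _; apply: measurable_dotp.
    exact: vmeasurable_cst.
  by apply: vmeasurable_dir; exact: vmeasurable_idpt.
- by move=> y; rewrite lee_fin mulr_ge0.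
Qed.

(** Uniformity in the axis is what Tonelli needs when the axis is the relative velocity. The
    degenerate axis [dir 0 = 0], for which the cosine is [0], is included. *)
Definition angular_bound (R : realType) (g : R -> R) (C : R) : Prop :=
  0 <= C /\ forall v : 'cV[R]_3,
  (\int[@leb3 R]_y (g (dotp (dir v) (dir (pt y))) * \1_(@unit_ball R) y)%:E
    <= C%:E)%E.

Lemma angular_bound_of_finite (R : realType) (g : R -> R) :
  measurable_fun setT g -> (forall u, 0 <= g u) ->
  (\int[@leb3 R]_y (g (dir (pt y) 2%R 0%R) * \1_(@unit_ball R) y)%:E < +oo)%E ->
  exists C, angular_bound g C.
Proof.
move=> mg g0 goo.
have [mb b0 boo] := finite_integralZ (g0 0) (finite_integral_ball_indic R).
have fin (h : R3 R -> R) : (forall y, 0 <= h y) ->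
    (\int[@leb3 R]_y (h y)%:E < +oo)%E ->
    (\int[@leb3 R]_y (h y)%:E = (fine (\int[@leb3 R]_y (h y)%:E))%:E)%E.
  move=> h0 hoo; rewrite fineK// ge0_fin_numE//.
  by apply: integral_ge0 => y _; rewrite lee_fin.
have ge0 (h : R3 R -> R) : (forall y, 0 <= h y) ->
    0 <= fine (\int[@leb3 R]_y (h y)%:E)%E.
  by move=> h0; rewrite fine_ge0// integral_ge0// => y _; rewrite lee_fin.
have G0 y : 0 <= g (dir (pt y) 2 0) * \1_(@unit_ball R) y by rewrite mulr_ge0.
(* The first summand serves the degenerate axis, the second one all unit axes. *)
exists (fine (\int[@leb3 R]_y (g 0%R * \1_(@unit_ball R) y)%:E)%E +
  fine (\int[@leb3 R]_y (g (dir (pt y) 2%R 0%R) * \1_(@unit_ball R) y)%:E)%E).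
split; first by rewrite addr_ge0 ?ge0.
move=> v; have [->|v0] := eqVneq v 0.
  have E y : dotp (dir 0) (dir (pt y)) = 0.
    by rewrite dir0 /dotp big1// => i _; rewrite mxE mul0r.
  under eq_integral do rewrite E.
  by rewrite fin// lee_fin lerDl ge0.
rewrite ball_rotation//; last exact: dir_dir.
by rewrite fin// lee_fin lerDr ge0.
Qed.

(** * Angular kernels *)

Lemma ler_powRN (R : realType) (x y r : R) :
  0 <= r -> 0 < x <= y -> y `^ (- r) <= x `^ (- r).
Proof.
move=> r0 /andP[x0 xy]; have y0 := lt_le_trans x0 xy.
rewrite !powRN lef_pV2 ?posrE ?powR_gt0//.
by rewrite ge0_ler_powR ?nnegrE// ltW.
Qed.

Lemma sin_le (R : realType) (x : R) : 0 <= x -> sin x <= x.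
Proof.
rewrite le_eqVlt => /predU1P[<-|x0]; first by rewrite sin0.
have [c _] := @MVT R sin cos 0 x x0 (fun t _ => is_derive_sin t)
  (continuous_subspaceT (@continuous_sin R)).
rewrite sin0 !subr0 => ->; have := cos_le1 c; nra.
Qed.

(* [angular_kernel] says nothing about [b] outside [[-1, 1]]. *)
Definition clip (R : realType) (b : R -> R) : R -> R := b \_ `[-1, 1]%classic.

Lemma clipE (R : realType) (b : R -> R) (u : R) :
  clip b u = if -1 <= u <= 1 then b u else 0.
Proof. by rewrite /clip patchE mem_setE in_itv. Qed.

Lemma clip_ge0 (R : realType) (b : R -> R) (u : R) :
  angular_kernel b -> 0 <= clip b u.
Proof. by case=> _ b0 _ _; rewrite clipE; case: ifP => // /b0. Qed.

Lemma clip_lt0 (R : realType) (b : R -> R) (u : R) :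
  angular_kernel b -> u < 0 -> clip b u = 0.
Proof.
case=> _ _ b0 _ u0; rewrite clipE; case: ifP => // /[dup] u1 /andP[uN1 _].
rewrite -[u]acosK ?in_itv//=; apply: b0; rewrite acos_lepi// andbT.
rewrite -ltr_cos ?in_itv/= ?acos_ge0 ?acos_lepi//.
  by rewrite cos_pihalf acosK ?in_itv.
by have := pi_gt0 R; lra.
Qed.

Lemma measurable_clip (R : realType) (b : R -> R) :
  angular_kernel b -> measurable_fun setT (clip b).
Proof.
by case=> mb _ _ _; apply/(measurable_restrictT _ _).1 => //; exact:
  measurable_itv.
Qed.

Lemma clip_noncutoff (R : realType) (b : R -> R) (s cb Cb : R) :
  angular_kernel b ->
  (forall theta : R, 0 < theta <= pi / 2 ->
      cb * theta `^ (- 2 - 2 * s) <= b (cos theta)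
        <= Cb * theta `^ (- 2 - 2 * s)) ->
  forall u, 0 <= u < 1 -> clip b u <= Cb * acos u `^ (- 2 - 2 * s).
Proof.
move=> ab bC u /andP[u0 u1]; have uI : -1 <= u <= 1 by apply/andP; split; lra.
rewrite clipE uI -{1}(acosK uI).
have : 0 < acos u <= pi / 2.
  rewrite acos_gt0 ?u1 ?andbT//=; last by lra.
  rewrite leNgt -ltr_cos ?in_itv/= ?acos_ge0 ?acos_lepi//; last first.
    by have := pi_gt0 R; lra.
  by rewrite cos_pihalf acosK ?in_itv// -leNgt.
by move=> /bC /andP[].
Qed.

Lemma cutoff_clip_finite (R : realType) (b : R -> R) :
  angular_kernel b -> cutoff b ->
  (\int[@leb3 R]_y (clip b (dir (pt y) 2%R 0%R) * \1_(@unit_ball R) y)%:E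
    < +oo)%E.
Proof.
move=> ab cb.
have e1 : enorm (basis3 R 2) = 1.
  by rewrite /enorm basis3_dotp mxE !eqxx sqrtr1.
have := cb _ e1; rewrite /sphere_int integral_mkcond.
have -> : (\int[@leb3 R]_y ((fun y => (b (dotp (basis3 R 2) (dir (pt y))))%:E)
  \_ (@unit_ball R)) y
  = \int[@leb3 R]_y (clip b (dir (pt y) 2%R 0%R) * \1_(@unit_ball R) y)%:E)%E.
  apply: eq_integral => y _; rewrite patchE indicE.
  case: ifPn; last by rewrite mulr0.
  rewrite mulr1 basis3_dotp clipE -[dir (pt y) 2 0]basis3_dotp.
  by rewrite dotp_itv// ?dotp_dir_le1// basis3_dotp mxE !eqxx.
have : (0 <= \int[@leb3 R]_y (clip b (dir (pt y) 2%R 0%R) * \1_(@unit_ball R)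
  y)%:E)%E.
  by apply: integral_ge0 => y _; rewrite lee_fin mulr_ge0// clip_ge0.
(* Finiteness is known for [3] times the integral: an infinite integral would stay infinite after
   that factor, and minus infinity is excluded by the sign. *)
case: (integral _ _ _) => [r _ _|_|//]; first exact: ltry.
by rewrite mulry gtr0_sg// mul1e ltxx.
Qed.

(** Under cutoff the kernel itself is integrable; otherwise it is bounded on [theta > eps], since
    its negative power of [theta] is largest at [eps]. *)
Lemma angular_bound_trunc (R : realType) (b : R -> R) (eps : R) :
  angular_kernel b -> 0 < eps < pi / 2 ->
  exists C, angular_bound (fun u => clip b u * (u < cos eps)%R%:R) C.
Proof.
move=> ab /andP[eps0 eps1]; have mb := measurable_clip ab.
have mi : measurable_fun setT (fun u : R => (u < cos eps)%R%:R : R).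
  rewrite (_ : (fun u => _) = \1_(`]-oo, cos eps[%classic : set R)).
    by apply: measurable_indic; exact: measurable_itv.
  by apply/funext => u; rewrite indicE mem_setE in_itv.
have mg : measurable_fun setT (fun u : R => clip b u * (u < cos eps)%R%:R).
  exact: measurable_funM.
have mdir : measurable_fun setT (fun y : R3 R => dir (pt y) 2 0).
  by apply: vmeasurable_dir; exact: vmeasurable_idpt.
have g0 u : 0 <= clip b u * (u < cos eps)%R%:R by rewrite mulr_ge0 ?clip_ge0.
apply: angular_bound_of_finite => //.
have mh : measurable_fun setT (fun y => clip b (dir (pt y) 2 0) *
    (dir (pt y) 2 0 < cos eps)%R%:R * \1_(@unit_ball R) y).
  apply: measurable_funM; last exact: measurable_ball_indic.
  exact: (measurableT_comp mg mdir).
set h := (fun y => _) in mh.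
suff : finite_integral (@leb3 R) h by case.
have hle (c : R3 R -> R) : (forall y, clip b (dir (pt y) 2 0) *
    (dir (pt y) 2 0 < cos eps)%R%:R <= c y) ->
    forall y, 0 <= h y <= c y * \1_(@unit_ball R) y.
  by move=> gc y; rewrite mulr_ge0//=; apply: ler_wpM2r; rewrite ?indicE.
have [_ _ _ [cb|[s [cb [Cb [/andP[s0 s1] /andP[cb0 cbC] bC]]]]]] := ab.
  have := cutoff_clip_finite ab cb => foo.
  apply: finite_integral_le mh (hle (fun y => clip b (dir (pt y) 2 0)) _) _.
    move=> y; rewrite -[leRHS]mulr1 ler_wpM2l ?clip_ge0//.
    by case: (_ < _).
  split=> //.
    apply: measurable_funM; last exact: measurable_ball_indic.
    exact: (measurableT_comp mb mdir).
  by move=> y; rewrite mulr_ge0 ?clip_ge0// indicE.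
have Cb0 : 0 < Cb by exact: lt_le_trans cbC.
pose C := Cb * eps `^ (- 2 - 2 * s).
have C0 : 0 <= C by rewrite mulr_ge0 ?powR_ge0// ltW.
apply: finite_integral_le mh (hle (fun=> C) _)
  (finite_integralZ C0 (finite_integral_ball_indic R)) => y.
move: (dir _ _ _) => u; have [ue|_] := ltP u (cos eps); last by rewrite mulr0.
rewrite mulr1; have [u0|u0] := ltP u 0; first by rewrite clip_lt0.
have u1 : u < 1 by apply: lt_le_trans ue _; exact: cos_le1.
apply: le_trans (clip_noncutoff ab bC _) _; first by rewrite u0.
rewrite ler_wpM2l ?(ltW Cb0)// (_ : - 2 - 2 * s = - (2 + 2 * s)); last by ring.
have uI : -1 <= u <= 1 by apply/andP; split; lra.
apply: ler_powRN; first by lra.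
rewrite eps0/= ltW// -ltr_cos ?in_itv/= ?acos_ge0 ?acos_lepi//.
  by rewrite acosK ?in_itv.
by have := pi_gt0 R; lra.
Qed.

(** With [u = cos theta], [sin theta <= theta] gives [theta^(-2-2s) <= (1 - u^2)^(-1-s)], while
    [1 - u <= 1 - u^2] for [u] in [[0, 1]]. One power cancels. *)
Lemma clip_sin_bound (R : realType) (b : R -> R) (s cb Cb : R) :
  angular_kernel b -> 0 < s -> 0 < Cb ->
  (forall theta : R, 0 < theta <= pi / 2 ->
      cb * theta `^ (- 2 - 2 * s) <= b (cos theta)
        <= Cb * theta `^ (- 2 - 2 * s)) ->
  forall u, 0 <= u < 1 -> clip b u * (1 - u) <= Cb * (1 - u ^+ 2) `^ (- s).
Proof.
move=> ab s0 Cb0 bC u /andP[u0 u1].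
have uI : -1 <= u <= 1 by apply/andP; split; lra.
have q0 : 0 < 1 - u ^+ 2 by nra.
have acos0 : 0 < acos u by rewrite acos_gt0 ?u1 ?andbT//; lra.
have qle : 1 - u ^+ 2 <= acos u ^+ 2.
  have := sin_le (ltW acos0); rewrite sin_acos// => h.
  have := sqr_sqrtr (ltW q0); have := sqrtr_ge0 (1 - u ^+ 2).
  by move: h; move: (Num.sqrt _) (acos u) acos0 => x y *; nra.
have pE : acos u `^ (- 2 - 2 * s) = (acos u ^+ 2) `^ (- (1 + s)).
  by rewrite -powR_mulrn ?(ltW acos0)// -powRrM; congr (_ `^ _); ring.
apply: (@le_trans _ _ (Cb * (1 - u ^+ 2) `^ (- (1 + s)) * (1 - u ^+ 2))).
  apply: ler_pM; [exact: clip_ge0|by lra| |by nra].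
  apply: le_trans (clip_noncutoff ab bC _) _; first by rewrite u0.
  rewrite pE ler_wpM2l ?(ltW Cb0)//; apply: ler_powRN; first by lra.
  by rewrite q0.
rewrite -mulrA ler_wpM2l ?(ltW Cb0)// (_ : - s = - (1 + s) + 1); last by ring.
by rewrite powRD ?powRr1 ?(ltW q0)//; apply/implyP => _; rewrite gt_eqF.
Qed.

(** On the unit ball [1 - u^2 = (y_1^2 + y_2^2) / |y|^2 >= |y_1| |y_2|], which turns the bound of
    [clip_sin_bound] into a product of two integrable local powers. Under cutoff [1 - u <= 2]
    suffices. *)
Lemma angular_bound_weighted (R : realType) (b : R -> R) :
  angular_kernel b -> exists C, angular_bound (fun u => clip b u * (1 - u)) C.
Proof.
move=> ab; have mb := measurable_clip ab.
have mg : measurable_fun setT (fun u : R => clip b u * (1 - u)).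
  by apply: measurable_funM => //; exact: measurable_funB.
have mdir : measurable_fun setT (fun y : R3 R => dir (pt y) 2 0).
  by apply: vmeasurable_dir; exact: vmeasurable_idpt.
have g0 u : 0 <= clip b u * (1 - u).
  have [u1|u1] := leP u 1; first by rewrite mulr_ge0 ?clip_ge0//; lra.
  rewrite clipE ifF ?mul0r//; apply/negbTE; rewrite negb_and; apply/orP; right.
  by rewrite -ltNge.
apply: angular_bound_of_finite => //.
pose h (y : R3 R) := clip b (dir (pt y) 2 0) * (1 - dir (pt y) 2 0) *
  \1_(@unit_ball R) y.
have mh : measurable_fun setT h.
  apply: measurable_funM; last exact: measurable_ball_indic.
  exact: (measurableT_comp mg mdir).
have h0 y : 0 <= h y by rewrite mulr_ge0.
suff : finite_integral (@leb3 R) h by case.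
have dir1 (y : R3 R) : -1 <= dir (pt y) 2 0 <= 1.
  by rewrite -basis3_dotp dotp_itv ?dotp_dir_le1// basis3_dotp mxE !eqxx.
have [_ _ _ [cb|[s [cb [Cb [/andP[s0 s1] /andP[cb0 cbC] bC]]]]]] := ab.
  have := cutoff_clip_finite ab cb => foo.
  apply: finite_integral_le mh _ (finite_integralZ (c := 2)
    (f := fun y => clip b (dir (pt y) 2 0) * \1_(@unit_ball R) y) _ _) => //.
    move=> y; rewrite h0/= /h mulrA; apply: ler_wpM2r; first by rewrite indicE.
    rewrite mulrC ler_wpM2r ?clip_ge0//.
    by have /andP[] := dir1 y; lra.
  split=> //.
    apply: measurable_funM; last exact: measurable_ball_indic.
    exact: (measurableT_comp mb mdir).
  by move=> y; rewrite mulr_ge0 ?clip_ge0// indicE.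
have Cb0 : 0 < Cb by exact: lt_le_trans cbC.
have l0 := finite_integral_local_power (ltr01 : (0 : R) < 1).
have ls := finite_integral_local_power s1.
apply: finite_integral_ae_le mh h0 _
  (finite_integralZ (ltW Cb0) (finite_integral_leb3 ls ls l0)).
(* Where [y_1] or [y_2] vanishes the majorant is [0], so the comparison is made off the coordinate
   planes. *)
apply: filterS (ae_coordinates_neq (((0, 0), 0) : R3 R)) => y [/= y1 y2 _].
have l0' k t : 0 <= local_power k t :> R by rewrite mulr_ge0 ?powR_ge0// indicE.
have hR : 0 <= Cb * (local_power s y.1.1 * local_power s y.1.2 * local_power 0
  y.2).
  by rewrite mulr_ge0 ?(ltW Cb0)// !mulr_ge0.
rewrite /h indicE; have [|_] := boolP (y \in _); last by rewrite mulr0.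
rewrite inE mulr1 => yb; have [b1 b2 b3] := unit_ball_coord yb.
have [u0|u0] := ltP (dir (pt y) 2 0) 0; first by rewrite clip_lt0// mul0r.
have p1 : 0 < `|y.1.1| by rewrite normr_gt0.
have p2 : 0 < `|y.1.2| by rewrite normr_gt0.
have en : enorm (pt y) ^+ 2 = `|y.1.1| ^+ 2 + `|y.1.2| ^+ 2 + y.2 ^+ 2.
  by rewrite enorm_sqr dotp3 !mxE /= -!expr2 !real_normK ?num_real.
have e1 : enorm (pt y) <= 1 by exact: yb.
have e0 : 0 < enorm (pt y).
  rewrite lt_neqAle enorm_ge0 andbT eq_sym -sqrf_eq0 en.
  by rewrite gt_eqF// -addrA ltr_pwDl ?exprn_gt0// addr_ge0 ?sqr_ge0.
have q12 : `|y.1.1| * `|y.1.2| <= 1 - dir (pt y) 2 0 ^+ 2.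
  rewrite !mxE /= exprMn exprVn.
  have y2E : y.2 ^+ 2 = enorm (pt y) ^+ 2 - `|y.1.1| ^+ 2 - `|y.1.2| ^+ 2.
    by rewrite en; ring.
  rewrite y2E; set e := enorm (pt y) in e0 e1 *.
  rewrite (_ : 1 - _ = e ^- 2 * (`|y.1.1| ^+ 2 + `|y.1.2| ^+ 2)); last first.
    by field; rewrite gt_eqF.
  apply: (@le_trans _ _ (`|y.1.1| ^+ 2 + `|y.1.2| ^+ 2)); first by nra.
  rewrite ler_peMl ?addr_ge0 ?sqr_ge0//.
  by rewrite invf_ge1 ?exprn_gt0// expr_le1// ltW.
have u1 : dir (pt y) 2 0 < 1.
  have : 0 < `|y.1.1| * `|y.1.2| by rewrite mulr_gt0.
  by move: q12 u0; move: (dir _ _ _) => u *; nra.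
apply: le_trans (clip_sin_bound ab s0 Cb0 bC _) _; first by rewrite u0.
rewrite ler_wpM2l ?(ltW Cb0)//.
rewrite /local_power !indicE !mem_setE !in_itv/= -!ler_norml b1 b2 b3.
rewrite oppr0 powRr0 !mulr1 -powRM//; apply: ler_powRN; first exact: ltW.
by rewrite q12 mulr_gt0.
Qed.

(** * Decay of the equilibrium *)

Lemma bracket_ge1 (R : realType) (x : 'cV[R]_3) : 1 <= bracket x.
Proof.
rewrite -[leLHS]sqrtr1 /bracket ler_wsqrtr// lerDl sqr_ge0//.
Qed.

Lemma enorm_le_bracket (R : realType) (x : 'cV[R]_3) : enorm x <= bracket x.
Proof.
rewrite -[leLHS](ger0_norm (enorm_ge0 x)) -sqrtr_sqr /bracket ler_wsqrtr//.
by rewrite lerDr.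
Qed.

Lemma Phi_ge0 (R : realType) (p : R) (x : 'cV[R]_3) : 0 < p -> 0 <= Phi p x.
Proof.
by move=> p0; rewrite /Phi; case: ifP => _; rewrite mulr_ge0 ?powR_ge0//
  invr_ge0 ltW.
Qed.

Lemma enorm_le_Phi (R : realType) (p : R) (x : 'cV[R]_3) :
  1 < p -> enorm x <= 1 + p * Phi p x.
Proof.
move=> p1; rewrite /Phi; have p0 : p != 0 by rewrite gt_eqF//; lra.
case: ifP => _; rewrite mulrA divff// mul1r.
  apply: le_trans (enorm_le_bracket x) _.
  apply: (@le_trans _ _ (bracket x `^ p)); last by rewrite lerDr.
  by rewrite le1r_powR ?bracket_ge1// ltW.
have [x1|x1] := leP (enorm x) 1; first by rewrite ler_wpDr ?powR_ge0.
by rewrite ler_wpDl//; rewrite le1r_powR// ltW.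
Qed.

Lemma energy_ge0 (R : realType) (p : R) (x v : 'cV[R]_3) :
  0 < p -> 0 <= energy p x v.
Proof.
move=> p0; rewrite addr_ge0 ?Phi_ge0// mulr_ge0 ?sqr_ge0//.
Qed.

Lemma sqr_le_powR (R : realType) (p d : R) : 2 < p -> 0 < d ->
  exists C : R, forall t, 0 <= t -> t ^+ 2 <= d * t `^ p + C.
Proof.
(* [T] solves [d * T^(p-2) = 1]: beyond [T] the power dominates the square, below it the constant
   [T ^+ 2] does. *)
move=> p2 d0; pose T := d^-1 `^ (p - 2)^-1; exists (T ^+ 2) => t t0.
have T0 : 0 < T by rewrite powR_gt0// invr_gt0.
have [tT|Tt] := leP t T.
  rewrite ler_wpDl ?mulr_ge0 ?powR_ge0 ?(ltW d0)//.
  by rewrite ler_pXn2r// ?nnegrE// ltW.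
rewrite ler_wpDr ?sqr_ge0//.
have t0' : 0 < t by exact: lt_trans Tt.
have -> : t `^ p = t ^+ 2 * t `^ (p - 2).
  rewrite -powR_mulrn// -powRD; first by congr (_ `^ _); ring.
  by apply/implyP => _; rewrite gt_eqF.
have dT : d^-1 <= t `^ (p - 2).
  have -> : d^-1 = T `^ (p - 2).
    rewrite /T -powRrM mulVf ?powRr1// ?invr_ge0 ?(ltW d0)//.
    by rewrite subr_eq0 gt_eqF.
  by rewrite ge0_ler_powR ?nnegrE ?(ltW T0) ?(ltW t0') ?(ltW Tt)//; lra.
rewrite mulrCA ler_peMr ?sqr_ge0//.
by rewrite -ler_pdivrMl// mulr1.
Qed.

Lemma mulmx_enorm_bound (R : realType) (A : 'M[R]_3) :
  exists2 K : R, 0 <= K & forall x : 'cV[R]_3,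
    enorm (A *m x) ^+ 2 <= K * enorm x ^+ 2.
Proof.
exists (\sum_i (\sum_j `|A i j|) ^+ 2) => [|x].
  by apply: sumr_ge0 => i _; exact: sqr_ge0.
rewrite {1}enorm_sqr /dotp mulr_suml; apply: ler_sum => i _.
rewrite -expr2 -exprMn -[leLHS]real_normK ?num_real//.
rewrite ler_pXn2r// ?nnegrE ?mulr_ge0 ?sumr_ge0 ?enorm_ge0//.
rewrite mxE mulr_suml; apply: le_trans (ler_norm_sum _ _ _) _.
by apply: ler_sum => j _; rewrite normrM ler_wpM2l// coord_le_enorm.
Qed.

(* For [p < 2] the term [A x . v] has to vanish, since the energy does not
   dominate it. *)
Lemma energy_dominates (R : realType) (p alpha : R) (A : 'M[R]_3) :
  1 < p -> p != 2 -> 0 < alpha -> (p < 2 -> A = 0) ->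
  exists C : R, forall x v, - alpha * energy p x v + dotp (A *m x) v <=
    C - alpha / 2 * energy p x v.
Proof.
move=> p1 pn2 a0 A0; have p0 : 0 < p by lra.
have [p2|p2] := ltP p 2.
  exists 0 => x v; rewrite (A0 p2) mul0mx.
  have -> : dotp 0 v = 0 by rewrite /dotp big1// => i _; rewrite mxE mul0r.
  by have := energy_ge0 x v p0; nra.
have {}p2 : 2 < p by rewrite lt_neqAle eq_sym pn2.
have [K K0 KA] := mulmx_enorm_bound A.
(* Chosen so that [alpha^-1 * K] times this constant is at most [alpha / (2 * p)], half of the
   coefficient of [|x|^p] in [alpha * E]. *)
have d0 : 0 < alpha ^+ 2 / (2 * p * (K + 1)) by rewrite !divr_gt0 ?exprn_gt0
  ?mulr_gt0//; lra.
have [C HC] := sqr_le_powR p2 d0.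
exists (K * C / alpha) => x v.
(* Young's inequality, with [alpha / 4] chosen to spend exactly half of the kinetic part of
   [alpha * E]. *)
have hAv : dotp (A *m x) v <= alpha / 4 * enorm v ^+ 2 + alpha^-1 * enorm (A *m
  x) ^+ 2.
  have := dotp_ge0 (alpha^-1 *: (A *m x) - 2^-1 *: v).
  rewrite !(dotpBl, dotpBr, dotpZl, dotpZr) (dotpC v) -!enorm_sqr => h.
  rewrite -(ler_pM2l (_ : 0 < alpha^-1)) ?invr_gt0//.
  have -> : alpha^-1 * (alpha / 4 * enorm v ^+ 2 + alpha^-1 * enorm (A *m x) ^+
    2) =
    enorm v ^+ 2 / 4 + alpha^-1 * (alpha^-1 * enorm (A *m x) ^+ 2).
    by field; rewrite gt_eqF.
  by move: h; lra.
have hx := HC _ (enorm_ge0 x).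
have hAx : alpha^-1 * enorm (A *m x) ^+ 2 <= alpha / 2 * Phi p x + K * C /
  alpha.
  apply: (@le_trans _ _ (alpha^-1 * (K * enorm x ^+ 2))).
    by rewrite ler_pM2l ?invr_gt0.
  rewrite /Phi ltNge (ltW p2) /=.
  apply: (@le_trans _ _ (alpha^-1 * (K *
    (alpha ^+ 2 / (2 * p * (K + 1)) * enorm x `^ p + C)))).
    by rewrite ler_pM2l ?invr_gt0// ler_wpM2l.
  have -> : alpha^-1 * (K * (alpha ^+ 2 / (2 * p * (K + 1)) * enorm x `^ p +
    C)) =
     alpha / 2 * (p^-1 * enorm x `^ p) * (K / (K + 1)) + K * C / alpha.
    by field; rewrite !gt_eqF//; lra.
  rewrite lerD2r ler_piMr//.
    by rewrite mulr_ge0 ?mulr_ge0 ?powR_ge0 ?invr_ge0//; lra.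
  by rewrite ler_pdivrMr; lra.
rewrite /energy; have := Phi_ge0 x p0; lra.
Qed.

(** With [N = n + 1], [1 + y <= (1 + N / a) * exp (a * y / N)], and the [N]-th power of the
    right-hand exponential cancels [exp (- a * y)] exactly. Taking [N] rather than [n] avoids a
    division by zero. *)
Lemma poly_expR_bounded (R : realType) (n : nat) (a : R) : 0 < a ->
  exists2 C : R, 0 <= C & forall y, 0 <= y -> (1 + y) ^+ n * expR (- a * y) <=
    C.
Proof.
move=> a0; have n1 : (0 : R) < n.+1%:R by rewrite ltr0n.
have c1 : 1 <= 1 + n.+1%:R / a by rewrite lerDl divr_ge0// ltW.
exists ((1 + n.+1%:R / a) ^+ n.+1).
  by rewrite exprn_ge0//; lra.
move=> y y0.
have ya : 0 <= y * a / n.+1%:R by rewrite !mulr_ge0 ?invr_ge0// ltW.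
apply: (@le_trans _ _ ((1 + y) ^+ n.+1 * expR (- a * y))).
  rewrite ler_wpM2r ?expR_ge0// exprS ler_peMl ?exprn_ge0//; lra.
have h : 1 + y <= (1 + n.+1%:R / a) * expR (y * a / n.+1%:R).
  apply: (@le_trans _ _ ((1 + n.+1%:R / a) * (1 + y * a / n.+1%:R))).
    have -> : (1 + n.+1%:R / a) * (1 + y * a / n.+1%:R) =
      1 + y + n.+1%:R / a + y * a / n.+1%:R.
      by field; rewrite !gt_eqF.
    by move: c1 ya; move: (_ / a) (_ / n.+1%:R) => t w *; lra.
  by rewrite ler_pM2l ?expR_ge1Dx//; lra.
apply: (@le_trans _ _ (((1 + n.+1%:R / a) * expR (y * a / n.+1%:R)) ^+ n.+1 *
    expR (- a * y))).
  rewrite ler_wpM2r ?expR_ge0// ler_pXn2r// nnegrE; first by lra.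
  by rewrite mulr_ge0 ?expR_ge0//; lra.
rewrite exprMn -expRM_natl -[leLHS]mulrA -expRD.
rewrite (_ : n.+1%:R * (y * a / n.+1%:R) + - a * y = 0) ?expR0 ?mulr1//.
by field; rewrite gt_eqF.
Qed.

(** An integrable weight that factors over the coordinates; the decay of the equilibrium enters all
    later integrals through it. *)
Definition decay (R : realType) (u : 'cV[R]_3) : R :=
  invsqr1 (u 0 0) * invsqr1 (u 1 0) * invsqr1 (u 2 0).

Lemma decay_gt0 (R : realType) (u : 'cV[R]_3) : 0 < decay u.
Proof. by rewrite !mulr_gt0// invsqr1_gt0. Qed.

(** Each coordinate costs [1 + t^2 <= c^2], hence the sixth power for three of them. *)
Lemma decay_ge (R : realType) (u : 'cV[R]_3) (c : R) :
  (forall i, `|u i 0| + 1 <= c) -> 1 <= decay u * c ^+ 6.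
Proof.
move=> uc.
have h i : 1 <= invsqr1 (u i 0) * c ^+ 2.
  rewrite /invsqr1 mulrC ler_pdivlMr; last by rewrite ltr_wpDr// sqr_ge0.
  rewrite mul1r -[u i 0 ^+ 2]real_normK ?num_real//.
  by have := uc i; have := normr_ge0 (u i 0); nra.
rewrite /decay (_ : _ * c ^+ 6 = invsqr1 (u 0 0) * c ^+ 2 *
  (invsqr1 (u 1 0) * c ^+ 2) * (invsqr1 (u 2 0) * c ^+ 2)); last by ring.
by rewrite -[1]mulr1 ler_pM// -[1]mulr1 ler_pM.
Qed.

Lemma coord_le_energy (R : realType) (p : R) (x v : 'cV[R]_3) (i : 'I_3) :
  1 < p -> `|x i 0| + 1 <= (2 + p) * (1 + energy p x v) /\
           `|v i 0| + 1 <= (2 + p) * (1 + energy p x v).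
Proof.
move=> p1; have p0 : 0 < p by lra.
have := enorm_le_Phi x p1; have := Phi_ge0 x p0.
have := coord_le_enorm x i; have := coord_le_enorm v i.
rewrite /energy; have := enorm_ge0 v; move: (enorm v) (enorm x) (Phi p x) => a b
  c a0 va xb c0 bc.
have pc : 0 <= p * c by rewrite mulr_ge0// ltW.
have pa : 0 <= p * a ^+ 2 by rewrite mulr_ge0 ?sqr_ge0// ltW.
have a2 : 0 <= (a - 1) ^+ 2 by exact: sqr_ge0.
have a3 : 0 <= a ^+ 2 by exact: sqr_ge0.
have -> : (2 + p) * (1 + (c + 2^-1 * a ^+ 2)) =
  2 + p + 2 * c + p * c + a ^+ 2 + p * a ^+ 2 / 2 by field.
have : (a - 1) ^+ 2 = a ^+ 2 - 2 * a + 1 by ring.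
by split; lra.
Qed.

Lemma equilibrium_decay (R : realType) (p : R) (M : 'cV[R]_3 -> 'cV[R]_3 -> R)
    (n : nat) :
  1 < p -> p != 2 -> positive_equilibrium p M ->
  exists2 C : R, 0 <= C & forall x v,
    (1 + energy p x v) ^+ n * M x v <= C * (decay x * decay v).
Proof.
move=> p1 pn2 [m [alpha [A [m0 a0 _ A0 ME]]]]; have p0 : 0 < p by lra.
have [K HK] := energy_dominates p1 pn2 a0 A0.
(* [12 = 6 + 6]: [decay_ge] takes six powers of [(2 + p) * (1 + E)] for [x] and six for [v]. The
   rate [alpha / 2] is what [energy_dominates] leaves. *)
have [C C0 HC] := poly_expR_bounded (n + 12) (divr_gt0 a0 (ltr0n R 2)).
exists (m * expR K * C * (2 + p) ^+ 12).
  rewrite mulr_ge0 ?exprn_ge0//; last by lra.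
  by rewrite mulr_ge0 ?mulr_ge0 ?expR_ge0// ltW.
move=> x v; set W := 1 + energy p x v.
have E0 := energy_ge0 x v p0; have W1 : 1 <= W by rewrite lerDl.
have M1 : M x v <= m * expR K * expR (- (alpha / 2) * energy p x v).
  rewrite ME -mulrA -expRD ler_pM2l// ler_expR; have := HK x v; lra.
have D : 1 <= decay x * decay v * ((2 + p) * W) ^+ 12.
  have d1 : 1 <= decay x * ((2 + p) * W) ^+ 6.
    by apply: decay_ge => i; case: (coord_le_energy x v i p1).
  have d2 : 1 <= decay v * ((2 + p) * W) ^+ 6.
    by apply: decay_ge => i; case: (coord_le_energy x v i p1).
  rewrite (_ : _ * _ ^+ 12 = decay x * ((2 + p) * W) ^+ 6 *
    (decay v * ((2 + p) * W) ^+ 6)); last by ring.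
  by rewrite -[leLHS]mulr1 ler_pM.
apply: (@le_trans _ _ (W ^+ n * (m * expR K * expR (- (alpha / 2) * energy p x
  v)))).
  by rewrite ler_wpM2l// exprn_ge0//; lra.
have mK : 0 <= m * expR K by rewrite mulr_ge0 ?expR_ge0// ltW.
have e0 := expR_ge0 (- (alpha / 2) * energy p x v).
apply: (@le_trans _ _ (W ^+ n * (m * expR K * expR (- (alpha / 2) * energy p x
  v)) *
   (decay x * decay v * ((2 + p) * W) ^+ 12))).
  by rewrite ler_peMr// mulr_ge0 ?exprn_ge0 ?mulr_ge0//; lra.
have -> : W ^+ n * (m * expR K * expR (- (alpha / 2) * energy p x v)) *
   (decay x * decay v * ((2 + p) * W) ^+ 12) =
   m * expR K * (W ^+ (n + 12) * expR (- (alpha / 2) * energy p x v)) *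
   ((2 + p) ^+ 12 * (decay x * decay v)).
  by rewrite exprD exprMn; ring.
have -> : m * expR K * C * (2 + p) ^+ 12 * (decay x * decay v) =
  m * expR K * C * ((2 + p) ^+ 12 * (decay x * decay v)) by ring.
rewrite ler_wpM2r//; last by rewrite ler_wpM2l// HC.
apply: mulr_ge0; first by apply: exprn_ge0; lra.
by rewrite mulr_ge0// ltW// decay_gt0.
Qed.

(** * Conserved modes and their Gram matrix *)

(** The skew-symmetric matrix that turns a combination of angular momenta into a bilinear form in
    [x] and [v]; see [dotp_ell] and [spin_skew]. *)
Definition spin (R : realType) (u : 'cV[R]_3) : 'M[R]_3 :=
  \matrix_(i, j) (nth [::] [:: [:: 0; - u 0 0; - u 1 0];
                               [:: u 0 0; 0; - u 2 0];
                               [:: u 1 0; u 2 0; 0]] i)`_j.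

Lemma dotp_ell (R : realType) (u x v : 'cV[R]_3) :
  dotp u (ell x v) = dotp (spin u *m x) v.
Proof.
rewrite !dotp3 !mxE !big_ord_recl !big_ord0 !mxE /=.
have -> : lift ord0 (ord0 : 'I_2) = 1 :> 'I_3 by exact/val_inj.
have -> : lift ord0 (lift ord0 (ord0 : 'I_1)) = 2 :> 'I_3 by exact/val_inj.
have -> : ord0 = 0 :> 'I_3 by [].
ring.
Qed.

Lemma spin_skew (R : realType) (u : 'cV[R]_3) : (spin u)^T = - spin u.
Proof.
apply/matrixP => i j; rewrite !mxE.
by case: (ord3P i) => ->; case: (ord3P j) => -> /=; rewrite ?oppr0 ?opprK.
Qed.

Lemma chiE0 (R : realType) (p : R) (x v : 'cV[R]_3) : chi p x v 0 0 = 1.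
Proof.
have -> : (0 : 'I_5) = lshift 4 (0 : 'I_1) by exact/val_inj.
by apply: etrans (@col_mxEu _ 1 4 1 _ _ _ _) _; rewrite mxE eqxx.
Qed.

Lemma chiE1 (R : realType) (p : R) (x v : 'cV[R]_3) :
  chi p x v 1 0 = energy p x v.
Proof.
have -> : (1 : 'I_5) = rshift 1 (lshift 3 (0 : 'I_1)) by exact/val_inj.
apply: etrans (@col_mxEd _ 1 4 1 _ _ _ _) _.
by apply: etrans (@col_mxEu _ 1 3 1 _ _ _ _) _; rewrite mxE eqxx.
Qed.

Lemma chiE2 (R : realType) (p : R) (x v : 'cV[R]_3) (k : 'I_3) :
  chi p x v (rshift 1 (rshift 1 k)) 0 = ell x v k 0.
Proof.
apply: etrans (@col_mxEd _ 1 4 1 _ _ _ _) _.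
exact: (@col_mxEd _ 1 3 1).
Qed.

Definition tail3 (R : realType) (c : 'cV[R]_5) : 'cV[R]_3 :=
  \col_k c (rshift 1 (rshift 1 k)) 0.

Lemma ord5P (i : 'I_5) :
  [\/ i = 0, i = 1 | exists k : 'I_3, i = rshift 1 (rshift 1 k)].
Proof.
case: i => -[|[|i]] h; [apply: Or31|apply: Or32|apply: Or33]; try exact/val_inj.
have i3 : (i < 3)%N by move: h; rewrite !ltnS.
by exists (Ordinal i3); exact/val_inj.
Qed.

Lemma dotp_chi (R : realType) (p : R) (c : 'cV[R]_5) (x v : 'cV[R]_3) :
  dotp c (chi p x v) =
  c 0 0 + c 1 0 * energy p x v + dotp (spin (tail3 c) *m x) v.
Proof.
rewrite -dotp_ell /dotp big_ord_recl big_ord_recl addrA.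
have -> : ord0 = 0 :> 'I_5 by exact/val_inj.
have -> : lift 0 ord0 = 1 :> 'I_5 by exact/val_inj.
rewrite chiE0 chiE1 mulr1; congr (_ + _).
apply: eq_bigr => k _; rewrite [tail3 c k 0]mxE -(chiE2 p).
by congr (c _ _ * chi p x v _ _); exact/val_inj.
Qed.

Lemma chi_cases (R : realType) (P : ('cV[R]_3 -> 'cV[R]_3 -> R) -> Prop) (p : R)
  :
  P (fun _ _ => 1) -> P (energy p) -> (forall k, P (fun x v => ell x v k 0)) ->
  forall i, P (fun x v => chi p x v i 0).
Proof.
move=> P1 PE Pl i; have [->|->|[k ->]] := ord5P i.
- rewrite (_ : (fun x v => _) = (fun _ _ => 1))//.
  by apply/funext => x; apply/funext => v; rewrite chiE0.
- rewrite (_ : (fun x v => _) = energy p)//.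
  by apply/funext => x; apply/funext => v; rewrite chiE1.
- rewrite (_ : (fun x v => _) = (fun x v => ell x v k 0))//.
  by apply/funext => x; apply/funext => v; rewrite chiE2.
Qed.

Lemma ellE (R : realType) (x v : 'cV[R]_3) (k : 'I_3) :
  exists i j, ell x v k 0 = x i 0 * v j 0 - x j 0 * v i 0.
Proof.
case: (ord3P k) => ->; [exists 0, 1|exists 0, 2|exists 1, 2]; by rewrite mxE.
Qed.

Lemma measurable_Phi d (T : measurableType d) (R : realType) (p : R)
    (F : T -> 'cV[R]_3) :
  vmeasurable F -> measurable_fun setT (fun t => Phi p (F t)).
Proof.
move=> mF; rewrite /Phi; case: (p < 2); apply: measurable_funM => //.
  apply: measurableT_comp (measurable_powR _) _.
  apply: measurableT_comp (@measurable_sqrt R) _.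
  apply: measurable_funD => //; apply: measurable_funX.
  exact: measurable_enorm.
by apply: measurableT_comp (measurable_powR _) _; exact: measurable_enorm.
Qed.

Lemma measurable_energy d (T : measurableType d) (R : realType) (p : R)
    (F G : T -> 'cV[R]_3) :
  vmeasurable F -> vmeasurable G ->
  measurable_fun setT (fun t => energy p (F t) (G t)).
Proof.
move=> mF mG; apply: measurable_funD; first exact: measurable_Phi.
by apply: measurable_funM => //; apply: measurable_funX; exact:
  measurable_enorm.
Qed.

Lemma measurable_chi d (T : measurableType d) (R : realType) (p : R)
    (F G : T -> 'cV[R]_3) (i : 'I_5) :
  vmeasurable F -> vmeasurable G ->
  measurable_fun setT (fun t => chi p (F t) (G t) i 0).
Proof.
move=> mF mG; move: i; apply: (chi_cases (P := fun c =>
  measurable_fun setT (fun t => c (F t) (G t)))) => //.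
  exact: measurable_energy.
move=> k; case: (ord3P k) => ->; under eq_fun do rewrite mxE /=.
all: apply: measurable_funB; apply: measurable_funM;
     by [exact: mF|exact: mG].
Qed.

Lemma measurable_equilibrium d (T : measurableType d) (R : realType) (p : R)
    (M : 'cV[R]_3 -> 'cV[R]_3 -> R) (F G : T -> 'cV[R]_3) :
  positive_equilibrium p M -> vmeasurable F -> vmeasurable G ->
  measurable_fun setT (fun t => M (F t) (G t)).
Proof.
move=> [m [al [A [_ _ _ _ ME]]]] mF mG.
under eq_fun do rewrite ME.
apply: measurable_funM => //; apply: measurableT_comp (@measurable_expR R) _.
apply: measurable_funD.
  by apply: measurable_funM => //; exact: measurable_energy.
by apply: measurable_dotp => //; exact: vmeasurable_mulmx.
Qed.

Lemma equilibrium_gt0 (R : realType) (p : R) (M : 'cV[R]_3 -> 'cV[R]_3 -> R) x v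
  :
  positive_equilibrium p M -> 0 < M x v.
Proof. by move=> [m [al [A [m0 _ _ _ ->]]]]; rewrite mulr_gt0// expR_gt0. Qed.

(** The square is dictated by the angular momenta: each is a difference of two products of a
    coordinate of [x] and one of [v], and every coordinate is at most [(2 + p) * (1 + E)]. *)
Lemma chi_bound (R : realType) (p : R) : 1 < p ->
  exists2 C : R, 0 <= C & forall x v i, `|chi p x v i 0| <= C * (1 + energy p x
    v) ^+ 2.
Proof.
move=> p1; have p0 : 0 < p by lra.
exists (2 * (2 + p) ^+ 2); first by rewrite mulr_ge0 ?exprn_ge0//; lra.
move=> x v; have E0 := energy_ge0 x v p0; set W := 1 + energy p x v.
have W1 : 1 <= W by rewrite /W; lra.
have c1 : 1 <= 2 * (2 + p) ^+ 2 by nra.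
apply: (chi_cases (P := fun c => `|c x v| <= 2 * (2 + p) ^+ 2 * W ^+ 2)).
- by rewrite normr1; nra.
- by rewrite ger0_norm//; rewrite /W in W1 *; nra.
- move=> k; have [i [j ->]] := ellE x v k.
  have [xi vi] := coord_le_energy x v i p1.
  have [xj vj] := coord_le_energy x v j p1.
  rewrite -/W in xi vi xj vj.
  apply: le_trans (ler_normB _ _) _; rewrite !normrM.
  have := normr_ge0 (x i 0); have := normr_ge0 (x j 0).
  have := normr_ge0 (v i 0); have := normr_ge0 (v j 0).
  have -> : 2 * (2 + p) ^+ 2 * W ^+ 2 = (2 + p) * W * ((2 + p) * W) +
     (2 + p) * W * ((2 + p) * W) by ring.
  by move=> a b c d; apply: lerD; apply: ler_pM => //; lra.
Qed.

Lemma finite_integral_decay (R : realType) :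
  finite_integral (@leb6 R) (fun z => decay (pt z.1) * decay (pt z.2)).
Proof.
have fw := finite_integral_invsqr1 R.
have f3 : finite_integral (@leb3 R) (fun y => decay (pt y)).
  rewrite (_ : (fun y => _) = (fun y : R3 R => invsqr1 y.1.1 * invsqr1 y.1.2 *
    invsqr1 y.2)).
    exact: finite_integral_leb3.
  by apply/funext => y; rewrite /decay !mxE.
exact: (@finite_integral_prod _ _ _ _ R (@leb3 R) (@leb3 R) _ _ f3 f3).
Qed.

Lemma finite_integral_integrable d (T : measurableType d) (R : realType)
    (m : {measure set T -> \bar R}) (f g : T -> R) :
  measurable_fun setT g -> (forall x, `|g x| <= f x) ->
  finite_integral m f -> m.-integrable setT (EFin \o g).
Proof.
move=> mg gf [mf f0 foo].
have intf : m.-integrable setT (EFin \o f).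
  apply/integrableP; split; first exact/measurable_EFinP.
  by under eq_integral do rewrite /= ger0_norm//.
apply: le_integrable intf => //; first exact/measurable_EFinP.
by move=> x _; rewrite /= lee_fin [leRHS]ger0_norm.
Qed.

Lemma integrable_chi2M (R : realType) (p : R) (M : 'cV[R]_3 -> 'cV[R]_3 -> R) i
  j :
  1 < p -> p != 2 -> positive_equilibrium p M ->
  (@leb6 R).-integrable setT (fun z =>
    (chi p (pt z.1) (pt z.2) i 0 * (chi p (pt z.1) (pt z.2) j 0 *
     M (pt z.1) (pt z.2)))%:E).
Proof.
move=> p1 pn2 hM; have p0 : 0 < p by lra.
have [C C0 HC] := chi_bound p1.
(* Two modes, each bounded by the square of [1 + E], require the exponent [4]. *)
have [D D0 HD] := equilibrium_decay 4 p1 pn2 hM.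
have mp1 : vmeasurable (fun z : (R3 R * R3 R)%type => pt z.1).
  exact: vmeasurable_pt measurable_fst.
have mp2 : vmeasurable (fun z : (R3 R * R3 R)%type => pt z.2).
  exact: vmeasurable_pt measurable_snd.
apply: (@finite_integral_integrable _ _ _ (@leb6 R)
  (fun z => C * C * D * (decay (pt z.1) * decay (pt z.2)))
  (fun z => chi p (pt z.1) (pt z.2) i 0 * (chi p (pt z.1) (pt z.2) j 0 *
     M (pt z.1) (pt z.2)))); last first.
- by apply: finite_integralZ (finite_integral_decay R); rewrite !mulr_ge0.
- move=> z; move: (pt z.1) (pt z.2) => x v.
  have M0 := equilibrium_gt0 x v hM; have E0 := energy_ge0 x v p0.
  rewrite !normrM (gtr0_norm M0) mulrA.
  apply: (@le_trans _ _ (C * (1 + energy p x v) ^+ 2 * (C * (1 + energy p x v)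
    ^+ 2) * M x v)).
    by rewrite ler_wpM2r ?(ltW M0)//; apply: ler_pM.
  rewrite (_ : _ * M x v = C * C * ((1 + energy p x v) ^+ 4 * M x v)); last by
    ring.
  by rewrite -[leRHS]mulrA ler_wpM2l ?mulr_ge0// HD.
- exact: measurable_funM (measurable_chi p i mp1 mp2)
    (measurable_funM (measurable_chi p j mp1 mp2)
      (measurable_equilibrium hM mp1 mp2)).
Qed.

Lemma Rintegral_sum d (T : measurableType d) (R : realType)
    (m : {measure set T -> \bar R}) (I : Type) (s : seq I) (c : I -> R)
    (f : I -> T -> R) :
  (forall i, m.-integrable setT (EFin \o f i)) ->
  m.-integrable setT (fun x => (\sum_(i <- s) c i * f i x)%:E) /\
  \int[m]_x (\sum_(i <- s) c i * f i x) = \sum_(i <- s) c i * \int[m]_x f i x.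
Proof.
move=> fi; elim: s => [|i s [IHi IHe]].
  under eq_fun do rewrite big_nil.
  under eq_Rintegral do rewrite big_nil.
  rewrite big_nil; split; first exact: integrable0.
  by rewrite /Rintegral integral0.
under eq_fun do rewrite big_cons.
under eq_Rintegral do rewrite big_cons.
have ci : m.-integrable setT (EFin \o (fun x => c i * f i x)).
  have := integrableZl measurableT (c i) (fi i).
  by apply: eq_integrable => // x _ /=.
rewrite big_cons; split.
  have := integrableD measurableT ci IHi.
  by apply: eq_integrable => // x _ /=.
by rewrite RintegralD// IHe RintegralZl.
Qed.

(** [Pi p M f] is by conversion the case [c = coefs p M f], so everything is proved for arbitrary
    coefficients. *)
Definition combination (R : realType) (p : R) (M : 'cV[R]_3 -> 'cV[R]_3 -> R)
    (c : 'cV[R]_5) : 'cV[R]_3 -> 'cV[R]_3 -> R :=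
  fun x v => dotp c (chi p x v) * M x v.

Lemma int6_combination (R : realType) (p : R) (M : 'cV[R]_3 -> 'cV[R]_3 -> R)
    (c : 'cV[R]_5) (i : 'I_5) :
  1 < p -> p != 2 -> positive_equilibrium p M ->
  (@leb6 R).-integrable setT (fun z =>
    (chi p (pt z.1) (pt z.2) i 0 * combination p M c (pt z.1) (pt z.2))%:E) /\
  int6 (fun x v => chi p x v i 0 * combination p M c x v) =
  \sum_j c j 0 * int6 (fun x v => chi p x v i 0 * (chi p x v j 0 * M x v)).
Proof.
move=> p1 pn2 hM.
have E x v : chi p x v i 0 * combination p M c x v =
    \sum_j c j 0 * (chi p x v i 0 * (chi p x v j 0 * M x v)).
  rewrite /combination /dotp mulr_suml mulr_sumr; apply: eq_bigr => j _; ring.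
have [h1 h2] := Rintegral_sum (index_enum 'I_5) (fun j => c j 0)
  (fun j => integrable_chi2M i j p1 pn2 hM).
rewrite /int6; split.
  by under eq_fun do rewrite E.
by under eq_Rintegral do rewrite E.
Qed.

Lemma GramE (R : realType) (p : R) (M : 'cV[R]_3 -> 'cV[R]_3 -> R) i j :
  Gram p M i j = int6 (fun x v => chi p x v i 0 * (chi p x v j 0 * M x v)).
Proof.
rewrite mxE; apply: eq_Rintegral => z _; rewrite mulrA; congr (_ * _).
by rewrite mxE big_ord1 [X in _ * X]mxE.
Qed.

Lemma moments_combination (R : realType) (p : R)
    (M : 'cV[R]_3 -> 'cV[R]_3 -> R) (c : 'cV[R]_5) :
  1 < p -> p != 2 -> positive_equilibrium p M ->
  moments p (combination p M c) = Gram p M *m c.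
Proof.
move=> p1 pn2 hM; apply/colP => i; rewrite !mxE.
have [_ ->] := int6_combination c i p1 pn2 hM.
by apply: eq_bigr => j _; rewrite GramE mulrC.
Qed.

Lemma ae_measure_preserving d (T : measurableType d) (R : realType)
    (m : {measure set T -> \bar R}) (h : T -> T) (P : T -> Prop) :
  measure_preserving m h -> {ae m, forall x, P x} -> {ae m, forall x, P (h x)}.
Proof.
move=> [mh Ih] [N [mN mN0 PN]]; exists (h @^-1` N); split.
- by rewrite -[X in measurable X]setTI; exact: mh.
- have mhN : measurable (h @^-1` N) by rewrite -[X in measurable X]setTI; exact:
  mh.
  transitivity (\int[m]_x (\1_N (h x))%:E)%E.
    by rewrite (integral_indic m measurableT mhN) setIT.
  rewrite (Ih (fun x => (\1_N x)%:E))//; first by rewrite integral_indic//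
    setIT.
  by apply/measurable_EFinP; exact: measurable_indic.
- by move=> x Px; apply: PN.
Qed.

Lemma leb6_setT_neq0 (R : realType) : @leb6 R setT != 0%E.
Proof.
have T1 : @lebesgue_measure R setT != 0%E.
  have : (@lebesgue_measure R `[0%R, 1%R]%classic <= @lebesgue_measure R
    setT)%E.
    apply: le_measure; rewrite ?inE//; exact: measurable_itv.
  rewrite lebesgue_measure_itv/= lte_fin ltr01 oppr0 addr0.
  by apply: contraTneq => ->; rewrite -ltNge lte_fin.
have T2 : @leb2 R setT != 0%E.
  have -> : @leb2 R setT = (@lebesgue_measure R setT * @lebesgue_measure R
    setT)%E.
    by rewrite /leb2 -setXTT product_measure1E.
  by rewrite mule_eq0 negb_or T1.
have T3 : @leb3 R setT != 0%E.
  have -> : @leb3 R setT = (@leb2 R setT * @lebesgue_measure R setT)%E.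
    rewrite -setXTT.
    exact: (@product_measure1E _ _ _ _ R (@leb2 R) (@lebesgue_measure R)).
  by rewrite mule_eq0 negb_or T2.
have -> : @leb6 R setT = (@leb3 R setT * @leb3 R setT)%E.
  rewrite -setXTT.
  exact: (@product_measure1E _ _ _ _ R (@leb3 R) (@leb3 R)).
by rewrite mule_eq0 negb_or T3.
Qed.

(** The whole space is not null. Hence finitely many identities that hold almost everywhere can be
    evaluated together at one common point. *)
Lemma ae_leb6_exists (R : realType) (P : (R3 R * R3 R)%type -> Prop) :
  {ae @leb6 R, forall z, P z} -> exists z, P z.
Proof.
move=> [N [mN N0 PN]]; apply: contrapT => nP.
have := leb6_setT_neq0 R; rewrite -measure_le0 => /negP; apply.
rewrite -N0; apply: le_measure; rewrite ?inE//.
by move=> z _; apply: PN => Pz; apply: nP; exists z.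
Qed.

Lemma measure_preserving_shift6 (R : realType) (a b : 'cV[R]_3) :
  exists h : (R3 R * R3 R)%type -> (R3 R * R3 R)%type,
  measure_preserving (@leb6 R) h /\
  forall z, pt (h z).1 = pt z.1 + a /\ pt (h z).2 = pt z.2 + b.
Proof.
have := @measure_preserving_prod _ _ _ _ R (@leb3 R) (@leb3 R) _ _
  (measure_preserving_shift3 (tup a)) (measure_preserving_shift3 (tup b)).
set h := (fun z => _) => mh; exists h; split=> // z.
by split; apply/colP => k; case: (ord3P k) => ->; rewrite !mxE.
Qed.

(* Mixed differences in [x] and [v] isolate the angular momenta, and second
   differences in [v] the energy; by translation invariance they also vanish
   almost everywhere. *)
Lemma chi_independent (R : realType) (p : R) (c : 'cV[R]_5) :
  {ae @leb6 R, forall z, dotp c (chi p (pt z.1) (pt z.2)) = 0} -> c = 0.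
Proof.
move=> c0; pose P x v := dotp c (chi p x v).
have PE x v : P x v = c 0 0 + c 1 0 * energy p x v + dotp (spin (tail3 c) *m x)
  v.
  exact: dotp_chi.
have aeP a b : {ae @leb6 R, forall z, P (pt z.1 + a) (pt z.2 + b) = 0}.
  have [h [mh hE]] := measure_preserving_shift6 a b.
  have := ae_measure_preserving mh c0; apply: filterS => z.
  by have [-> ->] := hE z.
(* The energy is a function of [x] plus a function of [v], so the alternating sum over the four
   corners retains only the bilinear part. *)
have mixed a b : dotp (spin (tail3 c) *m a) b = 0.
  have : {ae @leb6 R, forall z, [/\ P (pt z.1 + a) (pt z.2 + b) = 0,
      P (pt z.1 + a) (pt z.2 + 0) = 0, P (pt z.1 + 0) (pt z.2 + b) = 0 &
      P (pt z.1 + 0) (pt z.2 + 0) = 0]}.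
    by apply: filterS (filterI (filterI (aeP a b) (aeP a 0))
      (filterI (aeP 0 b) (aeP 0 0))) => z [[? ?] [? ?]]; split.
  move=> /ae_leb6_exists[z]; rewrite !addr0 !PE /energy; move: (pt z.1) (pt
    z.2) => x v [].
  rewrite mulmxDr !(dotpDl, dotpDr).
  move: (dotp _ v) (dotp _ v) (dotp _ b) (dotp _ b) (Phi _ _) (Phi _ _)
    (enorm v) (enorm _) => q1 q2 q3 q4 P1 P2 n1 n2; lra.
have K0 : tail3 c = 0.
  apply/colP => k; rewrite [RHS]mxE.
  have e i j : spin (tail3 c) i j = 0.
    have := mixed (basis3 R j) (basis3 R i); rewrite dotpC basis3_dotp => <-.
    rewrite [RHS]mxE (bigD1 j)//= big1 => [|l lj].
      by rewrite addr0 [basis3 R j j 0]mxE !eqxx mulr1.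
    by rewrite [basis3 R j l 0]mxE (negbTE lj) mulr0.
  case: (ord3P k) => ->.
  - by have := e 1 0; rewrite [LHS]mxE.
  - by have := e 2 0; rewrite [LHS]mxE.
  - by have := e 2 1; rewrite [LHS]mxE.
have K0' x v : dotp (spin (tail3 c) *m x) v = 0 by exact: mixed.
(* With the bilinear part gone, [P x (v + b) + P x (v - b) - 2 * P x v] equals [c 1 0] times
   [|b|^2 = 1]. *)
have second : c 1 0 = 0.
  pose b := basis3 R 0.
  have : {ae @leb6 R, forall z, [/\ P (pt z.1 + 0) (pt z.2 + b) = 0,
      P (pt z.1 + 0) (pt z.2 + - b) = 0 & P (pt z.1 + 0) (pt z.2 + 0) = 0]}.
    by apply: filterS3 (aeP 0 b) (aeP 0 (- b)) (aeP 0 0) => z *; split.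
  move=> /ae_leb6_exists[z]; rewrite !addr0 !PE !K0' /energy.
  move: (pt z.1) (pt z.2) => x v [].
  rewrite !enorm_sqr !(dotpDl, dotpDr, dotpNl, dotpNr) (dotpC v b).
  have -> : dotp b b = 1 by rewrite basis3_dotp mxE !eqxx.
  move: (dotp _ _) (Phi _ _) (dotp _ _) => q r s *; lra.
have first : c 0 0 = 0.
  have [z] := ae_leb6_exists c0; rewrite dotp_chi second K0' mul0r !addr0//.
apply/colP => i; rewrite [RHS]mxE; have [->|->|[k ->]] := ord5P i => //.
by have := congr1 (fun u : 'cV[R]_3 => u k 0) K0; rewrite !mxE.
Qed.

(** The quadratic form at [u] is the integral of [(u . chi)^2 M]. As [M > 0], a zero integral forces
    [u . chi = 0] almost everywhere, and [chi_independent] gives [u = 0]. *)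
Lemma Gram_posdef (R : realType) (p : R) (M : 'cV[R]_3 -> 'cV[R]_3 -> R) :
  1 < p -> p != 2 -> positive_equilibrium p M -> symmetric_posdef (Gram p M).
Proof.
move=> p1 pn2 hM; split.
  apply/matrixP => i j; rewrite mxE !GramE; apply: eq_Rintegral => z _; ring.
move=> u u0.
pose g (z : (R3 R * R3 R)%type) :=
  dotp u (chi p (pt z.1) (pt z.2)) * combination p M u (pt z.1) (pt z.2).
have gE z : g z = \sum_i u i 0 *
    (chi p (pt z.1) (pt z.2) i 0 * combination p M u (pt z.1) (pt z.2)).
  by rewrite /g {1}/dotp mulr_suml; apply: eq_bigr => i _; ring.
have g0 z : 0 <= g z.
  rewrite /g /combination mulrA mulr_ge0//; first by rewrite -expr2 sqr_ge0.
  exact/ltW/(equilibrium_gt0 _ _ hM).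
have [gi gint] := Rintegral_sum (index_enum 'I_5) (fun i => u i 0)
  (fun i => (int6_combination u i p1 pn2 hM).1).
have {}gi : (@leb6 R).-integrable setT (EFin \o g).
  by apply: eq_integrable gi => // z _ /=; rewrite gE.
have -> : (u^T *m Gram p M *m u) 0 0 = \int[@leb6 R]_z g z.
  under [RHS]eq_Rintegral do rewrite gE.
  rewrite gint -mulmxA mxE; apply: eq_bigr => i _; rewrite [u^T 0 i]mxE; congr
    (_ * _).
  by rewrite -moments_combination// mxE.
rewrite lt_neqAle eq_sym Rintegral_ge0// andbT.
apply: contra u0 => /eqP int0; apply/eqP/(@chi_independent _ p).
have : ae_eq (@leb6 R) setT (EFin \o g) (cst 0%E).
  apply/(ae_eq_integral_abs _ measurableT); first exact: measurable_int gi.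
  under eq_integral do rewrite /= ger0_norm//.
  by rewrite -[LHS]fineK ?integrable_fin_num//; congr _%:E.
apply: filterS => z /(_ I) /= [] /eqP.
rewrite /g /combination mulrA mulf_eq0 (gt_eqF (equilibrium_gt0 _ _ hM)) orbF.
by rewrite mulf_eq0 orbb => /eqP.
Qed.

Lemma posdef_unitmx (R : realType) n (G : 'M[R]_n) :
  symmetric_posdef G -> G \in unitmx.
Proof.
move=> [_ G0]; rewrite unitmxE unitfE; apply/negP => /det0P[w w0 wG].
have := G0 w^T; rewrite trmx_eq0 w0 trmxK wG mul0mx mxE ltxx.
by move=> /(_ isT).
Qed.

(** * Transport *)

Lemma scale_mulr (R : realType) (a b : R) : a *: b = a * b.
Proof. by []. Qed.

(** The two difference quotients are the same function of the step, so directional derivatives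
    reduce to one real variable at [0]. *)
Lemma is_derive_line (R : realType) (g : 'cV[R]_3 -> R) (x u : 'cV[R]_3) (d : R)
  :
  is_derive (0 : R) 1 (fun t => g (t *: u + x)) d -> is_derive x u g d.
Proof.
have E : (fun h : R => h^-1 *: (((fun t => g (t *: u + x)) \o shift 0) (h *:
  1) -
    g (0 *: u + x))) = (fun h => h^-1 *: ((g \o shift x) (h *: u) - g x)).
  apply/funext => h; rewrite /= scale0r add0r addr0 [h *: 1]mulr1.
  by [].
move=> [dg eg]; split; first by move: dg; rewrite /derivable E.
by move: eg; rewrite /derive E.
Qed.

Lemma is_derive_ext (R : realType) (f g : R -> R) (t d e : R) :
  is_derive t 1 f d -> f =1 g -> d = e -> is_derive t 1 g e.
Proof. by move=> fd /funext <- <-. Qed.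

Lemma is_derive_affine (R : realType) (a b t : R) :
  is_derive t 1 (fun s => a + s * b) b.
Proof.
have := is_deriveD (is_derive_cst a t 1) (is_deriveZ b (is_derive_id t (1 :
  R))).
move/is_derive_ext; apply => [s|].
  by rewrite /= mulrC.
by rewrite add0r [b *: 1]mulr1.
Qed.

Lemma is_derive_expR_comp (R : realType) (f : R -> R) (t d : R) :
  is_derive t 1 f d -> is_derive t 1 (fun s => expR (f s)) (expR (f t) * d).
Proof. by move=> fd; exact: is_derive1_comp (is_derive_expR (f t)) fd. Qed.

Lemma is_derive_powR_comp (R : realType) (f : R -> R) (r t d : R) :
  is_derive t 1 f d -> 0 < f t ->
  is_derive t 1 (fun s => f s `^ r) (r * f t `^ (r - 1) * d).
Proof.
by move=> fd f0; exact: is_derive1_comp (is_derive1_powR r f0) fd.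
Qed.

Lemma is_derive_quadratic (R : realType) (a b c : R) :
  is_derive (0 : R) 1 (fun t => a + t * b + c * t ^+ 2) b.
Proof.
have := is_deriveD (is_derive_affine a b 0)
  (is_deriveZ c (is_deriveX 2 (is_derive_id (0 : R) (1 : R)))).
move/is_derive_ext; apply => [s|].
  by [].
by rewrite /= expr1 mulr0 scale0r scaler0 addr0.
Qed.

Lemma enorm_line (R : realType) (x u : 'cV[R]_3) (t : R) :
  enorm (t *: u + x) ^+ 2 = enorm x ^+ 2 + t * (2 * dotp u x) + dotp u u * t ^+
    2.
Proof.
rewrite !enorm_sqr !(dotpDl, dotpDr, dotpZl, dotpZr) (dotpC x u); ring.
Qed.

Lemma sqrt_powR (R : realType) (a p : R) : 0 <= a -> Num.sqrt a `^ p = a `^ (p /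
  2).
Proof. by move=> a0; rewrite -powR12_sqrt// -powRrM mulrC. Qed.

(** Replaces the chain rule at the origin, where [|x|^p] with [p > 2] is a power of a vanishing
    quantity: the difference quotient is at most [C * |h|]. *)
Lemma is_derive_flat (R : realType) (f : R -> R) (C : R) :
  f 0 = 0 -> (forall t, `|t| <= 1 -> `|f t| <= C * t ^+ 2) ->
  is_derive (0 : R) 1 f 0.
Proof.
move=> f0 fC.
have C0 : 0 <= C.
  have := fC 1; rewrite normr1 lexx expr1n mulr1 => /(_ isT).
  by apply: le_trans.
have cv : (fun h : R => h^-1 *: ((f \o shift 0) (h *: 1) - f 0)) @ 0^' --> (0 :
  R).
  apply/cvgrPdist_le => e e0; near=> h.
  have h0 : h != 0 by near: h; exact: nbhs_dnbhs_neq.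
  have h1 : `|h| <= 1.
    by near: h; apply: dnbhs0_le.
  (* [C + 1] in place of [C], which may be zero. *)
  have he : `|h| <= e / (C + 1).
    by near: h; apply: dnbhs0_le; rewrite divr_gt0//; lra.
  rewrite /= addr0 f0 subr0 sub0r normrN !scale_mulr mulr1 normrM normfV.
  have hp : 0 < `|h| by rewrite normr_gt0.
  rewrite ler_pdivrMl//; apply: le_trans (fC _ h1) _.
  rewrite -[h ^+ 2]real_normK ?num_real// expr2 mulrCA ler_pM2l//.
  rewrite ler_pdivlMr in he; last by lra.
  by nra.
split; first by apply/cvg_ex; exists 0.
exact/cvg_lim.
Unshelve. all: by end_near. Qed.

(** [Phi] depends on [x] through [|x|^2] only, whence a gradient [phi * x] with [phi] independent of
    the direction. The factor is [(1 + |x|^2)^(p/2-1)] for [p < 2] and [|x|^(p-2)] for [p > 2], the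
    latter replaced by [0] at the origin. *)
Lemma is_derive_Phi (R : realType) (p : R) (x : 'cV[R]_3) :
  1 < p -> p != 2 -> exists phi : R, forall u,
    is_derive (0 : R) 1 (fun t => Phi p (t *: u + x)) (phi * dotp u x).
Proof.
move=> p1 pn2; have p0 : p != 0 by rewrite gt_eqF//; lra.
have [p2|p2] := ltP p 2.
  exists ((1 + enorm x ^+ 2) `^ (p / 2 - 1)) => u.
  have q0 : 0 < 1 + enorm x ^+ 2 + 0 * (2 * dotp u x) + dotp u u * 0 ^+ 2.
    by rewrite mul0r expr0n mulr0 !addr0 ltr_wpDr// sqr_ge0.
  have := is_deriveZ p^-1 (is_derive_powR_comp (p / 2)
    (is_derive_quadratic (1 + enorm x ^+ 2) (2 * dotp u x) (dotp u u)) q0).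
  move/is_derive_ext; apply => [t|].
    rewrite /Phi p2 /bracket sqrt_powR ?addr_ge0 ?sqr_ge0//=.
    by rewrite enorm_line !addrA.
  rewrite mul0r expr0n mulr0 !addr0 scale_mulr.
  by field.
have {}p2 : 2 < p by rewrite lt_neqAle eq_sym pn2.
have PhiE y : Phi p y = p^-1 * (enorm y ^+ 2) `^ (p / 2).
  rewrite /Phi ltNge (ltW p2)/= -[in LHS](ger0_norm (enorm_ge0 y)) -sqrtr_sqr.
  by rewrite sqrt_powR ?sqr_ge0.
have [->|x0] := eqVneq x 0.
  exists 0 => u; rewrite mul0r.
  apply: (@is_derive_flat _ _ (p^-1 * enorm u `^ p)) => [|t t1].
    by rewrite scale0r addr0 PhiE enorm0 expr0n powR0 ?mulr0//; lra.
  rewrite addr0 /Phi ltNge (ltW p2)/=.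
  have -> : enorm (t *: u) = `|t| * enorm u.
    by rewrite /enorm dotpZl dotpZr mulrA -expr2 sqrtrM ?sqr_ge0// sqrtr_sqr.
  rewrite powRM ?enorm_ge0// ger0_norm; last first.
    by rewrite !mulr_ge0 ?powR_ge0// invr_ge0; lra.
  rewrite -mulrA ler_pM2l ?invr_gt0; last by lra.
  rewrite mulrC ler_wpM2l ?powR_ge0//.
  have [->|t0] := eqVneq t 0; first by rewrite normr0 powR0 ?sqr_ge0.
  rewrite -[t ^+ 2]real_normK ?num_real// -powR_mulrn//.
  by rewrite ger_powR ?normr_gt0 ?t0// ltW.
exists ((enorm x ^+ 2) `^ (p / 2 - 1)) => u.
have q0 : 0 < enorm x ^+ 2 + 0 * (2 * dotp u x) + dotp u u * 0 ^+ 2.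
  rewrite mul0r expr0n mulr0 !addr0 exprn_gt0//.
  by rewrite lt_neqAle enorm_ge0 eq_sym enorm_eq0 x0.
have := is_deriveZ p^-1 (is_derive_powR_comp (p / 2)
  (is_derive_quadratic (enorm x ^+ 2) (2 * dotp u x) (dotp u u)) q0).
move/is_derive_ext; apply => [t|].
  by rewrite PhiE enorm_line.
rewrite mul0r expr0n mulr0 !addr0 scale_mulr.
by field.
Qed.

Lemma grad_is_derive (R : realType) (g : 'cV[R]_3 -> R) (x w : 'cV[R]_3) :
  (forall u, is_derive (0 : R) 1 (fun t => g (t *: u + x)) (dotp u w)) ->
  has_grad g x /\ grad g x = w.
Proof.
move=> gw; have gd u := is_derive_line (gw u).
split; first by move=> i; case: (gd (delta_mx i 0)).
apply/colP => i; rewrite mxE; have [_ ->] := gd (delta_mx i 0).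
exact: basis3_dotp.
Qed.

Lemma dotp_mulmx (R : realType) n (A : 'M[R]_n) (x y : 'cV[R]_n) :
  dotp (A *m x) y = dotp x (A^T *m y).
Proof.
rewrite /dotp; under eq_bigr do rewrite mxE mulr_suml.
rewrite exchange_big; apply: eq_bigr => j _; rewrite mxE mulr_sumr.
by apply: eq_bigr => i _; rewrite mxE; ring.
Qed.

Lemma skew_dotp (R : realType) n (A : 'M[R]_n) (x y : 'cV[R]_n) :
  A^T = - A -> dotp (A *m x) y = - dotp (A *m y) x.
Proof. by move=> AT; rewrite dotp_mulmx AT mulNmx dotpNr dotpC. Qed.

Lemma skew_dotp0 (R : realType) n (A : 'M[R]_n) (x : 'cV[R]_n) :
  A^T = - A -> dotp (A *m x) x = 0.
Proof. by move=> /(skew_dotp x x) h; lra. Qed.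

(** The common shape of [combination] along a line in [x] and along a line in [v]: the energy varies
    through [E], the two bilinear terms are affine in [t]. *)
Lemma is_derive_modulated_exp (R : realType) (E : R -> R)
    (dE c0 c1 k0 k1 al a0 a1 m : R) :
  is_derive (0 : R) 1 E dE ->
  is_derive (0 : R) 1 (fun t => (c0 + c1 * E t + (k0 + t * k1)) *
      (m * expR (- al * E t + (a0 + t * a1))))
    (m * expR (- al * E 0 + a0) *
     (c1 * dE + k1 + (c0 + c1 * E 0 + k0) * (- al * dE + a1))).
Proof.
move=> dEE.
have d1 := is_deriveD (is_deriveD (is_derive_cst c0 (0 : R) (1 : R)) (is_deriveZ
  c1 dEE))
  (is_derive_affine k0 k1 0).
have d2 := is_derive_expR_comp (is_deriveD (is_deriveZ (- al) dEE)
  (is_derive_affine a0 a1 0)).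
have := is_deriveM d1 (is_deriveZ m d2).
move/is_derive_ext; apply => [t|]; first by [].
have -> : (cst c0 + c1 \*: E + (fun s : R => k0 + s * k1)) 0 = c0 + c1 * E 0 +
  k0.
  by rewrite -[LHS]/(c0 + c1 * E 0 + (k0 + 0 * k1)) mul0r addr0.
have -> : (- al \*: E + (fun s : R => a0 + s * a1)) 0 = - al * E 0 + a0.
  by rewrite -[LHS]/(- al * E 0 + (a0 + 0 * a1)) mul0r addr0.
rewrite !scale_mulr.
set X := (m \*: _) 0.
have -> : X = m * expR (- al * E 0 + a0).
  by rewrite -[X]/(m * expR (- al * E 0 + (a0 + 0 * a1))) mul0r addr0.
ring.
Qed.

Lemma transport_kernel (R : realType) (p : R) (M : 'cV[R]_3 -> 'cV[R]_3 -> R)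
    (c : 'cV[R]_5) (x v : 'cV[R]_3) :
  1 < p -> p != 2 -> positive_equilibrium p M ->
  [/\ has_grad (Phi p) x, has_grad ((combination p M c) ^~ v) x,
      has_grad (combination p M c x) v &
      - dotp v (grad ((combination p M c) ^~ v) x) +
      dotp (grad (Phi p) x) (grad (combination p M c x) v) = 0].
Proof.
move=> p1 pn2 [m [al [A [m0 al0 AT A0 ME]]]].
have [phi dPhi] := is_derive_Phi x p1 pn2.
pose K := spin (tail3 c); have KT : K^T = - K by exact: spin_skew.
pose psi := c 0 0 + c 1 0 * energy p x v + dotp (K *m x) v.
have hE y w : combination p M c y w =
    (c 0 0 + c 1 0 * energy p y w + dotp (K *m y) w) *
    (m * expR (- al * energy p y w + dotp (A *m y) w)).
  by rewrite /combination dotp_chi ME.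
have ME' : M x v = m * expR (- al * energy p x v + dotp (A *m x) v) by exact:
  ME.
have [gP eP] : has_grad (Phi p) x /\ grad (Phi p) x = phi *: x.
  by apply: grad_is_derive => u; rewrite dotpZr; exact: dPhi.
have [gx ex] : has_grad ((combination p M c) ^~ v) x /\
    grad ((combination p M c) ^~ v) x =
    M x v *: ((c 1 0 * phi) *: x - K *m v + psi *: (- (al * phi) *: x - A *m
      v)).
  apply: grad_is_derive => u.
  have dE : is_derive (0 : R) 1 (fun t => energy p (t *: u + x) v) (phi * dotp u
    x).
    have := is_deriveD (dPhi u) (is_derive_cst (2^-1 * enorm v ^+ 2) (0 : R) (1
      : R)).
    by move/is_derive_ext; apply => [//|]; rewrite addr0.
  have := is_derive_modulated_exp (c 0 0) (c 1 0) (dotp (K *m x) v)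
    (dotp (K *m u) v) al (dotp (A *m x) v) (dotp (A *m u) v) m dE.
  move/is_derive_ext; apply => [t|].
    by rewrite hE !mulmxDr -!scalemxAr !dotpDl !dotpZl ![t * _ + _]addrC.
  rewrite scale0r add0r !(dotpZr, dotpDr, dotpNr) -/psi ME'.
  rewrite (skew_dotp u v KT) (skew_dotp u v AT) !(dotpC _ u); ring.
have [gv ev] : has_grad (combination p M c x) v /\
    grad (combination p M c x) v =
    M x v *: (c 1 0 *: v + K *m x + psi *: (- al *: v + A *m x)).
  apply: grad_is_derive => u.
  have dE : is_derive (0 : R) 1 (fun t => energy p x (t *: u + v)) (dotp u v).
    have := is_derive_quadratic (Phi p x + 2^-1 * enorm v ^+ 2) (dotp u v)
      (2^-1 * dotp u u).
    move/is_derive_ext; apply => [t|//].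
    by rewrite /energy enorm_line; field.
  have := is_derive_modulated_exp (c 0 0) (c 1 0) (dotp (K *m x) v)
    (dotp (K *m x) u) al (dotp (A *m x) v) (dotp (A *m x) u) m dE.
  move/is_derive_ext; apply => [t|].
    by rewrite hE !dotpDr !dotpZr ![t * _ + _]addrC.
  rewrite scale0r add0r !(dotpZr, dotpDr, dotpNr) -/psi ME'.
  rewrite !(dotpC _ u); ring.
(* The terms in [v . x] occur twice with opposite signs; all others are skew forms evaluated at a
   repeated vector. *)
split=> //; rewrite eP ex ev !(dotpZl, dotpZr, dotpDr, dotpNr).
rewrite (dotpC v (K *m v)) (dotpC v (A *m v)) (dotpC x (K *m x)) (dotpC x (A *m
  x)).
rewrite !skew_dotp0// (dotpC v x); ring.
Qed.

(** * Collisions *)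

Lemma dotp_le_enorm (R : realType) (e s : 'cV[R]_3) :
  dotp s s <= 1 -> `|dotp e s| <= enorm e.
Proof.
move=> s1; rewrite -[e in dotp e s]dir_scale dotpZl normrM ger0_norm
  ?enorm_ge0//.
by rewrite ler_piMr ?enorm_ge0// ler_norml dotp_itv ?dotp_dir_le1.
Qed.

Lemma enormB_le (R : realType) (u w : 'cV[R]_3) :
  enorm (u - w) <= enorm u + enorm w.
Proof.
rewrite -(ler_pXn2r (n := 2)) ?nnegrE ?addr_ge0 ?enorm_ge0//.
rewrite sqrrD !enorm_sqr !(dotpBl, dotpBr) (dotpC w u) -!enorm_sqr.
have : `|dotp u w| <= enorm u * enorm w.
  rewrite -[w in dotp u w]dir_scale dotpZr normrM ger0_norm ?enorm_ge0// mulrC.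
  by rewrite ler_wpM2r ?enorm_ge0// dotp_le_enorm// dotp_dir_le1.
by rewrite ler_norml => /andP[h _]; lra.
Qed.

(** The summand [1] makes every factor at least [1], so bounds that do not need the singularity can
    be multiplied by it freely. *)
Definition singular (R : realType) (k : R) (z : 'cV[R]_3) : R :=
  (1 + `|z 0 0| `^ (- k)) * (1 + `|z 1 0| `^ (- k)) * (1 + `|z 2 0| `^ (- k)).

(* For [gamma < 0] the bound fails where a coordinate vanishes, because
   [0 `^ r = 0] for [r != 0]. *)
Lemma powR_enorm_le (R : realType) (gamma : R) (z : 'cV[R]_3) :
  gamma <= 1 -> z 0 0 != 0 -> z 1 0 != 0 -> z 2 0 != 0 ->
  enorm z `^ gamma <= (1 + enorm z) * singular (Num.max 0 (- gamma / 3)) z.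
Proof.
move=> g1 z0 z1 z2; set k := Num.max _ _; have k0 : 0 <= k by rewrite le_max
  lexx.
have p0 i := powR_ge0 `|z i 0| (- k).
have z_ge0 := enorm_ge0 z.
have [g0|g0] := leP 0 gamma.
  apply: (@le_trans _ _ (1 + enorm z)).
    have [e1|e1] := leP (enorm z) 1.
      apply: (@le_trans _ _ 1); last by rewrite lerDl.
      have -> : 1 = 1 `^ gamma :> R by rewrite powR1.
      by rewrite ge0_ler_powR ?nnegrE.
    apply: (@le_trans _ _ (enorm z)); last by rewrite lerDr.
    by rewrite ler1_powR// ltW.
  rewrite ler_peMr ?addr_ge0// /singular.
  have h i : 1 <= 1 + `|z i 0| `^ (- k) by rewrite lerDl.
  by rewrite -[leLHS]mulr1 ler_pM// -[leLHS]mulr1 ler_pM.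
have kE : k = - gamma / 3 by apply/max_idPr; rewrite mulr_ge0 ?invr_ge0//; lra.
have enz : 0 < enorm z.
  by apply: lt_le_trans (coord_le_enorm z 0); rewrite normr_gt0.
have h i : z i 0 != 0 -> enorm z `^ (- k) <= 1 + `|z i 0| `^ (- k).
  move=> zi; apply: (@le_trans _ _ (`|z i 0| `^ (- k))); last by rewrite lerDr.
  by apply: ler_powRN => //; rewrite normr_gt0 zi coord_le_enorm.
(* [gamma = - 3 * k], so the power splits into three equal factors, each bounded through one
   coordinate. *)
have -> : enorm z `^ gamma = enorm z `^ (- k) * enorm z `^ (- k) * enorm z `^ (-
  k).
  rewrite -!powRD; try by apply/implyP => _; rewrite gt_eqF.
  by congr (_ `^ _); rewrite kE; field.
apply: (@le_trans _ _ (singular k z)).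
  by rewrite /singular !ler_pM ?mulr_ge0 ?powR_ge0 ?h.
by rewrite ler_peMl ?lerDl// /singular !mulr_ge0 ?addr_ge0.
Qed.

(** Here [gamma > -3] enters: the exponent given to each axis stays below the threshold [1] of local
    integrability. *)
Lemma collision_exponent (R : realType) (gamma : R) : -3 < gamma ->
  0 <= Num.max 0 (- gamma / 3) < 1.
Proof.
move=> g3; rewrite le_max lexx/= gt_max ltr01/=; lra.
Qed.

(** Majorant of the densities below, apart from their angular factor; it does not involve
    [sigma]. *)
Definition collision_weight (R : realType) (gamma : R) (mu : 'cV[R]_3 -> R)
    (v e : 'cV[R]_3) (k : R) (vs : 'cV[R]_3) : R :=
  mu v * mu vs * enorm (v - vs) `^ gamma *
  (enorm e * enorm (v - vs) + `|k| * enorm (v - vs) ^+ 2).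

Lemma finite_collision_weight (R : realType) (p gamma : R)
    (M : 'cV[R]_3 -> 'cV[R]_3 -> R) (x v e : 'cV[R]_3) (k : R) :
  1 < p -> p != 2 -> positive_equilibrium p M -> -3 < gamma <= 1 ->
  finite_integral (@leb3 R)
    (fun y => collision_weight gamma (M x) v e k (pt y)).
Proof.
move=> p1 pn2 hM /andP[g3 g1]; have p0 : 0 < p by lra.
set kap := Num.max 0 (- gamma / 3).
have k01 : 0 <= kap < 1 by exact: collision_exponent.
(* Three powers of [1 + |v - vs|] are to be absorbed: one from the bound on [|v - vs|^gamma], two
   from the quadratic term of the weight. [D] below converts each into a power of [1 + E]. *)
have [C C0 HC] := equilibrium_decay 3 p1 pn2 hM.
pose D := 1 + enorm v + (1 + p).
have D1 : 1 <= D by rewrite /D; have := enorm_ge0 v; lra.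
have D0 : 0 <= D by lra.
pose B := M x v * (enorm e + `|k|) * D ^+ 3 * C * decay x.
have M0 w : 0 < M x w by exact: equilibrium_gt0 hM.
have B0 : 0 <= B.
  rewrite /B mulr_ge0 ?(ltW (decay_gt0 x))// mulr_ge0// mulr_ge0 ?exprn_ge0//.
  by rewrite mulr_ge0 ?addr_ge0 ?enorm_ge0// ltW.
have fs a : finite_integral (@lebesgue_measure R)
    (fun t => (1 + `|a - t| `^ (- kap)) * invsqr1 t).
  exact: finite_integral_shifted_power.
have mv : vmeasurable (fun y : R3 R => v - pt y).
  by apply: vmeasurableB; [exact: vmeasurable_cst|exact: vmeasurable_idpt].
apply: finite_integral_ae_le (finite_integralZ B0
  (finite_integral_leb3 (fs (v 0 0)) (fs (v 1 0)) (fs (v 2 0)))).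
- apply: measurable_funM.
    apply: measurable_funM; last first.
      exact: measurableT_comp (measurable_powR _) (measurable_enorm mv).
    apply: measurable_funM => //.
    by apply: (measurable_equilibrium hM); [exact: vmeasurable_cst|exact:
      vmeasurable_idpt].
  apply: measurable_funD; apply: measurable_funM => //.
    exact: measurable_enorm.
  by apply: measurable_funX; exact: measurable_enorm.
- move=> y; rewrite /collision_weight mulr_ge0 ?addr_ge0 ?mulr_ge0 ?powR_ge0
  ?enorm_ge0 ?exprn_ge0//.
  + exact: ltW.
  + exact: ltW.
apply: filterS (ae_coordinates_neq (tup v)) => y [/= y0 y1 y2].
set vs := pt y; set z := v - vs.
have hz : enorm z `^ gamma <= (1 + enorm z) * singular kap z.
  by apply: powR_enorm_le => //; rewrite /z /vs !mxE/= subr_eq0 eq_sym.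
have E0 := energy_ge0 x vs p0; set W := 1 + energy p x vs.
have zW : 1 + enorm z <= D * W.
  apply: (@le_trans _ _ (1 + (enorm v + enorm vs))).
    by rewrite lerD2l enormB_le.
  have vsW : enorm vs <= 1 + enorm vs ^+ 2 / 2.
    have : 0 <= (enorm vs - 1) ^+ 2 by exact: sqr_ge0.
    by rewrite (_ : _ ^+ 2 = enorm vs ^+ 2 - 2 * enorm vs + 1); [lra|ring].
  have vsE : enorm vs ^+ 2 / 2 <= energy p x vs.
    by rewrite /energy mulrC lerDr Phi_ge0.
  rewrite /D /W; have := enorm_ge0 v; nra.
have z0 := enorm_ge0 z.
have s0 : 0 <= singular kap z.
  by rewrite /singular !mulr_ge0// addr_ge0// powR_ge0.
have step : collision_weight gamma (M x) v e k vs <=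
   M x v * (enorm e + `|k|) * singular kap z * D ^+ 3 * (W ^+ 3 * M x vs).
  rewrite /collision_weight -/z.
  have -> : M x v * (enorm e + `|k|) * singular kap z * D ^+ 3 * (W ^+ 3 * M x
    vs) =
     M x v * M x vs * ((D * W * singular kap z) * ((enorm e + `|k|) * (D * W) ^+
       2)) by ring.
  rewrite -[leLHS]mulrA ler_pM2l ?mulr_gt0//.
  have k0 := normr_ge0 k; have e0 := enorm_ge0 e.
  apply: ler_pM; first exact: powR_ge0.
  - by rewrite addr_ge0 ?mulr_ge0.
  - by apply: le_trans hz _; rewrite ler_wpM2r.
  - rewrite mulrDl; apply: lerD; rewrite ler_wpM2l//; last first.
      by rewrite ler_pXn2r ?nnegrE//; lra.
    by nra.
apply: le_trans step _.
apply: (@le_trans _ _ (M x v * (enorm e + `|k|) * singular kap z * D ^+ 3 *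
   (C * (decay x * decay vs)))).
  rewrite ler_wpM2l ?HC// mulr_ge0 ?exprn_ge0// mulr_ge0//.
  by rewrite mulr_ge0 ?addr_ge0 ?enorm_ge0// ltW.
rewrite /B /singular /decay /z /vs !mxE /=.
set S := M x v * _; rewrite le_eqVlt; apply/orP; left; apply/eqP; ring.
Qed.

(* [B mu mu_* (psi(v') - psi(v))] for a quadratic [psi] with gradient [e] at
   [v] and Hessian [k%:M]. *)
Definition collision_density (R : realType) (gamma : R) (b : R -> R)
    (mu : 'cV[R]_3 -> R) (v e : 'cV[R]_3) (k : R) (vs s : 'cV[R]_3) : R :=
  enorm (v - vs) `^ gamma * clip b (dotp (dir (v - vs)) s) * (mu v * mu vs) *
  (2^-1 * enorm (v - vs) * dotp e (s - dir (v - vs)) +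
   k / 4 * enorm (v - vs) ^+ 2 * (1 - dotp (dir (v - vs)) s)).

(* The mean of [collision_density] over the half-turn around [v - vs]: the
  factor
   [1 - cos theta] compensates the angular singularity. *)
Definition averaged_density (R : realType) (gamma : R) (b : R -> R)
    (mu : 'cV[R]_3 -> R) (v e : 'cV[R]_3) (k : R) (vs s : 'cV[R]_3) : R :=
  enorm (v - vs) `^ gamma * clip b (dotp (dir (v - vs)) s) * (mu v * mu vs) *
  ((1 - dotp (dir (v - vs)) s) *
   (k / 4 * enorm (v - vs) ^+ 2 - 2^-1 * enorm (v - vs) * dotp e (dir (v -
     vs)))).

(** The first bound keeps the full singularity of [b] and is of use on truncated sets; the second
    carries the factor [1 - cos theta] and needs no truncation. Allowing [|s| <= 1] covers
    [dir 0 = 0]. *)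
Lemma collision_density_bound (R : realType) (gamma : R) (b : R -> R)
    (mu : 'cV[R]_3 -> R) (v e : 'cV[R]_3) (k : R) (vs s : 'cV[R]_3) :
  angular_kernel b -> (forall w, 0 < mu w) -> dotp s s <= 1 ->
  `|collision_density gamma b mu v e k vs s| <=
    collision_weight gamma mu v e k vs * clip b (dotp (dir (v - vs)) s) /\
  `|averaged_density gamma b mu v e k vs s| <=
    collision_weight gamma mu v e k vs *
    (clip b (dotp (dir (v - vs)) s) * (1 - dotp (dir (v - vs)) s)).
Proof.
move=> ab mu0 s1; set z := v - vs; set u := dotp (dir z) s.
have /andP[u1 u2] : -1 <= u <= 1 by apply: dotp_itv => //; exact: dotp_dir_le1.
have z0 := enorm_ge0 z; have c0 := clip_ge0 u ab.
have e1 : `|dotp e s| <= enorm e by exact: dotp_le_enorm.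
have e2 : `|dotp e (dir z)| <= enorm e by apply: dotp_le_enorm; exact:
  dotp_dir_le1.
have A0 : 0 <= enorm z `^ gamma * clip b u * (mu v * mu vs).
  by rewrite !mulr_ge0 ?powR_ge0// ltW.
have z2 : 0 <= enorm z ^+ 2 by exact: sqr_ge0.
rewrite /collision_density /averaged_density /collision_weight -/z -/u; split.
  rewrite normrM (ger0_norm A0).
  rewrite (_ : mu v * mu vs * enorm z `^ gamma * _ * clip b u =
    enorm z `^ gamma * clip b u * (mu v * mu vs) *
    (enorm e * enorm z + `|k| * enorm z ^+ 2)); last by ring.
  apply: ler_wpM2l => //; apply: le_trans (ler_normD _ _) _; apply: lerD.
    rewrite !normrM (ger0_norm z0) [X in X * _ * _]ger0_norm ?invr_ge0//.
    have : `|dotp e (s - dir z)| <= 2 * enorm e.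
      by rewrite dotpBr; apply: le_trans (ler_normB _ _) _; lra.
    by have := normr_ge0 (dotp e (s - dir z)); nra.
  rewrite 2!normrM [`|k / 4|]normrM (ger0_norm z2) [X in _ * X * _ * _]ger0_norm
    ?invr_ge0//.
  have -> : `|1 - u| = 1 - u by rewrite ger0_norm//; lra.
  rewrite (_ : _ * (1 - u) = `|k| * enorm z ^+ 2 * ((1 - u) / 4)); last by ring.
  by rewrite ler_piMr ?mulr_ge0//; lra.
rewrite normrM (ger0_norm A0) normrM.
have -> : `|1 - u| = 1 - u by rewrite ger0_norm//; lra.
rewrite (_ : mu v * mu vs * enorm z `^ gamma * _ * (clip b u * (1 - u)) =
  enorm z `^ gamma * clip b u * (mu v * mu vs) *
  ((1 - u) * (enorm e * enorm z + `|k| * enorm z ^+ 2))); last by ring.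
apply: ler_wpM2l => //; apply: ler_wpM2l; first by lra.
rewrite [leRHS]addrC; apply: le_trans (ler_normB _ _) _; apply: lerD.
  rewrite normrM [`|k / 4|]normrM (ger0_norm z2) [X in _ * X * _]ger0_norm
    ?invr_ge0//.
  by have := normr_ge0 k; nra.
rewrite !normrM (ger0_norm z0) [X in X * _ * _]ger0_norm ?invr_ge0//.
by have := normr_ge0 (dotp e (dir z)); nra.
Qed.

(** * Truncated integrals, their symmetrization and their limits *)

Lemma integrable_indicP d (T : measurableType d) (R : realType)
    (m : {measure set T -> \bar R}) (A : set T) (f : T -> R) :
  measurable A -> m.-integrable A (EFin \o f) <->
  m.-integrable setT (fun z => (f z * \1_A z)%:E).
Proof.
move=> mA; have E : ((EFin \o f) \_ A = fun z => (f z * \1_A z)%:E)%E.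
  by apply/funext => z; rewrite patchE indicE; case: (z \in A) => /=; rewrite
    ?mulr1 ?mulr0.
by rewrite -E; exact: integrable_mkcond.
Qed.

Lemma Rintegral_indic d (T : measurableType d) (R : realType)
    (m : {measure set T -> \bar R}) (A : set T) (f : T -> R) :
  \int[m]_(z in A) f z = \int[m]_z (f z * \1_A z).
Proof.
rewrite Rintegral_mkcond; apply: eq_Rintegral => z _.
by rewrite patchE indicE; case: (z \in A) => /=; rewrite ?mulr1 ?mulr0.
Qed.

(** The integral grows as [eps] decreases and is bounded by the integral over the whole space.
    Monotonicity of the sets is assumed below some [r] only, because [cos] decreases on [[0, pi]]
    only. *)
Lemma ge0_cvg_integral_exhaust d (T : measurableType d) (R : realType)
    (m : {measure set T -> \bar R}) (L : T -> R) (A : R -> set T) (r : R) :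
  0 < r -> (forall z, 0 <= L z) -> m.-integrable setT (EFin \o L) ->
  (forall eps, measurable (A eps)) ->
  (forall e1 e2, 0 < e1 -> e1 <= e2 -> e2 < r -> A e2 `<=` A e1) ->
  cvg (\int[m]_(z in A eps) L z @[eps --> 0^'+]).
Proof.
move=> r0 L0 iL mA ndA; apply/cvg_ex; eexists.
have iA e : m.-integrable (A e) (EFin \o L) by exact: integrableS iL.
have iLA e : m.-integrable setT (EFin \o (fun z => L z * \1_(A e) z)).
  exact: (integrable_indicP m L (mA e)).1 (iA e).
apply: (@nonincreasing_at_right_cvgr _ _ _ (BLeft r)); first by rewrite
  bnd_simp.
- move=> e1 e2; rewrite !in_itv/= => /andP[e10 e1r] /andP[e20 e2r] e12.
  rewrite (Rintegral_indic m (A e1)) (Rintegral_indic m (A e2)).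
  apply: le_Rintegral => //.
  move=> z _; rewrite ler_wpM2l// !indicE ler_nat.
  have [ze2|//] := boolP (z \in A e2).
  by rewrite mem_set//; apply: (ndA e1 e2) => //; exact: set_mem.
- exists (\int[m]_z L z) => _ [e _ <-].
  rewrite (Rintegral_indic m (A e)); apply: le_Rintegral => //.
  by move=> z _; rewrite ler_piMr// indicE lern1 leq_b1.
Qed.

Lemma cvg_integral_exhaust d (T : measurableType d) (R : realType)
    (m : {measure set T -> \bar R}) (L : T -> R) (A : R -> set T) (r : R) :
  0 < r -> m.-integrable setT (EFin \o L) ->
  (forall eps, measurable (A eps)) ->
  (forall e1 e2, 0 < e1 -> e1 <= e2 -> e2 < r -> A e2 `<=` A e1) ->
  cvg (\int[m]_(z in A eps) L z @[eps --> 0^'+]).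
Proof.
move=> r0 iL mA ndA.
have ip : m.-integrable setT (EFin \o L^\+) by exact: integrable_funrpos.
have im : m.-integrable setT (EFin \o L^\-) by exact: integrable_funrneg.
have -> : (fun eps => \int[m]_(z in A eps) L z) =
    (fun eps => \int[m]_(z in A eps) (L^\+)%R z - \int[m]_(z in A eps) (L^\-)%R
      z).
  apply/funext => e; rewrite -RintegralB//.
  - by apply: eq_Rintegral => z _; rewrite -[in LHS](funrposBneg L).
  - exact: integrableS ip.
  - exact: integrableS im.
by apply: is_cvgB; apply: (@ge0_cvg_integral_exhaust _ _ _ _ _ _ r).
Qed.

Lemma indic_angle_gt (R : realType) (v : 'cV[R]_3) (eps : R) z :
  \1_(angle_gt v eps) z =
  (dotp (dir (v - pt z.1)) (dir (pt z.2)) < cos eps)%R%:R *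
  \1_(@unit_ball R) z.2 :> R.
Proof.
rewrite !indicE -natrM mulnb; congr (nat_of_bool _)%:R.
apply/idP/idP; rewrite inE /angle_gt/=.
  by move=> [zb ->] /=; rewrite inE.
by move=> /andP[-> /set_mem].
Qed.

Lemma vmeasurable_relative (R : realType) (v : 'cV[R]_3) :
  vmeasurable (fun z : (R3 R * R3 R)%type => v - pt z.1).
Proof.
apply: vmeasurableB; first exact: vmeasurable_cst.
exact: vmeasurable_pt measurable_fst.
Qed.

Lemma vmeasurable_direction (R : realType) :
  vmeasurable (fun z : (R3 R * R3 R)%type => dir (pt z.2)).
Proof. by apply: vmeasurable_dir; exact: vmeasurable_pt measurable_snd. Qed.

Lemma measurable_cosine (R : realType) (v : 'cV[R]_3) :
  measurable_fun setT (fun z : (R3 R * R3 R)%type =>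
    dotp (dir (v - pt z.1)) (dir (pt z.2))).
Proof.
apply: measurable_dotp; last exact: vmeasurable_direction.
by apply: vmeasurable_dir; exact: vmeasurable_relative.
Qed.

Lemma measurable_angle_gt (R : realType) (v : 'cV[R]_3) (eps : R) :
  measurable (angle_gt v eps).
Proof.
rewrite (_ : angle_gt v eps = (snd @^-1` @unit_ball R) `&`
  ((fun z : (R3 R * R3 R)%type => dotp (dir (v - pt z.1)) (dir (pt z.2))) @^-1`
    `]-oo, cos eps[%classic)).
  apply: measurableI; rewrite -[X in measurable X]setTI.
    by apply: measurable_snd => //; exact: measurable_unit_ball.
  by apply: measurable_cosine.
by apply/seteqP; split => z /=; rewrite /angle_gt /= in_itv.
Qed.

Lemma angle_gt_antitone (R : realType) (v : 'cV[R]_3) (e1 e2 : R) :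
  0 < e1 -> e1 <= e2 -> e2 < pi -> angle_gt v e2 `<=` angle_gt v e1.
Proof.
move=> e10 e12 e2pi z [zb zc]; split=> //; apply: lt_le_trans zc _.
by rewrite leNgt ltr_cos -?leNgt// in_itv/=; lra.
Qed.

(** The integrals of [f] and of [f] composed with [h] agree, so each equals the integral of their
    mean. Absolute integrability of [f] is essential, and truncation provides it. *)
Lemma Rintegral_symmetrize d (T : measurableType d) (R : realType)
    (m : {measure set T -> \bar R}) (h : T -> T) (f g : T -> R) :
  measure_preserving m h -> measurable_fun setT f ->
  finite_integral m (fun z => `|f z|) ->
  (forall z, f z + f (h z) = 2 * g z) ->
  \int[m]_z f z = \int[m]_z g z.
Proof.
move=> mh mf ff fg.
have int_f : m.-integrable setT (EFin \o f).
  exact: finite_integral_integrable mf (fun z => lexx _) ff.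
have int_fh : m.-integrable setT (EFin \o (fun z => f (h z))).
  apply: finite_integral_integrable (fun z => lexx _)
    (finite_integral_comp mh ff).
  exact: measurableT_comp mf mh.1.
have fhE : \int[m]_z f (h z) = \int[m]_z f z.
  congr fine.
  apply: (measure_preserving_integral (g := fun z => (f z)%:E) mh).
  exact/measurable_EFinP.
have -> : \int[m]_z g z = \int[m]_z (2^-1 * (f z + f (h z))).
  by apply: eq_Rintegral => z _; rewrite fg mulrA mulVf ?mul1r.
rewrite RintegralZl//; last first.
  by have := integrableD measurableT int_f int_fh; apply: eq_integrable.
by rewrite RintegralD// fhE; field.
Qed.

Section densities.
Context (R : realType) (p gamma : R) (b : R -> R)
  (M : 'cV[R]_3 -> 'cV[R]_3 -> R) (x v e : 'cV[R]_3) (k : R)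
  (p1 : 1 < p) (pn2 : p != 2) (hM : positive_equilibrium p M)
  (hg : -3 < gamma <= 1) (ab : angular_kernel b).

Let J (z : (R3 R * R3 R)%type) :=
  collision_density gamma b (M x) v e k (pt z.1) (dir (pt z.2)).
Let Jt (z : (R3 R * R3 R)%type) :=
  averaged_density gamma b (M x) v e k (pt z.1) (dir (pt z.2)).
Let u (z : (R3 R * R3 R)%type) := dotp (dir (v - pt z.1)) (dir (pt z.2)).

Let mpref : measurable_fun setT (fun z : (R3 R * R3 R)%type =>
  enorm (v - pt z.1) `^ gamma * clip b (u z) * (M x v * M x (pt z.1))).
Proof.
apply: measurable_funM; first apply: measurable_funM.
- apply: measurableT_comp (measurable_powR _) _.
  by apply: measurable_enorm; exact: vmeasurable_relative.
- by apply: measurableT_comp (measurable_clip ab) _; exact: measurable_cosine.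
- apply: measurable_funM => //; apply: (measurable_equilibrium hM).
    exact: vmeasurable_cst.
  exact: vmeasurable_pt measurable_fst.
Qed.

Lemma measurable_collision_density : measurable_fun setT J.
Proof.
have mr := vmeasurable_relative v; have mu := measurable_cosine v.
apply: measurable_funM => //; apply: measurable_funD; apply: measurable_funM.
- by apply: measurable_funM => //; exact: measurable_enorm.
- apply: measurable_dotp; first exact: vmeasurable_cst.
  by apply: vmeasurableB; [exact: vmeasurable_direction|exact: vmeasurable_dir].
- by apply: measurable_funM => //; apply: measurable_funX; exact:
  measurable_enorm.
- exact: measurable_funB.
Qed.

Lemma measurable_averaged_density : measurable_fun setT Jt.
Proof.
have mr := vmeasurable_relative v; have mu := measurable_cosine v.
apply: measurable_funM => //; apply: measurable_funM; first exact:
  measurable_funB.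
apply: measurable_funB; apply: measurable_funM => //.
- by apply: measurable_funX; exact: measurable_enorm.
- by apply: measurable_funM => //; exact: measurable_enorm.
- by apply: measurable_dotp; [exact: vmeasurable_cst|exact: vmeasurable_dir].
Qed.

(** One estimate serves the truncated density and the averaged one: only the angular factor [g]
    differs. *)
Let finite_weighted (g : R -> R) (C : R) :
  measurable_fun setT g -> (forall t, 0 <= g t) -> angular_bound g C ->
  finite_integral (@leb6 R) (fun z =>
    collision_weight gamma (M x) v e k (pt z.1) *
      (g (u z) * \1_(@unit_ball R) z.2)).
Proof.
move=> mg g0 [C0 gC].
apply: (@finite_integral_kernel _ _ _ _ R (@leb3 R) (@leb3 R)
  (fun y => collision_weight gamma (M x) v e k (pt y))
  (fun y y' => g (dotp (dir (v - pt y)) (dir (pt y'))) * \1_(@unit_ball R) y')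
    C) => //.
- apply: measurable_funM.
    by apply: measurableT_comp mg _; exact: measurable_cosine.
  by apply: measurableT_comp (@measurable_ball_indic R) _.
- by move=> y y'; rewrite mulr_ge0// indicE.
- exact: (@finite_collision_weight R p gamma M x v e k).
Qed.

Lemma finite_collision_density (eps : R) : 0 < eps < pi / 2 ->
  finite_integral (@leb6 R) (fun z => `|J z| * \1_(angle_gt v eps) z).
Proof.
move=> he; have [C gC] := angular_bound_trunc ab he.
have mi : measurable_fun setT (fun t : R => (t < cos eps)%R%:R : R).
  rewrite (_ : (fun t => _) = \1_(`]-oo, cos eps[%classic : set R)).
    by apply: measurable_indic; exact: measurable_itv.
  by apply/funext => t; rewrite indicE mem_setE in_itv.
have mg : measurable_fun setT (fun t : R => clip b t * (t < cos eps)%R%:R).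
  by apply: measurable_funM => //; exact: measurable_clip.
have g0 t : 0 <= clip b t * (t < cos eps)%R%:R by rewrite mulr_ge0 ?clip_ge0.
apply: finite_integral_le (finite_weighted mg g0 gC).
- apply: measurable_funM.
    exact: measurableT_comp (@normr_measurable _ _)
      measurable_collision_density.
  by apply: measurable_indic; exact: measurable_angle_gt.
- move=> z; rewrite mulr_ge0 ?indicE//= -indicE indic_angle_gt.
  have [h _] := @collision_density_bound R gamma b (M x) v e k (pt z.1) (dir (pt
    z.2))
    ab (fun w => equilibrium_gt0 x w hM) (dotp_dir_le1 _).
  rewrite -[clip b _ * _ * _]mulrA [leRHS]mulrA; exact: ler_wpM2r.
Qed.

Lemma integrable_averaged_density :
  (@leb6 R).-integrable setT (fun z => (Jt z * \1_(@unit_ball R) z.2)%:E).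
Proof.
have [C gC] := angular_bound_weighted ab.
have m1 : measurable_fun setT (fun t : R => clip b t * (1 - t)).
  apply: measurable_funM; first exact: measurable_clip.
  exact: measurable_funB.
have g0 t : 0 <= clip b t * (1 - t).
  have [t1|t1] := leP t 1; first by rewrite mulr_ge0 ?clip_ge0//; lra.
  by rewrite clipE [t <= 1]leNgt t1 andbF mul0r.
apply: (finite_integral_integrable _ _ (finite_weighted m1 g0 gC)).
- apply: measurable_funM; first exact: measurable_averaged_density.
  exact: measurableT_comp (@measurable_ball_indic R) measurable_snd.
- move=> z; have [_ h] := @collision_density_bound R gamma b (M x) v e k (pt
  z.1) (dir (pt z.2))
    ab (fun w => equilibrium_gt0 x w hM) (dotp_dir_le1 _).
  rewrite normrM [X in _ * X]ger0_norm ?indicE// mulrA -indicE.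
  by apply: ler_wpM2r; rewrite ?indicE.
Qed.

Let turn (z : (R3 R * R3 R)%type) :=
  (z.1, tup (half_turn (dir (v - pt z.1)) (pt z.2))).

(** The turn about [n] keeps the cosine and the ball, and [s] plus its image is [2 (n . s) n]. Hence
    the two linear terms [e . (s - n)] add up to [- 2 (1 - n . s) (e . n)]. *)
Lemma turn_density (eps : R) z : 0 < eps < pi / 2 ->
  J z * \1_(angle_gt v eps) z + J (turn z) * \1_(angle_gt v eps) (turn z) =
  2 * (Jt z * \1_(angle_gt v eps) z).
Proof.
move=> he; rewrite !indic_angle_gt /J /Jt /turn /= tupK.
rewrite /collision_density /averaged_density.
move: (M x v * M x (pt z.1)) => mm.
(* At zero relative velocity there is no axis, but every density contains a factor
   [enorm (v - vs) = 0]. *)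
have [z0|z0] := eqVneq (v - pt z.1) 0.
  by rewrite z0 enorm0; ring.
have n1 := dir_dir z0; move: (dir (v - pt z.1)) n1 => n n1.
have -> : dir (half_turn n (pt z.2)) = half_turn n (dir (pt z.2)).
  rewrite /dir half_turn_norm// /half_turn dotpZr scalerBr scalerA.
  by congr (_ *: _ - _); rewrite mulrCA.
rewrite half_turn_dotp//.
have -> : \1_(@unit_ball R) (tup (half_turn n (pt z.2))) = \1_(@unit_ball R) z.2
  :> R.
  rewrite !indicE; congr (nat_of_bool _)%:R.
  by apply/idP/idP; rewrite !inE /unit_ball/= tupK half_turn_norm.
rewrite /half_turn !(dotpBr, dotpZr).
set s := dir (pt z.2); move: s => s; ring.
Qed.

(** Every point of [angle_gt] already lies over the ball; the indicator is written so that one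
    function, integrable over the whole space, serves all [eps]. *)
Lemma turn_integral (eps : R) : 0 < eps < pi / 2 ->
  \int[@leb6 R]_(z in angle_gt v eps) J z =
  \int[@leb6 R]_(z in angle_gt v eps) (Jt z * \1_(@unit_ball R) z.2).
Proof.
move=> he; have mA := measurable_angle_gt v eps.
rewrite (Rintegral_indic _ _ J) (Rintegral_indic _ (angle_gt v eps)).
apply: (@Rintegral_symmetrize _ _ R (@leb6 R) turn).
- exact: measure_preserving_collision_turn.
- apply: measurable_funM; first exact: measurable_collision_density.
  exact: measurable_indic.
- rewrite (_ : (fun z => _) = fun z => `|J z| * \1_(angle_gt v eps) z).
    exact: finite_collision_density.
  apply/funext => z; rewrite normrM; congr (_ * _).
  by rewrite ger0_norm// indicE.
- move=> z; rewrite turn_density//; congr (2 * _).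
  by rewrite indic_angle_gt indicE; case: (_ \in _); rewrite /= !(mulr0, mulr1).
Qed.

Lemma cvg_averaged_density :
  cvg (\int[@leb6 R]_(z in angle_gt v eps) (Jt z * \1_(@unit_ball R) z.2)
    @[eps --> 0^'+]).
Proof.
apply: (@cvg_integral_exhaust _ _ _ _ _ _ pi); first exact: pi_gt0.
- exact: integrable_averaged_density.
- exact: measurable_angle_gt.
- exact: angle_gt_antitone.
Qed.

End densities.

(** [sigma = dir y] is a unit vector only for [y != 0], and the collision identities need that. The
    exceptional points are enclosed in the null hyperplane where the third coordinate of [y]
    vanishes. *)
Lemma ae_direction_neq0 (R : realType) :
  {ae @leb6 R, forall z, pt z.2 != 0}.
Proof.
exists (setT `*` (setT `*` [set 0 : measurableTypeR R])); split.
- apply: measurableX => //; apply: measurableX => //; exact: measurable_set1.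
- have mT : measurable [set: measurableTypeR R] by exact: measurableT.
  have m0 : measurable [set (0 : measurableTypeR R)] by exact: measurable_set1.
  have E3 : @leb3 R (setT `*` [set 0 : measurableTypeR R]) = 0%E.
    apply: etrans (@product_measure1E _ _ _ _ R (@leb2 R) (@lebesgue_measure R)
      _ _ _ _) _ => //.
    by rewrite [X in (_ * X)%E](lebesgue_measure_set1 (0 : R)) mule0.
  apply: etrans (@product_measure1E _ _ _ _ R (@leb3 R) (@leb3 R) _ _ _ _) _ =>
    //.
    by apply: measurableX.
  by rewrite [X in (_ * X)%E]E3 mule0.
- move=> z /= nz; split=> //; split=> //=.
  apply: contra_notP nz => z0; apply/eqP => /colP/(_ 2).
  by rewrite !mxE.
Qed.

Lemma measurable_Qintegrand (R : realType) (gamma : R) (b : R -> R)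
    (F G : 'cV[R]_3 -> R) (v : 'cV[R]_3) :
  angular_kernel b ->
  (forall W : (R3 R * R3 R)%type -> 'cV[R]_3, vmeasurable W ->
     measurable_fun setT (F \o W) /\ measurable_fun setT (G \o W)) ->
  measurable_fun setT (fun z : (R3 R * R3 R)%type =>
    Qintegrand gamma b F G v (pt z.1) (dir (pt z.2))).
Proof.
move=> ab mFG.
have mr := vmeasurable_relative v; have md := @vmeasurable_direction R.
have mvs : vmeasurable (fun z : (R3 R * R3 R)%type => pt z.1).
  exact: vmeasurable_pt measurable_fst.
have mc : vmeasurable (fun z : (R3 R * R3 R)%type => 2^-1 *: (v + pt z.1)).
  by apply: vmeasurableZ => //; apply: vmeasurableD => //; exact:
    vmeasurable_cst.
have mo : vmeasurable (fun z : (R3 R * R3 R)%type =>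
    (2^-1 * enorm (v - pt z.1)) *: dir (pt z.2)).
  by apply: vmeasurableZ => //; apply: measurable_funM => //; exact:
    measurable_enorm.
apply: measurable_funM.
  (* Measurability of [b] is known on [[-1, 1]] only; cosines lie there, so [b] may be replaced by
     [clip b]. *)
  rewrite (_ : (fun z => _) = fun z : (R3 R * R3 R)%type => enorm (v - pt z.1)
    `^ gamma *
      clip b (dotp (dir (v - pt z.1)) (dir (pt z.2)))).
    apply: measurable_funM.
      by apply: measurableT_comp (measurable_powR _) _; exact: measurable_enorm.
    by apply: measurableT_comp (measurable_clip ab) _; exact: measurable_cosine.
  by apply/funext => z; rewrite /kernelB clipE dotp_itv ?dotp_dir_le1.
apply: measurable_funB; apply: measurable_funM => //.
- exact: (mFG _ (vmeasurableB mc mo)).1.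
- exact: (mFG _ (vmeasurableD mc mo)).2.
- exact: (mFG _ mvs).1.
Qed.

(** The factor [s] lets [Q(M, h)] and [Q(h, M)] share one proof and, above all, one limit. *)
Lemma Q_of_density (R : realType) (p gamma : R) (b : R -> R)
    (M : 'cV[R]_3 -> 'cV[R]_3 -> R) (x v e : 'cV[R]_3) (k s : R)
    (F G : 'cV[R]_3 -> R) :
  1 < p -> p != 2 -> positive_equilibrium p M -> -3 < gamma <= 1 ->
  angular_kernel b ->
  measurable_fun setT (fun z : (R3 R * R3 R)%type =>
    Qintegrand gamma b F G v (pt z.1) (dir (pt z.2))) ->
  (forall z : (R3 R * R3 R)%type, pt z.2 != 0 ->
    Qintegrand gamma b F G v (pt z.1) (dir (pt z.2)) =
    s * collision_density gamma b (M x) v e k (pt z.1) (dir (pt z.2))) ->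
  Q_converges gamma b F G v /\
  Q gamma b F G v = s * (3 * lim (\int[@leb6 R]_(z in angle_gt v eps)
    (averaged_density gamma b (M x) v e k (pt z.1) (dir (pt z.2)) *
      \1_(@unit_ball R) z.2) @[eps --> 0^'+])).
Proof.
move=> p1 pn2 hM hg ab mQ QJ.
set q := (fun z : (R3 R * R3 R)%type => _) in mQ.
pose J (z : (R3 R * R3 R)%type) :=
  collision_density gamma b (M x) v e k (pt z.1) (dir (pt z.2)).
have aeQ : {ae @leb6 R, forall z, q z = s * J z}.
  by apply: filterS (ae_direction_neq0 R) => z; exact: QJ.
have mJ : measurable_fun setT J.
  exact: (measurable_collision_density gamma x v e k hM ab).
have main eps : 0 < eps < pi / 2 ->
    (@leb6 R).-integrable (angle_gt v eps) (EFin \o q) /\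
    Qtrunc gamma b F G v eps = s * (3 * \int[@leb6 R]_(z in angle_gt v eps)
      (averaged_density gamma b (M x) v e k (pt z.1) (dir (pt z.2)) *
      \1_(@unit_ball R) z.2)).
  move=> he; have mA := measurable_angle_gt v eps.
  have mi : measurable_fun setT (\1_(angle_gt v eps) : _ -> R) by exact:
    measurable_indic.
  have fJ := finite_collision_density x v e k p1 pn2 hM hg ab he.
  have mqA : measurable_fun setT (fun z => q z * \1_(angle_gt v eps) z).
    exact: measurable_funM.
  have fq : finite_integral (@leb6 R) (fun z => `|q z * \1_(angle_gt v eps) z|).
    apply: finite_integral_ae_le (finite_integralZ (normr_ge0 s) fJ).
    - exact: measurableT_comp (@normr_measurable _ _) mqA.
    - by move=> z; exact: normr_ge0.
    apply: filterS aeQ => z ->; rewrite 2!normrM mulrA.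
    by rewrite [X in _ * X <= _]ger0_norm// indicE.
  have iJ : (@leb6 R).-integrable (angle_gt v eps) (EFin \o J).
    apply/(integrable_indicP _ _ mA).
    have mJA : measurable_fun setT (fun z => J z * \1_(angle_gt v eps) z).
      exact: measurable_funM.
    apply: finite_integral_integrable mJA _ fJ => z.
    by rewrite normrM [X in _ * X <= _]ger0_norm// indicE.
  split.
    apply/(integrable_indicP _ _ mA).
    exact: finite_integral_integrable mqA (fun z => lexx _) fq.
  rewrite -(turn_integral x v e k p1 pn2 hM hg ab he) -/J mulrCA; congr (3 * _).
  rewrite -RintegralZl// (Rintegral_indic _ _ q) (Rintegral_indic _ (angle_gt v
    eps)); congr fine.
  apply: ae_eq_integral => //.
  - exact/measurable_EFinP.
  - apply/measurable_EFinP; apply: measurable_funM => //.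
    exact: measurable_funM.
  - by apply: filterS aeQ => z zE _; rewrite -zE.
have cv := @cvg_averaged_density R p gamma b M x v e k p1 pn2 hM hg ab.
(* The identities of [main] hold for [eps < pi / 2] only, which is enough for a limit at [0]. *)
have near0 : \forall eps \near (0 : R)^'+, 0 < eps < pi / 2.
  near=> eps; apply/andP; split; near: eps; first exact: nbhs_right_gt.
  by apply: nbhs_right_lt; rewrite divr_gt0// pi_gt0.
have cvQ : Qtrunc gamma b F G v eps @[eps --> 0^'+] --> s * (3 *
   lim (\int[@leb6 R]_(z in angle_gt v eps)
    (averaged_density gamma b (M x) v e k (pt z.1) (dir (pt z.2)) *
      \1_(@unit_ball R) z.2) @[eps --> 0^'+])).
  set I := (fun eps => Rintegral _ _ _) in cv *.
  have c3 : s * (3 * I eps) @[eps --> 0^'+] --> s * (3 * lim (I eps @[eps -->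
    0^'+])).
    by apply: cvgM; [exact: cvg_cst|apply: cvgM; [exact: cvg_cst|exact: cv]].
  apply: cvg_trans c3; apply: near_eq_cvg.
  by apply: filterS near0 => eps /main[_ ->].
split; last exact/cvg_lim.
split; last by apply/cvg_ex; eexists; exact: cvQ.
by apply: filterS near0 => eps /main[].
Unshelve. all: by end_near. Qed.

(** A collision moves [v] to [v + w] and [vs] to [vs - w]. Since [psi] is quadratic with isotropic
    Hessian, its increment at [v] has only a linear and a square term in [w], which are those of
    [collision_density]. *)
Lemma Qintegrand_combination (R : realType) (p gamma : R) (b : R -> R)
    (M : 'cV[R]_3 -> 'cV[R]_3 -> R) (c : 'cV[R]_5) (x v vs s : 'cV[R]_3) :
  positive_equilibrium p M -> dotp s s = 1 ->
  let D := collision_density gamma b (M x) v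
    (c 1 0 *: v + spin (tail3 c) *m x) (c 1 0) vs s in
  Qintegrand gamma b (M x) (combination p M c x) v vs s = D /\
  Qintegrand gamma b (combination p M c x) (M x) v vs s = - D.
Proof.
move=> [m [al [A [m0 al0 AT A0 ME]]]] s1 D.
(* The abbreviations are introduced as opaque variables, so that [ring] and [field] treat them as
   atoms. *)
have [z zE] : exists z, z = v - vs by exists (v - vs).
have [n nE] : exists n, n = dir z by exists (dir z).
have [w wE] : exists w, w = (2^-1 * enorm z) *: (s - n).
  by exists ((2^-1 * enorm z) *: (s - n)).
have [q qE] : exists q, q = spin (tail3 c) *m x by eexists.
have zn : enorm z *: n = z by rewrite nE dir_scale.
have v1 : vpost v vs s = v + w.
  rewrite /vpost -zE wE scalerBr -[in RHS]scalerA -[in RHS]scalerA zn zE.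
  by apply/colP => i; rewrite !mxE; field.
have v2 : vspost v vs s = vs - w.
  rewrite /vspost -zE wE scalerBr -[in RHS]scalerA -[in RHS]scalerA zn zE.
  by apply/colP => i; rewrite !mxE; field.
(* For [z = 0] the direction [n] is [0] and not a unit vector; multiplied by [enorm z] the identity
   holds in both cases. *)
have nn : enorm z * dotp n n = enorm z.
  rewrite nE; have [->|z0] := eqVneq z 0; first by rewrite enorm0 mul0r.
  by rewrite dir_dir// mulr1.
have ww : dotp w w = 2^-1 * enorm z ^+ 2 * (1 - dotp n s).
  rewrite wE !(dotpZl, dotpZr, dotpBl, dotpBr) s1 (dotpC s).
  rewrite [LHS](_ : _ = 2^-1 ^+ 2 * enorm z * (enorm z * (1 - 2 * dotp n s) +
    enorm z * dotp n n)); last by ring.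
  by rewrite nn; field.
(* This is conservation of energy: [|v + w|^2 + |vs - w|^2 = |v|^2 + |vs|^2] amounts to
   [z . w = - |w|^2]. *)
have zw : dotp z w = - dotp w w.
  rewrite ww -{1}zn dotpZl wE dotpZr dotpBr.
  rewrite [LHS](_ : _ = 2^-1 * enorm z * (enorm z * dotp n s - enorm z * dotp n
    n)).
    by rewrite nn; ring.
  ring.
have vw : dotp v w = dotp vs w - dotp w w.
  by rewrite -zw zE dotpBl; ring.
have MM : M x (vs - w) * M x (v + w) = M x v * M x vs.
  rewrite !ME mulrACA [RHS]mulrACA -!expRD; congr (_ * expR _).
  rewrite /energy !enorm_sqr !(dotpDl, dotpDr, dotpNl, dotpNr) (dotpC w v)
    (dotpC w vs) vw.
  by field.
have psi1 y t : dotp c (chi p x (y + t)) = dotp c (chi p x y) +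
    dotp (c 1 0 *: y + q) t + c 1 0 / 2 * dotp t t.
  rewrite !dotp_chi -qE /energy !enorm_sqr !(dotpDl, dotpDr, dotpZl) (dotpC t
    y).
  by field.
have e1 : dotp (c 1 0 *: v + q) w + c 1 0 / 2 * dotp w w =
   2^-1 * enorm z * dotp (c 1 0 *: v + q) (s - n) +
   c 1 0 / 4 * enorm z ^+ 2 * (1 - dotp n s).
  by rewrite ww wE dotpZr; field.
(* By conservation of energy and momentum, [psi] loses at [vs] what it gains at [v]. *)
have e2 : dotp (c 1 0 *: vs + q) (- w) + c 1 0 / 2 * dotp (- w) (- w) =
   - (dotp (c 1 0 *: v + q) w + c 1 0 / 2 * dotp w w).
  by rewrite !(dotpDl, dotpZl, dotpNl, dotpNr) vw; field.
have uI : -1 <= dotp n s <= 1 by rewrite nE dotp_itv ?dotp_dir_le1// s1.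
rewrite /Qintegrand /kernelB /D /collision_density v1 v2 -zE -nE -qE clipE
  uI -e1.
rewrite /combination; split.
  rewrite psi1 mulrCA MM; ring.
rewrite psi1 -[_ + _ + c 1 0 / 2 * _]addrA e2.
rewrite [X in _ * (X - _)](_ : _ = (dotp c (chi p x vs) -
  (dotp (c 1 0 *: v + q) w + c 1 0 / 2 * dotp w w)) *
  (M x (vs - w) * M x (v + w))); last by ring.
by rewrite MM; ring.
Qed.

Lemma measurable_combination d (T : measurableType d) (R : realType) (p : R)
    (M : 'cV[R]_3 -> 'cV[R]_3 -> R) (c : 'cV[R]_5) (x : 'cV[R]_3)
    (W : T -> 'cV[R]_3) :
  positive_equilibrium p M -> vmeasurable W ->
  measurable_fun setT (fun t => combination p M c x (W t)).
Proof.
move=> hM mW; have mx : vmeasurable (fun _ : T => x) by exact: vmeasurable_cst.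
apply: measurable_funM; last exact: measurable_equilibrium hM mx mW.
apply: measurable_dotp; first exact: vmeasurable_cst.
by move=> i; exact: measurable_chi.
Qed.

(** [Q_of_density] is applied twice with the same [e] and [k], so the same limit appears with the
    factors [1] and [-1]. *)
Lemma combination_in_kernel (R : realType) (p gamma : R) (b : R -> R)
    (M : 'cV[R]_3 -> 'cV[R]_3 -> R) (c : 'cV[R]_5) :
  1 < p -> p != 2 -> -3 < gamma <= 1 -> angular_kernel b ->
  positive_equilibrium p M -> in_kernel p gamma b M (combination p M c).
Proof.
move=> p1 pn2 hg ab hM x v.
have [gP gx gv tr] := transport_kernel c x v p1 pn2 hM.
split; first by split.
have mM W : vmeasurable W -> measurable_fun setT (M x \o W).
  by move=> mW; apply: measurable_equilibrium hM _ mW; exact: vmeasurable_cst.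
have mh W : vmeasurable W -> measurable_fun setT (combination p M c x \o W).
  by move=> mW; exact: measurable_combination hM mW.
set e := c 1 0 *: v + spin (tail3 c) *m x.
have [c1 Q1] := @Q_of_density R p gamma b M x v e (c 1 0) 1 (M x) (combination p
  M c x)
  p1 pn2 hM hg ab (measurable_Qintegrand gamma v ab (fun W mW => conj (mM _ _ W
    mW) (mh _ _ W mW)))
  (fun z z0 => etrans (@Qintegrand_combination R p gamma b M c x v _ _ hM
    (dir_dir z0)).1
     (esym (mul1r _))).
have [c2 Q2] := @Q_of_density R p gamma b M x v e (c 1 0) (-1) (combination p M
  c x) (M x)
  p1 pn2 hM hg ab (measurable_Qintegrand gamma v ab (fun W mW => conj (mh _ _ W
    mW) (mM _ _ W mW)))
  (fun z z0 => etrans (@Qintegrand_combination R p gamma b M c x v _ _ hM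
    (dir_dir z0)).2
     (esym (mulN1r _))).
by split=> //; rewrite tr Q1 Q2; ring.
Qed.

(** * The projection onto the conserved modes *)

Theorem proposition1p14 (R : realType) (p : R) (hp : 1 < p) (hp2 : p != 2)
    (gamma : R) (hgamma : -3 < gamma <= 1)
    (b : R -> R) (hb : angular_kernel b)
    (M : 'cV[R]_3 -> 'cV[R]_3 -> R) (hM : positive_equilibrium p M) :
  symmetric_posdef (Gram p M) /\
  forall f : 'cV[R]_3 -> 'cV[R]_3 -> R, finite_moments p f ->
    [/\ modes_span p M (Pi p M f),
        moments p (Pi p M f) = moments p f,
        (forall g : 'cV[R]_3 -> 'cV[R]_3 -> R,
           modes_span p M g -> moments p g = moments p f -> g = Pi p M f) &
        in_kernel p gamma b M (Pi p M f)].
Proof.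
have posG := Gram_posdef hp hp2 hM; have GU := posdef_unitmx posG.
split=> // f _; have PiE : Pi p M f = combination p M (coefs p M f) by [].
have spanE (a : 'I_5 -> R) :
    (fun x v => \sum_(i < 5) a i * (chi p x v i 0 * M x v)) =
    combination p M (\col_i a i).
  apply/funext => x; apply/funext => v; rewrite /combination /dotp mulr_suml.
  by apply: eq_bigr => i _; rewrite [(\col__ _) _ _]mxE mulrA.
split.
- exists (fun i => coefs p M f i 0); rewrite spanE PiE; congr combination.
  by apply/colP => i; rewrite mxE.
- by rewrite PiE moments_combination// mulKVmx.
(* Equal moments say that the Gram matrix maps the coefficients of [g] to the moments of [f];
   inverting it recovers [coefs]. *)
- move=> g [a ->]; rewrite spanE moments_combination// => aE.
  by rewrite PiE /coefs -aE mulKmx.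
- by rewrite PiE; exact: combination_in_kernel.
Qed.
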